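(* Let $m\ge 1$ be an integer and let $L(s)=\prod_{p}\prod_{j=1}^{m}(1-c_j(p)p^{-s})^{-1}$ ($s=\sigma+it$, $\sigma>1$, $p$ running over primes), where $|c_j(p)|\le 1$ for all $p,j$. Let $N\ge 16$ be an integer and $0<\delta<7/2$. Assume: (i) $L(s)$ continues analytically to a holomorphic function on $\sigma\ge\sigma_L$ for some $1/2\le\sigma_L<1$ with $\delta<7(1-\sigma_L)$; (ii) $L(s)$ has no zero in $D_{\delta,N}=\{\sigma\ge 1\}\cup\{1-\delta/7\le\sigma<1,\ |t|\le 2(\log N)^3\}$; (iii) $L(s)\ll N^{\gamma_1}(1+|t|)^{\gamma_2}$ for $\sigma_L<\sigma<4$, where $\gamma_1,\gamma_2>0$ are fixed constants. Then for every $A\ge 14/\delta$, \[ L(1)=\Big(1+O_{\delta,A}\Big(\frac{1}{\log\log N}\Big)\Big)\prod_{p\le(\log N)^A}\prod_{j=1}^{m}\big(1-c_j(p)p^{-1}\big)^{-1}. \]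
   Context: Implied constants in $O$ and $\ll$ are allowed to depend on the fixed constants $m,\gamma_1,\gamma_2$; the subscript indicates additional dependence on $\delta$ and $A$. *)

(* Defs.v *)
From Stdlib Require Import Reals.
From Coquelicot Require Import Coquelicot.
From mathcomp Require Import ssreflect ssrfun ssrbool eqtype ssrnat seq fintype bigop prime.

Set Implicit Arguments.
Unset Strict Implicit.
Unset Printing Implicit Defensive.

Local Open Scope C_scope.

Definition Cexp (z : C) : C :=
  ((exp (Re z) * cos (Im z))%R, (exp (Re z) * sin (Im z))%R).

(* [npow p s] is [p^s] with the real branch of [log p]; meaningful for
   [p > 0] only, since [ln 0 = 0]. *)
Definition npow (p : nat) (s : C) : C := Cexp (s * RtoC (ln (INR p))).

Definition euler_factor (m : nat) (c : 'I_m -> nat -> C) (s : C) (p : nat) : C :=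
  \big[Cmult/RtoC 1]_(j < m) / (1 - c j p * npow p (- s)).

Definition euler_upto (m : nat) (c : 'I_m -> nat -> C) (s : C) (n : nat) : C :=
  \big[Cmult/RtoC 1]_(0 <= p < n.+1 | prime p) euler_factor c s p.

(* The infinite product over the primes, taken in increasing order,
   converges to [z]. *)
Definition is_euler_product (m : nat) (c : 'I_m -> nat -> C) (s z : C) : Prop :=
  filterlim (euler_upto c s) eventually (locally z).

(* [floor x] for [0 <= x], and [0] for [x < 0]. *)
Definition natfloor (x : R) : nat := Z.to_nat (Int_part x).

(* On a set that is not open: holomorphic on some open neighbourhood of it. *)
Definition holomorphic_on (D : C -> Prop) (f : C -> C) : Prop :=
  exists U : C -> Prop,
    open U /\ (forall s, D s -> U s) /\ (forall s, U s -> ex_derive f s).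

Definition zero_free_region (delta : R) (N : nat) (s : C) : Prop :=
  (1 <= Re s \/
   (1 - delta / 7 <= Re s < 1 /\ Rabs (Im s) <= 2 * ln (INR N) ^ 3))%R.

(* Main.v *)
Require Import Defs.
From Stdlib Require Import Reals Lra Lia Psatz ZArith ClassicalEpsilon.
From Coquelicot Require Import Coquelicot.

(** Put [eta = delta/7], [l = log N], [T = l^(3/4)], [Y = floor(l^A)] and shift
    the variable to [z = s - 1].  On the rectangle where [L(1+z)] has no zero let
    [F] be its holomorphic logarithm that agrees with the logarithm of the Euler
    product for [Re z > 0].  If [E] is [F] minus the logarithms of the Euler
    factors at the primes [p <= Y], then [L(1)] is [exp E(0)] times the partial
    product, and [E(0)] is bounded by integrating [E(z) Y^z (1/z + z/T^2)]
    around the boundary of [[-eta', T] x [-T, T]], with [eta' = 15 eta/16].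
    As in Newman's proof of the prime number theorem, the factor
    [1/z + z/T^2] is [O(|Re z| / T^2)] on the horizontal sides, which compensates
    the bound [|E(z) Y^z| << 1/Re z] to the right of the imaginary axis.  To its
    left, [E] is split: the Dirichlet polynomial [sum_(p <= Y) a_p p^(-1-z)] is
    moved to [Re z = -T], where the symmetric bound holds, and what remains is
    [O(l)] by the Borel-Caratheodory inequality, hence contributes
    [O(l T Y^(-eta') + l/T^2)].  Altogether [E(0) << l^(-1/8)]. *)

Set Bullet Behavior "Strict Subproofs".
Local Open Scope R_scope.

(** * Complex differentiability *)

(** The growth hypothesis gives no better than [O(l)] for the logarithm of [L] left of the imaginary
    axis, so every saving there must be a power of [l] greater than the first. On the left side the
    saving can only come from [Y], and this is where [A >= 14/delta], that is [A eta >= 2], is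
    spent. About the coefficients only [|a_p| <= m] is used: sums over primes are majorised by sums
    over all integers, and the resulting factor [1/Re z] is what the kernel absorbs. The gap between
    [eta'] and [eta] is the room that Borel-Caratheodory needs, while [T] stays well below the
    height [2 l^3] of the zero-free region. The implied constant has to be fixed before the [c_j],
    [L], [N] and [sigma_L], so all bounds carry explicit constants. The complex analysis rests on
    Goursat for rectangles with one exceptional point, where mere continuity is required. This makes
    difference quotients admissible integrands and yields Cauchy's formula. The integral of the
    Cauchy kernel is found by a conjugation trick on circles, and is only bounded below on
    rectangles. *)

Definition ccont (f : C -> C) (z : C) : Prop :=
  forall e, 0 < e -> exists d, 0 < d /\
    forall w, Cmod (w - z) < d -> Cmod (f w - f z) < e.

(* Caratheodory's form: the slope of [f] at [z] extends continuously to [z].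
   The product and chain rules become algebraic. *)
Definition cderiv (f : C -> C) (z l : C) : Prop :=
  exists phi : C -> C, ccont phi z /\ phi z = l /\
  exists d, 0 < d /\
    forall w, Cmod (w - z) < d -> f w = (f z + phi w * (w - z))%C.

Lemma Cmod_minus_sym (a b : C) : Cmod (a - b) = Cmod (b - a).
Proof. rewrite <- Cmod_opp. f_equal. ring. Qed.

Lemma Cmod_triangle_minus (a b c : C) : Cmod (a - c) <= Cmod (a - b) + Cmod (b - c).
Proof. replace (a - c)%C with ((a - b) + (b - c))%C by ring. apply Cmod_triangle. Qed.

Lemma Cmod_le_minus (a b : C) : Cmod a <= Cmod b + Cmod (a - b).
Proof. replace a with (b + (a - b))%C at 1 by ring. apply Cmod_triangle. Qed.

Lemma Cmod_diag (z : C) : Cmod (z - z) = 0.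
Proof. replace (z - z)%C with (RtoC 0) by ring. apply Cmod_0. Qed.

Lemma Cminus_neq_0 (a b : C) : a <> b -> (a - b)%C <> 0.
Proof. intros H E. apply H. replace a with ((a - b) + b)%C by ring. rewrite E. ring. Qed.

Lemma ccont_const (a z : C) : ccont (fun _ => a) z.
Proof. intros e He. exists 1. split; [lra|]. intros w _. rewrite Cmod_diag. exact He. Qed.

Lemma ccont_id (z : C) : ccont (fun w => w) z.
Proof. intros e He. exists e. split; [exact He|]. intros w Hw. exact Hw. Qed.

Lemma ccont_ext_loc (f g : C -> C) (z : C) (d : R) : 0 < d ->
  (forall w, Cmod (w - z) < d -> f w = g w) -> ccont f z -> ccont g z.
Proof.
  intros Hd Hfg Hf e He. destruct (Hf e He) as [d' [Hd' H]].
  exists (Rmin d d'). split; [now apply Rmin_glb_lt|]. intros w Hw.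
  rewrite <- Hfg; [|eapply Rlt_le_trans; [exact Hw | apply Rmin_l]].
  rewrite <- Hfg; [|rewrite Cmod_diag; exact Hd].
  apply H. eapply Rlt_le_trans; [exact Hw | apply Rmin_r].
Qed.

Lemma ccont_ext (f g : C -> C) (z : C) : (forall w, f w = g w) -> ccont f z -> ccont g z.
Proof. intros H. apply (ccont_ext_loc f g z 1); [lra | intros; apply H]. Qed.

Lemma ccont_plus (f g : C -> C) (z : C) :
  ccont f z -> ccont g z -> ccont (fun w => f w + g w)%C z.
Proof.
  intros Hf Hg e He.
  destruct (Hf (e/2)) as [d1 [Hd1 H1]]; [lra|]. destruct (Hg (e/2)) as [d2 [Hd2 H2]]; [lra|].
  exists (Rmin d1 d2). split; [now apply Rmin_glb_lt|]. intros w Hw.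
  assert (A1 := H1 w (Rlt_le_trans _ _ _ Hw (Rmin_l _ _))).
  assert (A2 := H2 w (Rlt_le_trans _ _ _ Hw (Rmin_r _ _))).
  replace (f w + g w - (f z + g z))%C with ((f w - f z) + (g w - g z))%C by ring.
  pose proof (Cmod_triangle (f w - f z) (g w - g z)). lra.
Qed.

Lemma ccont_mult (f g : C -> C) (z : C) :
  ccont f z -> ccont g z -> ccont (fun w => f w * g w)%C z.
Proof.
  intros Hf Hg e He.
  set (A := Cmod (f z) + 1). set (B := Cmod (g z) + 1).
  assert (HA : 0 < A) by (unfold A; pose proof (Cmod_ge_0 (f z)); lra).
  assert (HB : 0 < B) by (unfold B; pose proof (Cmod_ge_0 (g z)); lra).
  destruct (Hf (Rmin 1 (e/(2*B)))) as [d1 [Hd1 H1]].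
  { apply Rmin_glb_lt; [lra|]. apply Rdiv_lt_0_compat; lra. }
  destruct (Hg (e/(2*A))) as [d2 [Hd2 H2]]. { apply Rdiv_lt_0_compat; lra. }
  exists (Rmin d1 d2). split; [now apply Rmin_glb_lt|]. intros w Hw.
  assert (A1 := H1 w (Rlt_le_trans _ _ _ Hw (Rmin_l _ _))).
  assert (A2 := H2 w (Rlt_le_trans _ _ _ Hw (Rmin_r _ _))).
  replace (f w * g w - f z * g z)%C with (f w * (g w - g z) + (f w - f z) * g z)%C by ring.
  eapply Rle_lt_trans; [apply Cmod_triangle|]. rewrite !Cmod_mult.
  assert (Hfw : Cmod (f w) <= A).
  { pose proof (Cmod_le_minus (f w) (f z)). pose proof (Rmin_l 1 (e/(2*B))). unfold A. lra. }
  assert (L1 : Cmod (f w) * Cmod (g w - g z) <= A * Cmod (g w - g z)).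
  { apply Rmult_le_compat_r; [apply Cmod_ge_0 | exact Hfw]. }
  assert (L2 : A * Cmod (g w - g z) < A * (e / (2 * A))) by (now apply Rmult_lt_compat_l).
  assert (L3 : Cmod (f w - f z) * Cmod (g z) <= e/(2*B) * B).
  { pose proof (Rmin_r 1 (e/(2*B))). apply Rmult_le_compat; try apply Cmod_ge_0; [lra|unfold B; lra]. }
  replace (A * (e / (2 * A))) with (e/2) in L2 by (field; lra).
  replace (e / (2 * B) * B) with (e/2) in L3 by (field; lra). lra.
Qed.

Lemma ccont_opp (f : C -> C) (z : C) : ccont f z -> ccont (fun w => - f w)%C z.
Proof.
  intros H. apply (ccont_ext (fun w => (- 1) * f w)%C).
  - intros w. ring.
  - apply ccont_mult; [apply ccont_const | exact H].
Qed.

Lemma ccont_minus (f g : C -> C) (z : C) :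
  ccont f z -> ccont g z -> ccont (fun w => f w - g w)%C z.
Proof. intros Hf Hg. apply ccont_plus; [exact Hf | now apply ccont_opp]. Qed.

Lemma ccont_comp (f g : C -> C) (z : C) :
  ccont g z -> ccont f (g z) -> ccont (fun w => f (g w)) z.
Proof.
  intros Hg Hf e He. destruct (Hf e He) as [d [Hd H]]. destruct (Hg d Hd) as [d' [Hd' H']].
  exists d'. split; [exact Hd'|]. intros w Hw. apply H, H', Hw.
Qed.

Lemma ccont_neq_0 (f : C -> C) (z : C) : ccont f z -> f z <> 0%C ->
  exists d, 0 < d /\ forall w, Cmod (w - z) < d -> Cmod (f z) / 2 <= Cmod (f w) /\ f w <> 0%C.
Proof.
  intros Hf Hz. apply Cmod_gt_0 in Hz. destruct (Hf (Cmod (f z) / 2)) as [d [Hd H]]; [lra|].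
  exists d. split; [exact Hd|]. intros w Hw. specialize (H w Hw).
  pose proof (Cmod_le_minus (f z) (f w)). rewrite Cmod_minus_sym in H0.
  split; [lra|]. apply Cmod_gt_0. lra.
Qed.

Lemma ccont_inv (f : C -> C) (z : C) : ccont f z -> f z <> 0%C -> ccont (fun w => / f w)%C z.
Proof.
  intros Hf Hz e He. destruct (ccont_neq_0 f z Hf Hz) as [d1 [Hd1 H1]].
  assert (Hm := proj1 (Cmod_gt_0 _) Hz). set (m := Cmod (f z)) in *.
  destruct (Hf (e * (m * m / 2))) as [d2 [Hd2 H2]]. { apply Rmult_lt_0_compat; nra. }
  exists (Rmin d1 d2). split; [now apply Rmin_glb_lt|]. intros w Hw.
  destruct (H1 w (Rlt_le_trans _ _ _ Hw (Rmin_l _ _))) as [B1 B2].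
  assert (A2 := H2 w (Rlt_le_trans _ _ _ Hw (Rmin_r _ _))).
  replace (/ f w - / f z)%C with ((f z - f w) * / (f w * f z))%C by (field; split; assumption).
  rewrite Cmod_mult, Cmod_inv, Cmod_mult, Cmod_minus_sym; [|now apply Cmult_neq_0]. fold m.
  assert (0 < Cmod (f w) * m) by nra.
  apply Rmult_lt_reg_r with (Cmod (f w) * m); [assumption|].
  rewrite Rmult_assoc, Rinv_l, Rmult_1_r by lra.
  eapply Rlt_le_trans; [exact A2|]. apply Rmult_le_compat_l; [lra|]. nra.
Qed.

Lemma ccont_div (f g : C -> C) (z : C) :
  ccont f z -> ccont g z -> g z <> 0%C -> ccont (fun w => f w / g w)%C z.
Proof. intros Hf Hg Hz. apply ccont_mult; [exact Hf | now apply ccont_inv]. Qed.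

Lemma cderiv_ccont (f : C -> C) (z l : C) : cderiv f z l -> ccont f z.
Proof.
  intros [phi [Hphi [_ [d [Hd H]]]]].
  apply (ccont_ext_loc (fun w => f z + phi w * (w - z))%C f z d Hd).
  { intros w Hw. symmetry. now apply H. }
  apply ccont_plus; [apply ccont_const|]. apply ccont_mult; [exact Hphi|].
  apply ccont_minus; [apply ccont_id | apply ccont_const].
Qed.

Lemma cderiv_eq (f : C -> C) (z l l' : C) : cderiv f z l -> l = l' -> cderiv f z l'.
Proof. now intros H <-. Qed.

Lemma cderiv_ext_loc (f g : C -> C) (z l : C) (d : R) : 0 < d ->
  (forall w, Cmod (w - z) < d -> f w = g w) -> cderiv f z l -> cderiv g z l.
Proof.
  intros Hd Hfg [phi [Hphi [Hl [d' [Hd' H]]]]].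
  exists phi. split; [exact Hphi|]. split; [exact Hl|].
  exists (Rmin d d'). split; [now apply Rmin_glb_lt|]. intros w Hw.
  rewrite <- Hfg; [|eapply Rlt_le_trans; [exact Hw | apply Rmin_l]].
  rewrite <- Hfg; [|rewrite Cmod_diag; exact Hd].
  apply H. eapply Rlt_le_trans; [exact Hw | apply Rmin_r].
Qed.

Lemma cderiv_ext (f g : C -> C) (z l : C) :
  (forall w, f w = g w) -> cderiv f z l -> cderiv g z l.
Proof. intros H. apply (cderiv_ext_loc f g z l 1); [lra | intros; apply H]. Qed.

Lemma cderiv_const (a z : C) : cderiv (fun _ => a) z 0.
Proof.
  exists (fun _ => RtoC 0). split; [apply ccont_const|]. split; [reflexivity|].
  exists 1. split; [lra|]. intros. ring.
Qed.

Lemma cderiv_id (z : C) : cderiv (fun w => w) z 1.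
Proof.
  exists (fun _ => RtoC 1). split; [apply ccont_const|]. split; [reflexivity|].
  exists 1. split; [lra|]. intros. ring.
Qed.

Lemma cderiv_plus (f g : C -> C) (z l l' : C) :
  cderiv f z l -> cderiv g z l' -> cderiv (fun w => f w + g w)%C z (l + l').
Proof.
  intros [phi [Hphi [Hl [d [Hd H]]]]] [psi [Hpsi [Hl' [d' [Hd' H']]]]].
  exists (fun w => phi w + psi w)%C. split; [now apply ccont_plus|].
  split; [now rewrite Hl, Hl'|].
  exists (Rmin d d'). split; [now apply Rmin_glb_lt|]. intros w Hw.
  rewrite (H w), (H' w). ring.
  - eapply Rlt_le_trans; [exact Hw | apply Rmin_r].
  - eapply Rlt_le_trans; [exact Hw | apply Rmin_l].
Qed.

Lemma cderiv_mult (f g : C -> C) (z l l' : C) :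
  cderiv f z l -> cderiv g z l' -> cderiv (fun w => f w * g w)%C z (l * g z + f z * l').
Proof.
  intros Hf Hg. assert (Cg := cderiv_ccont _ _ _ Hg). revert Hf Hg.
  intros [phi [Hphi [Hl [d [Hd H]]]]] [psi [Hpsi [Hl' [d' [Hd' H']]]]].
  exists (fun w => phi w * g w + f z * psi w)%C. split.
  { apply ccont_plus; apply ccont_mult; auto. apply ccont_const. }
  split; [now rewrite Hl, Hl'|].
  exists (Rmin d d'). split; [now apply Rmin_glb_lt|]. intros w Hw.
  rewrite (H w), (H' w). ring.
  - eapply Rlt_le_trans; [exact Hw | apply Rmin_r].
  - eapply Rlt_le_trans; [exact Hw | apply Rmin_l].
Qed.

Lemma cderiv_opp (f : C -> C) (z l : C) : cderiv f z l -> cderiv (fun w => - f w)%C z (- l).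
Proof.
  intros H. apply (cderiv_ext (fun w => (- 1) * f w)%C).
  - intros w. ring.
  - eapply cderiv_eq; [apply cderiv_mult; [apply cderiv_const | exact H]|].
    cbv beta. ring.
Qed.

Lemma cderiv_minus (f g : C -> C) (z l l' : C) :
  cderiv f z l -> cderiv g z l' -> cderiv (fun w => f w - g w)%C z (l - l').
Proof. intros Hf Hg. apply cderiv_plus; [exact Hf | now apply cderiv_opp]. Qed.

Lemma cderiv_comp (f g : C -> C) (z l l' : C) :
  cderiv f (g z) l -> cderiv g z l' -> cderiv (fun w => f (g w)) z (l * l').
Proof.
  intros Hf Hg. assert (Cg := cderiv_ccont _ _ _ Hg). revert Hf Hg.
  intros [phi [Hphi [Hl [d [Hd H]]]]] [psi [Hpsi [Hl' [d' [Hd' H']]]]].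
  destruct (Cg d Hd) as [d2 [Hd2 H2]].
  exists (fun w => phi (g w) * psi w)%C. split.
  { apply ccont_mult; [now apply ccont_comp | exact Hpsi]. }
  split; [now rewrite Hl, Hl'|].
  exists (Rmin d' d2). split; [now apply Rmin_glb_lt|]. intros w Hw.
  rewrite (H (g w)).
  - rewrite (H' w) at 2; [ring|]. eapply Rlt_le_trans; [exact Hw | apply Rmin_l].
  - apply H2. eapply Rlt_le_trans; [exact Hw | apply Rmin_r].
Qed.

Lemma cderiv_inv (f : C -> C) (z l : C) : f z <> 0%C ->
  cderiv f z l -> cderiv (fun w => / f w)%C z (- l / (f z * f z)).
Proof.
  intros Hz Hf. assert (Cf := cderiv_ccont _ _ _ Hf). destruct Hf as [phi [Hphi [Hl [d [Hd H]]]]].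
  destruct (ccont_neq_0 f z Cf Hz) as [d1 [Hd1 H1]].
  exists (fun w => - phi w / (f w * f z))%C. split.
  { apply ccont_div; [now apply ccont_opp| |now apply Cmult_neq_0].
    apply ccont_mult; [exact Cf | apply ccont_const]. }
  split; [now rewrite Hl|].
  exists (Rmin d d1). split; [now apply Rmin_glb_lt|]. intros w Hw.
  destruct (H1 w (Rlt_le_trans _ _ _ Hw (Rmin_r _ _))) as [_ B2].
  assert (E := H w (Rlt_le_trans _ _ _ Hw (Rmin_l _ _))).
  assert (E2 : (phi w * (w - z) = f w - f z)%C) by (rewrite E; ring).
  replace (- phi w / (f w * f z) * (w - z))%C with (- (phi w * (w - z)) / (f w * f z))%C
    by (field; split; assumption).
  rewrite E2. field. split; assumption.
Qed.

Lemma cderiv_div (f g : C -> C) (z l l' : C) : g z <> 0%C ->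
  cderiv f z l -> cderiv g z l' ->
  cderiv (fun w => f w / g w)%C z ((l * g z - f z * l') / (g z * g z)).
Proof.
  intros Hz Hf Hg. eapply cderiv_eq.
  - apply cderiv_mult; [exact Hf | apply cderiv_inv; [exact Hz | exact Hg]].
  - cbv beta; field. exact Hz.
Qed.

(** The little-o form. Together with the converse [cderiv_of_estimate] it lets estimates of
    integrals and the algebraic rules above serve the same notion of derivative. *)
Lemma cderiv_estimate (f : C -> C) (z l : C) : cderiv f z l ->
  forall e, 0 < e -> exists d, 0 < d /\ forall w, Cmod (w - z) < d ->
    Cmod (f w - f z - l * (w - z)) <= e * Cmod (w - z).
Proof.
  intros [phi [Hphi [Hl [d [Hd H]]]]] e He.
  destruct (Hphi e He) as [d1 [Hd1 H1]].
  exists (Rmin d d1). split; [now apply Rmin_glb_lt|]. intros w Hw.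
  rewrite (H w (Rlt_le_trans _ _ _ Hw (Rmin_l _ _))), <- Hl.
  replace (f z + phi w * (w - z) - f z - phi z * (w - z))%C
    with ((phi w - phi z) * (w - z))%C by ring.
  rewrite Cmod_mult. apply Rmult_le_compat_r; [apply Cmod_ge_0|].
  left. apply H1. eapply Rlt_le_trans; [exact Hw | apply Rmin_r].
Qed.

Lemma Cdiv_le (a b : C) (e : R) : b <> 0%C -> Cmod a <= e * Cmod b -> Cmod (a / b) <= e.
Proof.
  intros Hb H. rewrite Cmod_div by exact Hb. assert (Hm := proj1 (Cmod_gt_0 _) Hb).
  apply Rmult_le_reg_r with (Cmod b); [exact Hm|]. unfold Rdiv.
  rewrite Rmult_assoc, Rinv_l, Rmult_1_r by lra. exact H.
Qed.

(** Continuous at [z] exactly when [l] is the derivative there. Besides being Caratheodory's slope,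
    it is the integrand with a removable singularity behind Cauchy's formula and the residue
    bound. *)
Definition dslope (f : C -> C) (z l w : C) : C :=
  if Ceq_dec w z then l else ((f w - f z) / (w - z))%C.

Lemma dslope_eq (f : C -> C) (z l : C) : dslope f z l z = l.
Proof. unfold dslope. now destruct (Ceq_dec z z). Qed.

Lemma dslope_neq (f : C -> C) (z l w : C) : w <> z ->
  dslope f z l w = ((f w - f z) / (w - z))%C.
Proof. intros H. unfold dslope. now destruct (Ceq_dec w z). Qed.

Lemma dslope_ccont (f : C -> C) (z l : C) :
  (forall e, 0 < e -> exists d, 0 < d /\ forall w, Cmod (w - z) < d ->
    Cmod (f w - f z - l * (w - z)) <= e * Cmod (w - z)) ->
  ccont (dslope f z l) z.
Proof.
  intros H e He. destruct (H (e/2)) as [d [Hd H1]]; [lra|].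
  exists d. split; [exact Hd|]. intros w Hw. rewrite dslope_eq.
  destruct (Ceq_dec w z) as [->|Hwz].
  - rewrite dslope_eq, Cmod_diag. exact He.
  - rewrite dslope_neq by exact Hwz. apply Rle_lt_trans with (e/2); [|lra].
    assert (Hn := Cminus_neq_0 _ _ Hwz).
    replace ((f w - f z) / (w - z) - l)%C with ((f w - f z - l * (w - z)) / (w - z))%C
      by (field; exact Hn).
    apply Cdiv_le; [exact Hn | now apply H1].
Qed.

Lemma cderiv_of_estimate (f : C -> C) (z l : C) :
  (forall e, 0 < e -> exists d, 0 < d /\ forall w, Cmod (w - z) < d ->
    Cmod (f w - f z - l * (w - z)) <= e * Cmod (w - z)) ->
  cderiv f z l.
Proof.
  intros H. exists (dslope f z l). split; [now apply dslope_ccont|].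
  split; [apply dslope_eq|]. exists 1. split; [lra|]. intros w _.
  destruct (Ceq_dec w z) as [->|Hwz]; [ring|]. rewrite dslope_neq by exact Hwz.
  field. now apply Cminus_neq_0.
Qed.

(** The one place where Coquelicot's complex derivative enters: hypothesis (i) speaks of
    [ex_derive], while the proof works with [cderiv]. *)
Lemma cderiv_of_is_derive (f : C -> C) (z : C) :
  ex_derive (K := C_AbsRing) (V := C_NormedModule) f z -> exists l, cderiv f z l.
Proof.
  intros [l [_ Hl]]. exists l. apply cderiv_of_estimate. intros e He.
  destruct (Hl z (fun P H => H) (mkposreal e He)) as [d Hd].
  exists d. split; [apply cond_pos|]. intros w Hw. specialize (Hd w Hw).
  unfold norm, minus, plus, opp, scal in Hd; simpl in Hd.
  unfold mult in Hd; simpl in Hd.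
  replace (f w - f z - l * (w - z))%C with (f w + - f z + - ((w + - z) * l))%C by ring.
  exact Hd.
Qed.

(** * The exponential, and integrals of complex functions *)

Lemma im_le_Cmod (c : C) : Rabs (Im c) <= Cmod c.
Proof. pose proof (Rmax_Cmod c). pose proof (Rmax_r (Rabs (fst c)) (Rabs (snd c))). unfold Im. lra. Qed.

Lemma Cmod_le_re_im (c : C) : Cmod c <= Rabs (Re c) + Rabs (Im c).
Proof.
  rewrite (surjective_pairing c) at 1. change (fst c) with (Re c). change (snd c) with (Im c).
  replace (Re c, Im c) with (RtoC (Re c) + Ci * RtoC (Im c))%C.
  - eapply Rle_trans; [apply Cmod_triangle|]. rewrite Cmod_mult, Cmod_Ci, !Cmod_R. lra.
  - unfold Ci, RtoC, Cplus, Cmult. simpl. f_equal; ring.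
Qed.

Lemma Cexp_plus (a b : C) : Cexp (a + b) = (Cexp a * Cexp b)%C.
Proof.
  destruct a as [a1 a2], b as [b1 b2]. unfold Cexp, Cmult, Cplus, Re, Im; simpl.
  rewrite exp_plus, cos_plus, sin_plus. f_equal; ring.
Qed.

Lemma Cexp_0 : Cexp 0 = 1%C.
Proof. unfold Cexp, Re, Im; simpl. rewrite exp_0, cos_0, sin_0. unfold RtoC. f_equal; ring. Qed.

Lemma Cexp_neq_0 (a : C) : Cexp a <> 0%C.
Proof.
  intros H. assert (E : (Cexp a * Cexp (- a))%C = 1%C).
  { rewrite <- Cexp_plus, <- Cexp_0. f_equal. ring. }
  rewrite H in E. apply (f_equal fst) in E. simpl in E. lra.
Qed.

Lemma Cexp_opp (a : C) : Cexp (- a) = (/ Cexp a)%C.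
Proof.
  assert (E : (Cexp a * Cexp (- a))%C = 1%C).
  { rewrite <- Cexp_plus, <- Cexp_0. f_equal. ring. }
  replace (Cexp (- a)) with (/ Cexp a * (Cexp a * Cexp (- a)))%C
    by (field; apply Cexp_neq_0). rewrite E. ring.
Qed.

Lemma Cmod_Cexp (a : C) : Cmod (Cexp a) = exp (Re a).
Proof.
  unfold Cexp, Cmod; simpl.
  replace (_ + _) with (exp (Re a) ^ 2 * (Rsqr (sin (Im a)) + Rsqr (cos (Im a))))
    by (unfold Rsqr; ring).
  rewrite sin2_cos2, Rmult_1_r. apply sqrt_pow2. left. apply exp_pos.
Qed.

Lemma derivable_estimate (f : R -> R) (x l : R) : derivable_pt_lim f x l ->
  forall e, 0 < e -> exists d, 0 < d /\ forall h, Rabs h < d ->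
    Rabs (f (x + h) - f x - l * h) <= e * Rabs h.
Proof.
  intros H e He. destruct (H e He) as [d Hd]. exists d. split; [apply cond_pos|].
  intros h Hh. destruct (Req_dec h 0) as [->|Hn].
  - replace (f (x + 0) - f x - l * 0) with 0 by (rewrite Rplus_0_r; ring).
    rewrite Rabs_R0. lra.
  - specialize (Hd h Hn Hh).
    replace (f (x + h) - f x - l * h) with (((f (x + h) - f x) / h - l) * h) by (field; exact Hn).
    rewrite Rabs_mult. apply Rmult_le_compat_r; [apply Rabs_pos | lra].
Qed.

Lemma Cexp_cderiv_0 : cderiv Cexp 0 1.
Proof.
  apply cderiv_of_estimate. intros e He.
  set (e1 := Rmin 1 (e / 8)).
  assert (He1 : 0 < e1) by (apply Rmin_glb_lt; lra).
  assert (He1a : e1 <= 1) by apply Rmin_l. assert (He1b : e1 <= e / 8) by apply Rmin_r. clearbody e1.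
  destruct (derivable_estimate _ _ _ derivable_pt_lim_exp_0 e1 He1) as [d1 [Hd1 H1]].
  destruct (derivable_estimate _ _ _ (derivable_pt_lim_cos 0) e1 He1) as [d2 [Hd2 H2]].
  destruct (derivable_estimate _ _ _ (derivable_pt_lim_sin 0) e1 He1) as [d3 [Hd3 H3]].
  exists (Rmin e1 (Rmin d1 (Rmin d2 d3))). split; [repeat apply Rmin_glb_lt; assumption|].
  intros w Hw. rewrite Cexp_0. replace (w - 0)%C with w in * by ring.
  destruct w as [x y].
  assert (Hx := re_le_Cmod (x, y)). assert (Hy := im_le_Cmod (x, y)). simpl in Hx, Hy.
  pose proof (Cmod_ge_0 (x, y)) as Hm. set (m := Cmod (x, y)) in *.
  assert (B0 : m < e1) by (eapply Rlt_le_trans; [exact Hw | apply Rmin_l]).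
  assert (B : m < Rmin d1 (Rmin d2 d3)) by (eapply Rlt_le_trans; [exact Hw | apply Rmin_r]).
  assert (B1 : m < d1) by (eapply Rlt_le_trans; [exact B | apply Rmin_l]).
  assert (B' : m < Rmin d2 d3) by (eapply Rlt_le_trans; [exact B | apply Rmin_r]).
  assert (B2 : m < d2) by (eapply Rlt_le_trans; [exact B' | apply Rmin_l]).
  assert (B3 : m < d3) by (eapply Rlt_le_trans; [exact B' | apply Rmin_r]).
  specialize (H1 x ltac:(lra)). specialize (H2 y ltac:(lra)). specialize (H3 y ltac:(lra)).
  rewrite ?Rplus_0_l, ?exp_0, ?cos_0, ?sin_0 in *.
  replace (cos y - 1 - - 0 * y) with (cos y - 1) in H2 by ring.
  replace (sin y - 0 - 1 * y) with (sin y - y) in H3 by ring.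
  replace (exp x - 1 - 1 * x) with (exp x - 1 - x) in H1 by ring.
  (* The remainder is split so that each term contains one of the three real remainders or the
     product [x y]. With [m = |w|] they are at most [e1 m], [4 e1 m] and [e1 m], hence [e / 8]
     suffices for [e1]. *)
  replace (Cexp (x, y) - 1 - 1 * (x, y))%C
    with (RtoC (exp x - 1 - x)%R * (cos y, sin y) + RtoC (1 + x)%R * ((cos y - 1)%R, (sin y - y)%R)
          + (0%R, (x * y)%R))%C.
  2:{ unfold Cexp, RtoC, Cplus, Cmult, Cminus, Copp, Re, Im; apply injective_projections; simpl; ring. }
  eapply Rle_trans; [apply Cmod_triangle|].
  eapply Rle_trans; [apply Rplus_le_compat_r, Cmod_triangle|].
  rewrite !Cmod_mult, !Cmod_R.
  assert (A1 : Cmod (cos y, sin y) = 1).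
  { unfold Cmod; simpl. rewrite !Rmult_1_r. replace (cos y * cos y + sin y * sin y) with 1.
    apply sqrt_1. pose proof (sin2_cos2 y). unfold Rsqr in *. lra. }
  assert (A2 : Cmod (cos y - 1, sin y - y) <= 2 * e1 * m).
  { eapply Rle_trans; [apply Cmod_le_re_im|]. simpl.
    assert (e1 * Rabs y <= e1 * m) by (apply Rmult_le_compat_l; lra). lra. }
  assert (A3 : Cmod (0, x * y) <= e1 * m).
  { eapply Rle_trans; [apply Cmod_le_re_im|]. simpl. rewrite Rabs_R0, Rabs_mult.
    assert (Rabs x * Rabs y <= e1 * m); [|lra].
    apply Rmult_le_compat; try apply Rabs_pos; lra. }
  rewrite A1.
  assert (A4 : Rabs (1 + x) <= 2).
  { pose proof (Rabs_triang 1 x). rewrite Rabs_R1 in *. lra. }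
  assert (A5 : Rabs (1 + x) * Cmod (cos y - 1, sin y - y) <= 2 * (2 * e1 * m)).
  { apply Rmult_le_compat; [apply Rabs_pos | apply Cmod_ge_0 | exact A4 | exact A2]. }
  assert (A6 : e1 * Rabs x <= e1 * m) by (apply Rmult_le_compat_l; lra).
  assert (A7 : e1 * m <= e / 8 * m) by (apply Rmult_le_compat_r; lra).
  assert (0 <= e * m) by nra. lra.
Qed.

Lemma Cexp_cderiv (z : C) : cderiv Cexp z (Cexp z).
Proof.
  apply (cderiv_ext (fun w => Cexp z * Cexp (w - z))%C).
  { intros w. rewrite <- Cexp_plus. f_equal. ring. }
  eapply cderiv_eq.
  - apply cderiv_mult; [apply cderiv_const|].
    apply (cderiv_comp Cexp (fun w => w - z)%C).
    + replace (z - z)%C with (RtoC 0) by ring. apply Cexp_cderiv_0.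
    + apply cderiv_minus; [apply cderiv_id | apply cderiv_const].
  - cbv beta. ring.
Qed.

Lemma norm_CR (c : C) : norm (V := C_R_NormedModule) c = Cmod c.
Proof.
  unfold norm; simpl. unfold prod_norm, norm; simpl. unfold Cmod, abs; simpl.
  f_equal. pose proof (pow2_abs (fst c)). pose proof (pow2_abs (snd c)). simpl in *. lra.
Qed.

Lemma ccont_continuous (f : C -> C) (t : R) : ccont f (RtoC t) ->
  continuous (U := C_R_NormedModule) (fun u : R => f (RtoC u)) t.
Proof.
  intros H. apply filterlim_locally. intros eps.
  destruct (H eps (cond_pos eps)) as [d [Hd H1]]. exists (mkposreal d Hd).
  intros u Hu. specialize (H1 (RtoC u)).
  assert (Hc : Cmod (RtoC u - RtoC t) < d).
  { rewrite <- RtoC_minus, Cmod_R. exact Hu. }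
  specialize (H1 Hc). split.
  - eapply Rle_lt_trans; [|exact H1].
    apply (re_le_Cmod (f (RtoC u) - f (RtoC t))%C).
  - eapply Rle_lt_trans; [|exact H1].
    apply (im_le_Cmod (f (RtoC u) - f (RtoC t))%C).
Qed.

Lemma cderiv_is_derive (f : C -> C) (t : R) (l : C) : cderiv f (RtoC t) l ->
  is_derive (V := C_R_NormedModule) (fun u : R => f (RtoC u)) t l.
Proof.
  intros H. split; [apply is_linear_scal_l|]. intros x Hx.
  apply (is_filter_lim_locally_unique (V := AbsRing_NormedModule R_AbsRing)) in Hx. subst x.
  intros eps. destruct (cderiv_estimate _ _ _ H eps (cond_pos eps)) as [d [Hd H1]].
  exists (mkposreal d Hd). intros u Hu. specialize (H1 (RtoC u)).
  assert (Ec : Cmod (RtoC u - RtoC t) = Rabs (u - t)) by (rewrite <- RtoC_minus; apply Cmod_R).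
  rewrite Ec in H1. specialize (H1 Hu).
  rewrite norm_CR.
  replace (minus _ _) with (f u - f t - l * (u - t))%C; [exact H1|].
  unfold minus, plus, opp, scal; simpl. unfold prod_plus, prod_opp, prod_scal, scal; simpl.
  unfold mult, plus, opp; simpl.
  rewrite (surjective_pairing l), (surjective_pairing (f u)), (surjective_pairing (f t)).
  unfold Cminus, Cplus, Cmult, Copp, RtoC; simpl. f_equal; ring.
Qed.

(** The integrand takes a complex argument although only real points matter: paths such as
    [t + Ci * y] are then entire in [t], and [ccont_comp] and [cderiv_comp] apply to them as they
    stand. *)
Definition cint (f : C -> C) (a b : R) : C :=
  RInt (V := C_R_CompleteNormedModule) (fun t : R => f (RtoC t)) a b.

Definition ccont_seg (f : C -> C) (a b : R) : Prop :=
  forall t, Rmin a b <= t <= Rmax a b -> ccont f (RtoC t).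

Lemma cint_is (f : C -> C) (a b : R) : ccont_seg f a b ->
  is_RInt (V := C_R_NormedModule) (fun t : R => f (RtoC t)) a b (cint f a b).
Proof.
  intros H. apply (RInt_correct (V := C_R_CompleteNormedModule)).
  apply (ex_RInt_continuous (V := C_R_CompleteNormedModule)).
  intros t Ht. apply ccont_continuous. now apply H.
Qed.

Lemma cint_unique (f : C -> C) (a b : R) (l : C) :
  is_RInt (V := C_R_NormedModule) (fun t : R => f (RtoC t)) a b l -> cint f a b = l.
Proof. intros H. now apply (is_RInt_unique (V := C_R_CompleteNormedModule)). Qed.

Lemma cint_ext (f g : C -> C) (a b : R) :
  (forall t, Rmin a b < t < Rmax a b -> f (RtoC t) = g (RtoC t)) -> cint f a b = cint g a b.
Proof. intros H. now apply (RInt_ext (V := C_R_CompleteNormedModule)). Qed.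

Lemma cint_plus (f g : C -> C) (a b : R) : ccont_seg f a b -> ccont_seg g a b ->
  cint (fun t => f t + g t)%C a b = (cint f a b + cint g a b)%C.
Proof.
  intros Hf Hg. apply cint_unique.
  exact (is_RInt_plus (V := C_R_NormedModule) _ _ _ _ _ _ (cint_is f a b Hf) (cint_is g a b Hg)).
Qed.

(** The integral lives in a real vector space, so a complex factor is handled through the real and
    imaginary parts. *)
Lemma cint_scal (k : C) (f : C -> C) (a b : R) : ccont_seg f a b ->
  cint (fun t => k * f t)%C a b = (k * cint f a b)%C.
Proof.
  intros Hf. apply cint_unique. assert (H := cint_is f a b Hf).
  assert (H1 := is_RInt_fct_extend_fst (U := R_NormedModule) (V := R_NormedModule) _ _ _ _ H).
  assert (H2 := is_RInt_fct_extend_snd (U := R_NormedModule) (V := R_NormedModule) _ _ _ _ H).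
  apply (is_RInt_fct_extend_pair (U := R_NormedModule) (V := R_NormedModule)).
  - exact (is_RInt_minus (V := R_NormedModule) _ _ _ _ _ _
      (is_RInt_scal (V := R_NormedModule) _ _ _ (fst k) _ H1)
      (is_RInt_scal (V := R_NormedModule) _ _ _ (snd k) _ H2)).
  - exact (is_RInt_plus (V := R_NormedModule) _ _ _ _ _ _
      (is_RInt_scal (V := R_NormedModule) _ _ _ (fst k) _ H2)
      (is_RInt_scal (V := R_NormedModule) _ _ _ (snd k) _ H1)).
Qed.

Lemma cint_conj (f : C -> C) (a b : R) : ccont_seg f a b ->
  cint (fun t => Cconj (f t)) a b = Cconj (cint f a b).
Proof.
  intros Hf. apply cint_unique. assert (H := cint_is f a b Hf).
  assert (H1 := is_RInt_fct_extend_fst (U := R_NormedModule) (V := R_NormedModule) _ _ _ _ H).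
  assert (H2 := is_RInt_fct_extend_snd (U := R_NormedModule) (V := R_NormedModule) _ _ _ _ H).
  apply (is_RInt_fct_extend_pair (U := R_NormedModule) (V := R_NormedModule)); [exact H1|].
  exact (is_RInt_opp (V := R_NormedModule) _ _ _ _ H2).
Qed.

Lemma cint_minus (f g : C -> C) (a b : R) : ccont_seg f a b -> ccont_seg g a b ->
  cint (fun t => f t - g t)%C a b = (cint f a b - cint g a b)%C.
Proof.
  intros Hf Hg. apply cint_unique.
  exact (is_RInt_minus (V := C_R_NormedModule) _ _ _ _ _ _ (cint_is f a b Hf) (cint_is g a b Hg)).
Qed.

Lemma cint_chasles (f : C -> C) (a b c : R) : ccont_seg f a b -> ccont_seg f b c ->
  (cint f a b + cint f b c)%C = cint f a c.
Proof.
  intros H1 H2. symmetry. apply cint_unique.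
  exact (is_RInt_Chasles (V := C_R_NormedModule) _ _ _ _ _ _ (cint_is f a b H1) (cint_is f b c H2)).
Qed.

Lemma cint_swap (f : C -> C) (a b : R) : ccont_seg f a b -> cint f b a = (- cint f a b)%C.
Proof.
  intros H. apply cint_unique.
  exact (is_RInt_swap (V := C_R_NormedModule) _ _ _ _ (cint_is f a b H)).
Qed.

Lemma cint_point (f : C -> C) (a : R) : cint f a a = 0%C.
Proof. exact (RInt_point (V := C_R_CompleteNormedModule) a _). Qed.

Lemma cint_const (k : C) (a b : R) : cint (fun _ => k) a b = (RtoC (b - a) * k)%C.
Proof.
  unfold cint. rewrite (RInt_const (V := C_R_CompleteNormedModule)).
  unfold scal; simpl. unfold prod_scal, scal; simpl. unfold mult; simpl.
  unfold Cmult, RtoC; simpl. f_equal; ring.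
Qed.

Lemma cint_norm_le (f : C -> C) (g : R -> R) (a b : R) : a <= b -> ccont_seg f a b ->
  ex_RInt g a b -> (forall t, a <= t <= b -> Cmod (f (RtoC t)) <= g t) ->
  Cmod (cint f a b) <= RInt g a b.
Proof.
  intros Hab Hf Hg H. rewrite <- norm_CR.
  apply (norm_RInt_le (V := C_R_NormedModule) (fun t : R => f (RtoC t)) g a b); [exact Hab | |
    now apply cint_is | now apply (RInt_correct (V := R_CompleteNormedModule))].
  intros t Ht. rewrite norm_CR. now apply H.
Qed.

Lemma cint_norm_le_const (f : C -> C) (M a b : R) : a <= b -> ccont_seg f a b ->
  (forall t, a <= t <= b -> Cmod (f (RtoC t)) <= M) ->
  Cmod (cint f a b) <= (b - a) * M.
Proof.
  intros Hab Hf H. rewrite <- norm_CR.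
  apply (norm_RInt_le_const (V := C_R_NormedModule) (fun t : R => f (RtoC t))); [exact Hab | |
    now apply cint_is].
  intros t Ht. rewrite norm_CR. now apply H.
Qed.

Lemma cint_ftc (F f : C -> C) (a b : R) :
  (forall t, Rmin a b <= t <= Rmax a b -> cderiv F (RtoC t) (f (RtoC t))) ->
  ccont_seg f a b -> cint f a b = (F (RtoC b) - F (RtoC a))%C.
Proof.
  intros HF Hf. apply cint_unique.
  apply (is_RInt_derive (V := C_R_CompleteNormedModule) (fun t : R => F (RtoC t)) (fun t : R => f (RtoC t))).
  - intros t Ht. apply cderiv_is_derive. now apply HF.
  - intros t Ht. apply ccont_continuous. now apply Hf.
Qed.

(** * Rectangles and the Cauchy-Goursat theorem *)

Definition hint (f : C -> C) (y a b : R) : C := cint (fun t => f (t + Ci * y)%C) a b.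
Definition vint (f : C -> C) (x c d : R) : C := cint (fun t => f (x + Ci * t)%C) c d.

(** The boundary integral, counterclockwise when [a <= b] and [c <= d]. The factor [i] of [dz] on
    vertical sides is left out of [vint] and appears here as [Ci]. *)
Definition rect (f : C -> C) (a b c d : R) : C :=
  (hint f c a b + Ci * vint f b c d - hint f d a b - Ci * vint f a c d)%C.

(** The corners come in no fixed order because L-shaped paths may leave their starting point towards
    any quadrant. *)
Definition cbox (a b c d : R) (z : C) : Prop :=
  Rmin a b <= Re z <= Rmax a b /\ Rmin c d <= Im z <= Rmax c d.

Lemma Re_pt (x y : R) : Re (x + Ci * y)%C = x.
Proof. unfold Re, Ci, Cplus, Cmult, RtoC; simpl; ring. Qed.

Lemma Im_pt (x y : R) : Im (x + Ci * y)%C = y.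
Proof. unfold Im, Ci, Cplus, Cmult, RtoC; simpl; ring. Qed.

Lemma pt_eta (z : C) : (Re z + Ci * Im z)%C = z.
Proof. destruct z. unfold Re, Im, Ci, Cplus, Cmult, RtoC; simpl. f_equal; ring. Qed.

Lemma cbox_pt (a b c d x y : R) : Rmin a b <= x <= Rmax a b -> Rmin c d <= y <= Rmax c d ->
  cbox a b c d (x + Ci * y)%C.
Proof. unfold cbox. rewrite Re_pt, Im_pt. tauto. Qed.

Lemma cbox_le (a b c d : R) (z : C) : a <= b -> c <= d ->
  (cbox a b c d z <-> a <= Re z <= b /\ c <= Im z <= d).
Proof. intros H1 H2. unfold cbox. now rewrite !Rmin_left, !Rmax_right by assumption. Qed.

Lemma Rminmax_l (a b : R) : Rmin a b <= a <= Rmax a b.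
Proof. split; [apply Rmin_l | apply Rmax_l]. Qed.

Lemma Rminmax_r (a b : R) : Rmin a b <= b <= Rmax a b.
Proof. split; [apply Rmin_r | apply Rmax_r]. Qed.

Lemma ccont_h (f : C -> C) (y t : R) : ccont f (t + Ci * y)%C ->
  ccont (fun t => f (t + Ci * y)%C) t.
Proof.
  intros H. apply (ccont_comp f (fun t => t + Ci * y)%C); [|exact H].
  apply ccont_plus; [apply ccont_id | apply ccont_const].
Qed.

Lemma ccont_v (f : C -> C) (x t : R) : ccont f (x + Ci * t)%C ->
  ccont (fun t => f (x + Ci * t)%C) t.
Proof.
  intros H. apply (ccont_comp f (fun t => x + Ci * t)%C); [|exact H].
  apply ccont_plus; [apply ccont_const|]. apply ccont_mult; [apply ccont_const | apply ccont_id].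
Qed.

Definition ccont_box (f : C -> C) (a b c d : R) : Prop :=
  forall z, cbox a b c d z -> ccont f z.

Lemma ccont_box_h (f : C -> C) (a b c d y : R) : ccont_box f a b c d ->
  Rmin c d <= y <= Rmax c d -> ccont_seg (fun t => f (t + Ci * y)%C) a b.
Proof. intros H Hy t Ht. apply ccont_h, H, cbox_pt; assumption. Qed.

Lemma ccont_box_v (f : C -> C) (a b c d x : R) : ccont_box f a b c d ->
  Rmin a b <= x <= Rmax a b -> ccont_seg (fun t => f (x + Ci * t)%C) c d.
Proof. intros H Hx t Ht. apply ccont_v, H, cbox_pt; assumption. Qed.

Lemma cbox_incl (a b c d a' b' c' d' : R) (z : C) :
  a <= a' -> a' <= b' -> b' <= b -> c <= c' -> c' <= d' -> d' <= d ->
  cbox a' b' c' d' z -> cbox a b c d z.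
Proof.
  intros. rewrite cbox_le in * by lra. lra.
Qed.

Lemma rect_split_x (f : C -> C) (a m b c d : R) : a <= m <= b -> c <= d ->
  ccont_box f a b c d -> rect f a b c d = (rect f a m c d + rect f m b c d)%C.
Proof.
  intros Hm Hcd H. unfold rect, hint.
  assert (H1 : ccont_box f a m c d).
  { intros z Hz. apply H. revert Hz. apply cbox_incl; lra. }
  assert (H2 : ccont_box f m b c d).
  { intros z Hz. apply H. revert Hz. apply cbox_incl; lra. }
  rewrite <- (cint_chasles (fun t => f (t + Ci * c)%C) a m b).
  rewrite <- (cint_chasles (fun t => f (t + Ci * d)%C) a m b).
  - ring.
  - apply (ccont_box_h f a m c d); [exact H1 | apply Rminmax_r].
  - apply (ccont_box_h f m b c d); [exact H2 | apply Rminmax_r].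
  - apply (ccont_box_h f a m c d); [exact H1 | apply Rminmax_l].
  - apply (ccont_box_h f m b c d); [exact H2 | apply Rminmax_l].
Qed.

Lemma rect_split_y (f : C -> C) (a b c m d : R) : a <= b -> c <= m <= d ->
  ccont_box f a b c d -> rect f a b c d = (rect f a b c m + rect f a b m d)%C.
Proof.
  intros Hab Hm H. unfold rect, vint.
  assert (H1 : ccont_box f a b c m).
  { intros z Hz. apply H. revert Hz. apply cbox_incl; lra. }
  assert (H2 : ccont_box f a b m d).
  { intros z Hz. apply H. revert Hz. apply cbox_incl; lra. }
  rewrite <- (cint_chasles (fun t => f (a + Ci * t)%C) c m d).
  rewrite <- (cint_chasles (fun t => f (b + Ci * t)%C) c m d).
  - ring.
  - apply (ccont_box_v f a b c m); [exact H1 | apply Rminmax_r].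
  - apply (ccont_box_v f a b m d); [exact H2 | apply Rminmax_r].
  - apply (ccont_box_v f a b c m); [exact H1 | apply Rminmax_l].
  - apply (ccont_box_v f a b m d); [exact H2 | apply Rminmax_l].
Qed.

Lemma rect_minus (f g : C -> C) (a b c d : R) : ccont_box f a b c d -> ccont_box g a b c d ->
  rect (fun z => f z - g z)%C a b c d = (rect f a b c d - rect g a b c d)%C.
Proof.
  intros Hf Hg. unfold rect, hint, vint.
  rewrite (cint_minus (fun t => f (t + Ci * c)%C) (fun t => g (t + Ci * c)%C)),
    (cint_minus (fun t => f (b + Ci * t)%C) (fun t => g (b + Ci * t)%C)),
    (cint_minus (fun t => f (t + Ci * d)%C) (fun t => g (t + Ci * d)%C)),
    (cint_minus (fun t => f (a + Ci * t)%C) (fun t => g (a + Ci * t)%C)); [ring|..].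
  all: first [eapply ccont_box_h | eapply ccont_box_v]; first [eassumption | apply Rminmax_l | apply Rminmax_r].
Qed.

Lemma rect_norm_le (f : C -> C) (M a b c d : R) : a <= b -> c <= d -> ccont_box f a b c d ->
  (forall z, cbox a b c d z -> Cmod (f z) <= M) ->
  Cmod (rect f a b c d) <= 2 * ((b - a) + (d - c)) * M.
Proof.
  intros Hab Hcd Hf HM. unfold rect.
  assert (Hh : forall y, Rmin c d <= y <= Rmax c d -> Cmod (hint f y a b) <= (b - a) * M).
  { intros y Hy. apply cint_norm_le_const; [exact Hab | now apply (ccont_box_h f a b c d)|].
    intros t Ht. apply HM, cbox_pt; [|exact Hy]. now rewrite Rmin_left, Rmax_right. }
  assert (Hv : forall x, Rmin a b <= x <= Rmax a b -> Cmod (Ci * vint f x c d) <= (d - c) * M).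
  { intros x Hx. rewrite Cmod_mult, Cmod_Ci, Rmult_1_l.
    apply cint_norm_le_const; [exact Hcd | now apply (ccont_box_v f a b c d)|].
    intros t Ht. apply HM, cbox_pt; [exact Hx|]. now rewrite Rmin_left, Rmax_right. }
  pose proof (Hh c (Rminmax_l _ _)). pose proof (Hh d (Rminmax_r _ _)).
  pose proof (Hv a (Rminmax_l _ _)). pose proof (Hv b (Rminmax_r _ _)).
  unfold Cminus. eapply Rle_trans; [apply Cmod_triangle|]. rewrite Cmod_opp.
  eapply Rle_trans; [apply Rplus_le_compat_r, Cmod_triangle|]. rewrite Cmod_opp.
  eapply Rle_trans; [apply Rplus_le_compat_r, Rplus_le_compat_r, Cmod_triangle|]. lra.
Qed.

Lemma hint_ftc (F f : C -> C) (y a b : R) :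
  (forall t, Rmin a b <= t <= Rmax a b -> cderiv F (t + Ci * y)%C (f (t + Ci * y)%C)) ->
  ccont_seg (fun t => f (t + Ci * y)%C) a b ->
  hint f y a b = (F (b + Ci * y) - F (a + Ci * y))%C.
Proof.
  intros HF Hf. apply (cint_ftc (fun t => F (t + Ci * y)%C)); [|exact Hf].
  intros t Ht. eapply cderiv_eq.
  - apply (cderiv_comp F (fun t => t + Ci * y)%C); [now apply HF|].
    apply cderiv_plus; [apply cderiv_id | apply cderiv_const].
  - cbv beta. ring.
Qed.

Lemma vint_ftc (F f : C -> C) (x c d : R) :
  (forall t, Rmin c d <= t <= Rmax c d -> cderiv F (x + Ci * t)%C (f (x + Ci * t)%C)) ->
  ccont_seg (fun t => f (x + Ci * t)%C) c d ->
  (Ci * vint f x c d)%C = (F (x + Ci * d) - F (x + Ci * c))%C.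
Proof.
  intros HF Hf. unfold vint. rewrite <- cint_scal by exact Hf.
  apply (cint_ftc (fun t => F (x + Ci * t)%C) (fun t => Ci * f (x + Ci * t))%C).
  - intros t Ht. eapply cderiv_eq.
    + apply (cderiv_comp F (fun t => x + Ci * t)%C); [now apply HF|].
      apply cderiv_plus; [apply cderiv_const|].
      apply cderiv_mult; [apply cderiv_const | apply cderiv_id].
    + cbv beta. ring.
  - intros t Ht. apply ccont_mult; [apply ccont_const | now apply Hf].
Qed.

Lemma rect_primitive (F f : C -> C) (a b c d : R) : ccont_box f a b c d ->
  (forall z, cbox a b c d z -> cderiv F z (f z)) -> rect f a b c d = 0%C.
Proof.
  intros Hf HF. unfold rect.
  rewrite (hint_ftc F f c), (hint_ftc F f d), (vint_ftc F f a), (vint_ftc F f b); [ring|..].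
  all: try (intros t Ht; apply HF, cbox_pt; first [exact Ht | apply Rminmax_l | apply Rminmax_r]).
  all: first [eapply ccont_box_h | eapply ccont_box_v]; first [eassumption | apply Rminmax_l | apply Rminmax_r].
Qed.

Lemma rect_affine (k l : C) (a b c d : R) : rect (fun z => k + l * z)%C a b c d = 0%C.
Proof.
  apply (rect_primitive (fun z => k * z + l * (z * z / 2))%C).
  - intros z _. apply ccont_plus; [apply ccont_const|].
    apply ccont_mult; [apply ccont_const | apply ccont_id].
  - intros z _. eapply cderiv_eq.
    + apply cderiv_plus; apply cderiv_mult; try apply cderiv_const; try apply cderiv_id.
      apply cderiv_mult; [apply cderiv_mult; apply cderiv_id | apply cderiv_const].
    + cbv beta. field.
Qed.

Lemma nested_intervals (u v : nat -> R) :
  (forall n, u n <= u (S n)) -> (forall n, v (S n) <= v n) -> (forall n, u n <= v n) ->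
  exists x, forall n, u n <= x <= v n.
Proof.
  intros Hu Hv Huv.
  assert (Mu : forall n k, u n <= u (n + k)%nat).
  { intros n k. induction k as [|k IH]; [rewrite Nat.add_0_r; lra|].
    rewrite Nat.add_succ_r. specialize (Hu (n + k)%nat). lra. }
  assert (Mv : forall n k, v (n + k)%nat <= v n).
  { intros n k. induction k as [|k IH]; [rewrite Nat.add_0_r; lra|].
    rewrite Nat.add_succ_r. specialize (Hv (n + k)%nat). lra. }
  assert (H : forall n k, u n <= v k).
  { intros n k. specialize (Mu n k). specialize (Mv k n). rewrite Nat.add_comm in Mv.
    specialize (Huv (n + k)%nat). lra. }
  destruct (completeness (fun x => exists n, x = u n)) as [x [H1 H2]].
  - exists (v 0%nat). intros x [n ->]. apply H.
  - exists (u 0%nat). now exists 0%nat.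
  - exists x. intros n. split; [apply H1; now exists n|].
    apply H2. intros y [k ->]. apply H.
Qed.

(** * Repeated bisection for Goursat's theorem *)

Section Bisection.

Context (f : C -> C) (a c w h : R).

Let Q (p : R * R) (n : nat) : R :=
  Cmod (rect f (fst p) (fst p + w / 2 ^ n) (snd p) (snd p + h / 2 ^ n)).

(** A rectangle is coded by its lower left corner, its sides at stage [n] being [w / 2^n] and
    [h / 2^n]. The upper right quarter is the untested default: [bisect_large] shows that it must
    carry a quarter of the integral when the other three do not. *)
Let quarter (p : R * R) (n : nat) : R * R :=
  let p1 := (fst p + w / 2 ^ S n, snd p) in
  let p2 := (fst p, snd p + h / 2 ^ S n) in
  let p3 := (fst p + w / 2 ^ S n, snd p + h / 2 ^ S n) in
  if Rle_dec (Q p n) (4 * Q p (S n)) then p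
  else if Rle_dec (Q p n) (4 * Q p1 (S n)) then p1
  else if Rle_dec (Q p n) (4 * Q p2 (S n)) then p2 else p3.

Fixpoint bisect (n : nat) : R * R :=
  match n with
  | O => (a, c)
  | S k => quarter (bisect k) k
  end.

Hypotheses (Hw : 0 <= w) (Hh : 0 <= h).

Lemma bisect_width (x : R) (n : nat) : x / 2 ^ n = x / 2 ^ S n + x / 2 ^ S n.
Proof. simpl. field. apply pow_nonzero. lra. Qed.

Lemma bisect_width_ge (x : R) (n : nat) : 0 <= x -> 0 <= x / 2 ^ n.
Proof. intros Hx. apply Rdiv_le_0_compat; [exact Hx|]. apply pow_lt. lra. Qed.

Lemma bisect_step (n : nat) :
  fst (bisect n) <= fst (bisect (S n)) /\
  fst (bisect (S n)) + w / 2 ^ S n <= fst (bisect n) + w / 2 ^ n /\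
  snd (bisect n) <= snd (bisect (S n)) /\
  snd (bisect (S n)) + h / 2 ^ S n <= snd (bisect n) + h / 2 ^ n.
Proof.
  pose proof (bisect_width w n). pose proof (bisect_width h n).
  pose proof (bisect_width_ge w (S n) Hw). pose proof (bisect_width_ge h (S n) Hh).
  change (bisect (S n)) with (quarter (bisect n) n). unfold quarter.
  repeat destruct Rle_dec; cbn [fst snd]; lra.
Qed.

Lemma bisect_bounds (n : nat) :
  a <= fst (bisect n) /\ fst (bisect n) + w / 2 ^ n <= a + w /\
  c <= snd (bisect n) /\ snd (bisect n) + h / 2 ^ n <= c + h.
Proof.
  induction n as [|n IH]; [simpl; lra|]. pose proof (bisect_step n). lra.
Qed.

Hypothesis Hf : ccont_box f a (a + w) c (c + h).

Lemma bisect_large (n : nat) : Q (bisect n) n <= 4 * Q (bisect (S n)) (S n).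
Proof.
  change (bisect (S n)) with (quarter (bisect n) n). unfold quarter.
  pose proof (bisect_bounds n) as B. destruct (bisect n) as [x y]; cbn [fst snd] in *.
  destruct Rle_dec as [|N1]; [assumption|].
  destruct Rle_dec as [|N2]; [assumption|].
  destruct Rle_dec as [|N3]; [assumption|].
  apply Rnot_le_lt in N1, N2, N3. apply Rnot_lt_le. intros N4. revert N1 N2 N3 N4.
  unfold Q; cbn [fst snd].
  pose proof (bisect_width w n) as Ew. pose proof (bisect_width h n) as Eh.
  pose proof (bisect_width_ge w (S n) Hw). pose proof (bisect_width_ge h (S n) Hh).
  set (w1 := w / 2 ^ S n) in *. set (h1 := h / 2 ^ S n) in *.
  clearbody w1 h1.
  rewrite Ew, Eh in *. rewrite <- !Rplus_assoc in *.
  assert (Hf' : forall a' b' c' d', x <= a' -> a' <= b' -> b' <= x + w1 + w1 ->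
     y <= c' -> c' <= d' -> d' <= y + h1 + h1 -> ccont_box f a' b' c' d').
  { intros a' b' c' d' ? ? ? ? ? ? z Hz. apply Hf. revert Hz. apply cbox_incl; lra. }
  rewrite (rect_split_x f x (x + w1) (x + w1 + w1) y (y + h1 + h1)),
    (rect_split_y f x (x + w1) y (y + h1) (y + h1 + h1)),
    (rect_split_y f (x + w1) (x + w1 + w1) y (y + h1) (y + h1 + h1)); try (apply Hf'; lra); try lra.
  set (r1 := rect f x (x + w1) y (y + h1)).
  set (r2 := rect f x (x + w1) (y + h1) (y + h1 + h1)).
  set (r3 := rect f (x + w1) (x + w1 + w1) y (y + h1)).
  set (r4 := rect f (x + w1) (x + w1 + w1) (y + h1) (y + h1 + h1)).
  pose proof (Cmod_triangle (r1 + r2) (r3 + r4)).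
  pose proof (Cmod_triangle r1 r2). pose proof (Cmod_triangle r3 r4). lra.
Qed.

Lemma bisect_large_0 (n : nat) : Cmod (rect f a (a + w) c (c + h)) <= 4 ^ n * Q (bisect n) n.
Proof.
  induction n as [|n IH].
  - unfold Q. simpl. rewrite !Rdiv_1_r. lra.
  - eapply Rle_trans; [exact IH|]. simpl pow.
    replace (4 * 4 ^ n * Q (bisect (S n)) (S n)) with (4 ^ n * (4 * Q (bisect (S n)) (S n))) by ring.
    apply Rmult_le_compat_l; [apply pow_le; lra | apply bisect_large].
Qed.

Hypothesis Hd : forall z, cbox a (a + w) c (c + h) z -> exists l, cderiv f z l.

(** All rectangles share a point [z], near which [f] is affine up to [e |u - z|]. The affine part
    integrates to zero by [rect_affine]; what is left is at most the perimeter times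
    [e (w + h) / 2^n], and the two factors [2^(-n)] cancel [4^n]. *)
Lemma bisect_small (e : R) : 0 < e -> exists n, 4 ^ n * Q (bisect n) n <= 2 * e * (w + h) ^ 2.
Proof.
  intros He.
  assert (Gw : forall n, 0 <= w / 2 ^ n) by (intros; now apply bisect_width_ge).
  assert (Gh : forall n, 0 <= h / 2 ^ n) by (intros; now apply bisect_width_ge).
  destruct (nested_intervals (fun n => fst (bisect n)) (fun n => fst (bisect n) + w / 2 ^ n)) as [x Hx].
  { intros n; pose proof (bisect_step n); lra. }
  { intros n; pose proof (bisect_step n); lra. }
  { intros n; specialize (Gw n); lra. }
  destruct (nested_intervals (fun n => snd (bisect n)) (fun n => snd (bisect n) + h / 2 ^ n)) as [y Hy].
  { intros n; pose proof (bisect_step n); lra. }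
  { intros n; pose proof (bisect_step n); lra. }
  { intros n; specialize (Gh n); lra. }
  set (z := (x + Ci * y)%C).
  destruct (Hd z) as [l Hl].
  { specialize (Hx 0%nat). specialize (Hy 0%nat). simpl in Hx, Hy. rewrite !Rdiv_1_r in *.
    apply cbox_le; try lra. unfold z. rewrite Re_pt, Im_pt. lra. }
  destruct (cderiv_estimate _ _ _ Hl e He) as [d [Hd0 Hest]].
  assert (Hn : exists n, (w + h) / 2 ^ n < d).
  (* The summand 1 keeps the denominator positive for a degenerate rectangle, where [w + h = 0]. *)
  { destruct (pow_lt_1_zero (/ 2)) with (y := d / (w + h + 1)) as [n Hn].
    - rewrite Rabs_right; lra.
    - apply Rdiv_lt_0_compat; lra.
    - exists n. specialize (Hn n (Nat.le_refl n)).
      rewrite Rabs_right in Hn by (apply Rle_ge, pow_le; lra).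
      rewrite pow_inv in Hn. unfold Rdiv.
      assert (P : 0 < / 2 ^ n) by (apply Rinv_0_lt_compat, pow_lt; lra).
      apply Rle_lt_trans with ((w + h + 1) * / 2 ^ n); [nra|].
      apply Rlt_le_trans with ((w + h + 1) * (d / (w + h + 1))).
      + apply Rmult_lt_compat_l; lra.
      + right. field. lra. }
  destruct Hn as [n Hn]. exists n.
  pose proof (bisect_bounds n) as B. specialize (Hx n). specialize (Hy n). cbv beta in Hx, Hy.
  specialize (Gw n). specialize (Gh n).
  assert (Es : (w + h) / 2 ^ n = w / 2 ^ n + h / 2 ^ n) by (field; apply pow_nonzero; lra).
  unfold Q. set (x0 := fst (bisect n)) in *. set (y0 := snd (bisect n)) in *.
  set (wn := w / 2 ^ n) in *. set (hn := h / 2 ^ n) in *.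
  assert (Hfn : ccont_box f x0 (x0 + wn) y0 (y0 + hn)).
  { intros u Hu. apply Hf. revert Hu. apply cbox_incl; lra. }
  set (g := (fun u => (f z - l * z) + l * u)%C).
  assert (Hg : ccont_box g x0 (x0 + wn) y0 (y0 + hn)).
  { intros u _. apply ccont_plus; [apply ccont_const|].
    apply ccont_mult; [apply ccont_const | apply ccont_id]. }
  assert (Hz : forall u, cbox x0 (x0 + wn) y0 (y0 + hn) u -> Cmod (u - z) <= wn + hn).
  { intros u Hu. rewrite cbox_le in Hu by lra. eapply Rle_trans; [apply Cmod_le_re_im|].
    replace (Re (u - z)%C) with (Re u - x) by (rewrite <- (Re_pt x y); reflexivity).
    replace (Im (u - z)%C) with (Im u - y) by (rewrite <- (Im_pt x y); reflexivity).
    apply Rplus_le_compat; apply Rabs_le; lra. }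
  assert (R0 : rect f x0 (x0 + wn) y0 (y0 + hn) = rect (fun u => f u - g u)%C x0 (x0 + wn) y0 (y0 + hn)).
  { rewrite rect_minus by assumption. unfold g. rewrite rect_affine. ring. }
  rewrite R0.
  assert (R1 : Cmod (rect (fun u => f u - g u)%C x0 (x0 + wn) y0 (y0 + hn))
      <= 2 * ((x0 + wn - x0) + (y0 + hn - y0)) * (e * (wn + hn))).
  { apply rect_norm_le; try lra.
    - intros u Hu. apply ccont_minus; [now apply Hfn | now apply Hg].
    - intros u Hu. specialize (Hz u Hu).
      replace (f u - g u)%C with (f u - f z - l * (u - z))%C by (unfold g; ring).
      eapply Rle_trans; [apply Hest; lra|]. apply Rmult_le_compat_l; lra. }
  eapply Rle_trans; [apply Rmult_le_compat_l; [apply pow_le; lra | exact R1]|].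
  right. unfold wn, hn. replace 4 with (2 * 2) by ring. rewrite Rpow_mult_distr.
  field. apply pow_nonzero. lra.
Qed.

Lemma goursat_aux : rect f a (a + w) c (c + h) = 0%C.
Proof.
  apply Cmod_eq_0. apply Rle_antisym; [|apply Cmod_ge_0]. apply le_epsilon. intros e He.
  set (s := 2 * (w + h) ^ 2 + 1).
  assert (Hs : 0 < s) by (unfold s; nra).
  destruct (bisect_small (e / s)) as [n Hn]; [now apply Rdiv_lt_0_compat|].
  eapply Rle_trans; [apply bisect_large_0|]. eapply Rle_trans; [exact Hn|].
  rewrite Rplus_0_l. apply Rle_trans with (s * (e / s)); [|right; field; lra].
  assert (0 < e / s) by now apply Rdiv_lt_0_compat. unfold s at 2. nra.
Qed.

End Bisection.

Theorem goursat (f : C -> C) (a b c d : R) : a <= b -> c <= d ->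
  (forall z, cbox a b c d z -> exists l, cderiv f z l) -> rect f a b c d = 0%C.
Proof.
  intros Hab Hcd H.
  replace b with (a + (b - a)) in * by ring. replace d with (c + (d - c)) in * by ring.
  assert (Hf : ccont_box f a (a + (b - a)) c (c + (d - c))).
  { intros z Hz. destruct (H z Hz) as [l Hl]. exact (cderiv_ccont _ _ _ Hl). }
  apply goursat_aux; [lra | lra | exact Hf | exact H].
Qed.

(** A small box around [p] is cut out. Goursat kills the four remaining pieces, and the integral
    over the box is at most its perimeter times a local bound of the continuous function [f]. *)
Theorem goursat_except (f : C -> C) (p : C) (a b c d : R) : a <= b -> c <= d ->
  ccont_box f a b c d ->
  (forall z, cbox a b c d z -> z <> p -> exists l, cderiv f z l) -> rect f a b c d = 0%C.
Proof.
  intros Hab Hcd Hf H.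
  destruct (Rle_dec a (Re p)) as [P1|P1]; [destruct (Rle_dec (Re p) b) as [P2|P2];
   [destruct (Rle_dec c (Im p)) as [P3|P3]; [destruct (Rle_dec (Im p) d) as [P4|P4]|]|]|].
  2-5: apply goursat; [assumption | assumption|]; intros z Hz; apply H; [exact Hz|];
     intros ->; rewrite cbox_le in Hz by lra; lra.
  destruct (Hf p) with (e := 1) as [d0 [Hd0 Hb]]; [apply cbox_le; lra | lra|].
  set (M := Cmod (f p) + 1).
  assert (HM : 0 < M) by (unfold M; pose proof (Cmod_ge_0 (f p)); lra).
  apply Cmod_eq_0. apply Rle_antisym; [|apply Cmod_ge_0]. apply le_epsilon. intros e He.
  rewrite Rplus_0_l.
  (* The box has half-width at most [r]: [2 r < d0] keeps it inside the disc where [|f| <= M], and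
     its perimeter [8 r] times [M] is at most [e]. *)
  set (r := Rmin (d0 / 3) (e / (8 * M))).
  assert (Hr : 0 < r) by (apply Rmin_glb_lt; [lra | apply Rdiv_lt_0_compat; lra]).
  assert (Hr1 : r <= d0 / 3) by apply Rmin_l.
  assert (Hr2 : r <= e / (8 * M)) by apply Rmin_r. clearbody r.
  (* Where [p] lies within [r] of a side, the box is clipped at that side; the corresponding outer
     strip then has zero width and its integral vanishes by [Dx] or [Dy]. *)
  assert (Hx : exists x0, (x0 = a \/ x0 = Re p - r) /\ a <= x0 <= Re p /\ Re p - r <= x0).
  { destruct (Rle_dec a (Re p - r)); [exists (Re p - r) | exists a]; lra. }
  assert (Hx' : exists x1, (x1 = b \/ x1 = Re p + r) /\ Re p <= x1 <= b /\ x1 <= Re p + r).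
  { destruct (Rle_dec (Re p + r) b); [exists (Re p + r) | exists b]; lra. }
  assert (Hy : exists y0, (y0 = c \/ y0 = Im p - r) /\ c <= y0 <= Im p /\ Im p - r <= y0).
  { destruct (Rle_dec c (Im p - r)); [exists (Im p - r) | exists c]; lra. }
  assert (Hy' : exists y1, (y1 = d \/ y1 = Im p + r) /\ Im p <= y1 <= d /\ y1 <= Im p + r).
  { destruct (Rle_dec (Im p + r) d); [exists (Im p + r) | exists d]; lra. }
  destruct Hx as [x0 [Ex0 Hx0]], Hx' as [x1 [Ex1 Hx1]], Hy as [y0 [Ey0 Hy0]], Hy' as [y1 [Ey1 Hy1]].
  assert (Hf' : forall a' b' c' d', a <= a' -> a' <= b' -> b' <= b ->
     c <= c' -> c' <= d' -> d' <= d -> ccont_box f a' b' c' d').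
  { intros a' b' c' d' ? ? ? ? ? ? z Hz. apply Hf. revert Hz. apply cbox_incl; lra. }
  assert (G : forall a' b' c' d', a <= a' -> a' <= b' -> b' <= b ->
     c <= c' -> c' <= d' -> d' <= d ->
     (b' < Re p \/ Re p < a' \/ d' < Im p \/ Im p < c') -> rect f a' b' c' d' = 0%C).
  { intros a' b' c' d' ? ? ? ? ? ? Hp. apply goursat; [assumption | assumption|].
    intros z Hz. apply H.
    - revert Hz. apply cbox_incl; lra.
    - intros ->. rewrite cbox_le in Hz by lra. lra. }
  assert (Dx : forall a' c' d', rect f a' a' c' d' = 0%C).
  { intros. unfold rect, hint. rewrite !cint_point. ring. }
  assert (Dy : forall a' b' c', rect f a' b' c' c' = 0%C).
  { intros. unfold rect, vint. rewrite !cint_point. ring. }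
  rewrite (rect_split_x f a x0 b), (rect_split_x f x0 x1 b), (rect_split_y f x0 x1 c y0),
    (rect_split_y f x0 x1 y0 y1); try (apply Hf'; lra); try lra.
  replace (rect f a x0 c d) with (RtoC 0)
    by (destruct Ex0 as [->|Ex0]; [symmetry; apply Dx | symmetry; apply G; lra]).
  replace (rect f x1 b c d) with (RtoC 0)
    by (destruct Ex1 as [->|Ex1]; [symmetry; apply Dx | symmetry; apply G; lra]).
  replace (rect f x0 x1 c y0) with (RtoC 0)
    by (destruct Ey0 as [->|Ey0]; [symmetry; apply Dy | symmetry; apply G; lra]).
  replace (rect f x0 x1 y1 d) with (RtoC 0)
    by (destruct Ey1 as [->|Ey1]; [symmetry; apply Dy | symmetry; apply G; lra]).
  replace (0 + (0 + (rect f x0 x1 y0 y1 + 0) + 0))%C with (rect f x0 x1 y0 y1) by ring.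
  eapply Rle_trans; [apply (rect_norm_le f M)|]; try lra.
  - apply Hf'; lra.
  - intros z Hz. rewrite cbox_le in Hz by lra.
    assert (Hzp : Cmod (z - p) < d0).
    { eapply Rle_lt_trans; [apply Cmod_le_re_im|].
      change (Re (z - p)%C) with (Re z - Re p). change (Im (z - p)%C) with (Im z - Im p).
      apply Rle_lt_trans with (r + r); [|lra].
      apply Rplus_le_compat; apply Rabs_le; lra. }
    specialize (Hb z Hzp). pose proof (Cmod_le_minus (f z) (f p)). unfold M. lra.
  - apply Rle_trans with (2 * (4 * r) * M).
    + apply Rmult_le_compat_r; lra.
    + apply Rle_trans with (8 * M * (e / (8 * M))); [|right; field; lra].
      replace (2 * (4 * r) * M) with (8 * M * r) by ring. apply Rmult_le_compat_l; lra.
Qed.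

(** * Primitives *)

Lemma Cmod_le_parts (a b : C) : Rabs (Re a) <= Rabs (Re b) -> Rabs (Im a) <= Rabs (Im b) ->
  Cmod a <= Cmod b.
Proof.
  intros H1 H2. unfold Cmod. apply sqrt_le_1_alt. unfold Re, Im in *.
  rewrite <- (pow2_abs (fst a)), <- (pow2_abs (fst b)), <- (pow2_abs (snd a)), <- (pow2_abs (snd b)).
  pose proof (Rabs_pos (fst a)). pose proof (Rabs_pos (snd a)).
  apply Rplus_le_compat; apply pow_incr; lra.
Qed.

Lemma cderiv_unique (f : C -> C) (z l l' : C) : cderiv f z l -> cderiv f z l' -> l = l'.
Proof.
  intros H1 H2. replace l with (l' + (l - l'))%C by ring.
  assert (E : Cmod (l - l') = 0); [|rewrite (Cmod_eq_0 _ E); ring].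
  apply Rle_antisym; [|apply Cmod_ge_0]. apply le_epsilon. intros e He.
  destruct (cderiv_estimate _ _ _ H1 (e/2)) as [d1 [Hd1 A1]]; [lra|].
  destruct (cderiv_estimate _ _ _ H2 (e/2)) as [d2 [Hd2 A2]]; [lra|].
  set (r := Rmin d1 d2 / 2).
  assert (Hm : 0 < Rmin d1 d2) by now apply Rmin_glb_lt.
  pose proof (Rmin_l d1 d2). pose proof (Rmin_r d1 d2).
  assert (Er : Cmod (z + RtoC r - z) = r).
  { replace (z + RtoC r - z)%C with (RtoC r) by ring. rewrite Cmod_R.
    apply Rabs_right. unfold r. lra. }
  specialize (A1 (z + RtoC r)%C). specialize (A2 (z + RtoC r)%C). rewrite Er in *.
  specialize (A1 ltac:(unfold r; lra)). specialize (A2 ltac:(unfold r; lra)).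
  pose proof (Cmod_triangle_minus (l * (z + RtoC r - z)) (f (z + RtoC r)%C - f z) (l' * (z + RtoC r - z))) as T.
  replace (l * (z + RtoC r - z) - l' * (z + RtoC r - z))%C with ((l - l') * (z + RtoC r - z))%C in T by ring.
  rewrite Cmod_mult, Er in T. rewrite (Cmod_minus_sym (l * _)) in T.
  assert (Hr : 0 < r) by (unfold r; lra). apply Rmult_le_reg_r with r; lra.
Qed.

Definition copen (U : C -> Prop) : Prop :=
  forall z, U z -> exists d, 0 < d /\ forall w, Cmod (w - z) < d -> U w.

Definition holo (f : C -> C) (U : C -> Prop) : Prop :=
  forall z, U z -> exists l, cderiv f z l.

(* The L-shaped paths from [z0] used to build primitives stay in such a set;
   discs and open rectangles are of this kind. *)
Definition box_star (U : C -> Prop) (z0 : C) : Prop :=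
  copen U /\ U z0 /\
  forall z w, U z -> cbox (Re z0) (Re z) (Im z0) (Im z) w -> U w.

Definition cdisc (z0 : C) (rho : R) (z : C) : Prop := Cmod (z - z0) < rho.

Definition orect (a b c d : R) (z : C) : Prop := a < Re z < b /\ c < Im z < d.

Lemma between_abs (a b x : R) : Rmin a b <= x <= Rmax a b -> Rabs (x - a) <= Rabs (b - a).
Proof.
  unfold Rmin, Rmax, Rabs. intros H. destruct (Rle_dec a b); repeat destruct Rcase_abs; lra.
Qed.

Lemma cdisc_open (z0 : C) (rho : R) : copen (cdisc z0 rho).
Proof.
  intros z Hz. exists (rho - Cmod (z - z0)). unfold cdisc in *. split; [lra|].
  intros w Hw. pose proof (Cmod_triangle_minus w z z0). lra.
Qed.

Lemma cdisc_box_star (z0 : C) (rho : R) : 0 < rho -> box_star (cdisc z0 rho) z0.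
Proof.
  intros HR. split; [apply cdisc_open|]. split; [unfold cdisc; rewrite Cmod_diag; exact HR|].
  intros z w Hz [H1 H2]. unfold cdisc in *. eapply Rle_lt_trans; [|exact Hz].
  apply Cmod_le_parts.
  - change (Rabs (Re w - Re z0) <= Rabs (Re z - Re z0)). now apply between_abs.
  - change (Rabs (Im w - Im z0) <= Rabs (Im z - Im z0)). now apply between_abs.
Qed.

Lemma orect_box_star (a b c d : R) (z0 : C) : orect a b c d z0 -> box_star (orect a b c d) z0.
Proof.
  intros H0. split; [|split; [exact H0|]].
  - intros z [H1 H2]. set (r := Rmin (Rmin (Re z - a) (b - Re z)) (Rmin (Im z - c) (d - Im z))).
    exists r. split; [unfold r; repeat apply Rmin_glb_lt; lra|]. intros w Hw.
    assert (A1 := Rle_lt_trans _ _ _ (re_le_Cmod (w - z)) Hw).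
    assert (A2 := Rle_lt_trans _ _ _ (im_le_Cmod (w - z)) Hw).
    change (Re (w - z)%C) with (Re w - Re z) in A1. change (Im (w - z)%C) with (Im w - Im z) in A2.
    assert (r <= Rmin (Re z - a) (b - Re z)) by apply Rmin_l.
    assert (r <= Rmin (Im z - c) (d - Im z)) by apply Rmin_r.
    pose proof (Rmin_l (Re z - a) (b - Re z)). pose proof (Rmin_r (Re z - a) (b - Re z)).
    pose proof (Rmin_l (Im z - c) (d - Im z)). pose proof (Rmin_r (Im z - c) (d - Im z)).
    clearbody r.
    apply Rabs_def2 in A1. apply Rabs_def2 in A2. unfold orect. lra.
  - intros z w Hz [H1 H2]. unfold orect in *. revert H1 H2. unfold Rmin, Rmax.
    repeat destruct Rle_dec; lra.
Qed.

Lemma cint_norm_le_abs (f : C -> C) (M a b : R) : ccont_seg f a b ->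
  (forall t, Rmin a b <= t <= Rmax a b -> Cmod (f (RtoC t)) <= M) ->
  Cmod (cint f a b) <= Rabs (b - a) * M.
Proof.
  intros Hf H. destruct (Rle_dec a b) as [Hab|Hab].
  - rewrite Rabs_right by lra. apply cint_norm_le_const; [exact Hab | exact Hf|].
    intros t Ht. apply H. now rewrite Rmin_left, Rmax_right.
  - assert (Hf' : ccont_seg f b a). { intros t Ht. apply Hf. now rewrite Rmin_comm, Rmax_comm. }
    rewrite cint_swap, Cmod_opp by exact Hf'. rewrite Rabs_left1 by lra.
    replace (- (b - a)) with (a - b) by ring.
    apply cint_norm_le_const; [lra | exact Hf'|].
    intros t Ht. apply H. rewrite Rmin_right, Rmax_left; lra.
Qed.

Lemma rect_swap_x (f : C -> C) (a b c d : R) : ccont_box f a b c d ->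
  rect f b a c d = (- rect f a b c d)%C.
Proof.
  intros H. unfold rect, hint.
  rewrite (cint_swap _ a b), (cint_swap _ a b).
  - ring.
  - eapply ccont_box_h; [exact H | apply Rminmax_r].
  - eapply ccont_box_h; [exact H | apply Rminmax_l].
Qed.

Lemma rect_swap_y (f : C -> C) (a b c d : R) : ccont_box f a b c d ->
  rect f a b d c = (- rect f a b c d)%C.
Proof.
  intros H. unfold rect, vint.
  rewrite (cint_swap _ c d), (cint_swap _ c d).
  - ring.
  - eapply ccont_box_v; [exact H | apply Rminmax_l].
  - eapply ccont_box_v; [exact H | apply Rminmax_r].
Qed.

Lemma cbox_swap_x (a b c d : R) (z : C) : cbox a b c d z -> cbox b a c d z.
Proof. unfold cbox. now rewrite (Rmin_comm b a), (Rmax_comm b a). Qed.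

Lemma cbox_swap_y (a b c d : R) (z : C) : cbox a b c d z -> cbox a b d c z.
Proof. unfold cbox. now rewrite (Rmin_comm d c), (Rmax_comm d c). Qed.

Lemma goursat_except_any (f : C -> C) (p : C) (a b c d : R) :
  ccont_box f a b c d ->
  (forall z, cbox a b c d z -> z <> p -> exists l, cderiv f z l) -> rect f a b c d = 0%C.
Proof.
  revert a b c d.
  assert (H1 : forall a b c d, c <= d -> ccont_box f a b c d ->
    (forall z, cbox a b c d z -> z <> p -> exists l, cderiv f z l) -> rect f a b c d = 0%C).
  { intros a b c d Hcd Hf H. destruct (Rle_dec a b) as [Hab|Hab].
    - now apply (goursat_except f p).
    - rewrite rect_swap_x, (goursat_except f p); try lra; try ring.
      all: intros z Hz; apply cbox_swap_x in Hz; auto. }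
  intros a b c d Hf H. destruct (Rle_dec c d) as [Hcd|Hcd]; [now apply H1|].
  rewrite rect_swap_y, H1; try lra; try ring.
  all: intros z Hz; apply cbox_swap_y in Hz; auto.
Qed.

Theorem holo_primitive (g : C -> C) (U : C -> Prop) (z0 p : C) : box_star U z0 ->
  (forall z, U z -> ccont g z) ->
  (forall z, U z -> z <> p -> exists l, cderiv g z l) ->
  exists G, forall z, U z -> cderiv G z (g z).
Proof.
  intros [HU [_ HB]] Hg Hp.
  exists (fun z => hint g (Im z0) (Re z0) (Re z) + Ci * vint g (Re z) (Im z0) (Im z))%C.
  intros z Hz. apply cderiv_of_estimate. intros e He.
  destruct (HU z Hz) as [d1 [Hd1 Hd1U]].
  destruct (Hg z Hz (e / 2)) as [d2 [Hd2 Hd2g]]; [lra|].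
  exists (Rmin d1 d2). split; [now apply Rmin_glb_lt|]. intros w Hw.
  assert (Hw1 := Rlt_le_trans _ _ _ Hw (Rmin_l _ _)).
  assert (Hw2 := Rlt_le_trans _ _ _ Hw (Rmin_r _ _)).
  set (x0 := Re z0) in *. set (y0 := Im z0) in *.
  assert (Nr : forall v, cbox (Re z) (Re w) (Im z) (Im w) v -> Cmod (v - z) <= Cmod (w - z)).
  { intros v [V1 V2]. apply Cmod_le_parts.
    - change (Rabs (Re v - Re z) <= Rabs (Re w - Re z)). now apply between_abs.
    - change (Rabs (Im v - Im z) <= Rabs (Im w - Im z)). now apply between_abs. }
  assert (E : hint g y0 x0 (Re w) = (hint g y0 x0 (Re z) + hint g y0 (Re z) (Re w))%C).
  { symmetry. apply cint_chasles.
    - intros t Ht. apply ccont_h, Hg. apply (HB z); [exact Hz|]. apply cbox_pt; [exact Ht | apply Rminmax_l].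
    - intros t Ht. apply ccont_h, Hg. apply (HB (t + Ci * Im z)%C).
      + apply Hd1U. eapply Rle_lt_trans; [apply Nr|exact Hw1]. apply cbox_pt; [exact Ht | apply Rminmax_l].
      + rewrite Re_pt, Im_pt. apply cbox_pt; [apply Rminmax_r | apply Rminmax_l]. }
  assert (E2 : vint g (Re w) y0 (Im w) = (vint g (Re w) y0 (Im z) + vint g (Re w) (Im z) (Im w))%C).
  { symmetry. apply cint_chasles.
    - intros t Ht. apply ccont_v, Hg. apply (HB (Re w + Ci * Im z)%C).
      + apply Hd1U. eapply Rle_lt_trans; [apply Nr|exact Hw1]. apply cbox_pt; [apply Rminmax_r | apply Rminmax_l].
      + rewrite Re_pt, Im_pt. apply cbox_pt; [apply Rminmax_r | exact Ht].
    - intros t Ht. apply ccont_v, Hg. apply Hd1U. eapply Rle_lt_trans; [apply Nr|exact Hw1].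
      apply cbox_pt; [apply Rminmax_r | exact Ht]. }
  (* This rectangle lies in [U]: the point with abscissa [Re v] and height [Im z] is close to [z],
     hence in [U], and [v] lies in the box between [z0] and that point. *)
  assert (E3 : rect g (Re z) (Re w) y0 (Im z) = 0%C).
  { assert (HR : forall v, cbox (Re z) (Re w) y0 (Im z) v -> U v).
    { intros v [V1 V2]. apply (HB (Re v + Ci * Im z)%C).
      + apply Hd1U. eapply Rle_lt_trans; [apply Nr|exact Hw1]. apply cbox_pt; [exact V1 | apply Rminmax_l].
      + rewrite Re_pt, Im_pt. split; [apply Rminmax_r | exact V2]. }
    apply (goursat_except_any g p); intros v Hv; auto. }
  unfold rect in E3.
  assert (C1 : ccont_seg (fun t => g (t + Ci * Im z)%C) (Re z) (Re w)).
  { intros t Ht. apply ccont_h, Hg, Hd1U. eapply Rle_lt_trans; [apply Nr|exact Hw1].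
    apply cbox_pt; [exact Ht | apply Rminmax_l]. }
  assert (C2 : ccont_seg (fun t => g (Re w + Ci * t)%C) (Im z) (Im w)).
  { intros t Ht. apply ccont_v, Hg, Hd1U. eapply Rle_lt_trans; [apply Nr|exact Hw1].
    apply cbox_pt; [apply Rminmax_r | exact Ht]. }
  assert (K : forall a b k, ccont_seg (fun _ => k) a b) by (intros a b k t _; apply ccont_const).
  assert (B1 : Cmod (hint g (Im z) (Re z) (Re w) - RtoC (Re w - Re z) * g z) <= Rabs (Re w - Re z) * (e / 2)).
  { unfold hint. rewrite <- cint_const, <- (cint_minus (fun t => g (t + Ci * Im z)%C)) by auto.
    apply cint_norm_le_abs.
    - intros t Ht. apply ccont_minus; [now apply C1 | apply ccont_const].
    - intros t Ht. left. apply Hd2g. eapply Rle_lt_trans; [apply Nr|exact Hw2].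
      apply cbox_pt; [exact Ht | apply Rminmax_l]. }
  assert (B2 : Cmod (vint g (Re w) (Im z) (Im w) - RtoC (Im w - Im z) * g z) <= Rabs (Im w - Im z) * (e / 2)).
  { unfold vint. rewrite <- cint_const, <- (cint_minus (fun t => g (Re w + Ci * t)%C)) by auto.
    apply cint_norm_le_abs.
    - intros t Ht. apply ccont_minus; [now apply C2 | apply ccont_const].
    - intros t Ht. left. apply Hd2g. eapply Rle_lt_trans; [apply Nr|exact Hw2].
      apply cbox_pt; [apply Rminmax_r | exact Ht]. }
  rewrite E, E2.
  assert (Ew : (w - z)%C = (RtoC (Re w - Re z) + Ci * RtoC (Im w - Im z))%C).
  { rewrite <- (pt_eta w) at 1. rewrite <- (pt_eta z) at 1. rewrite !RtoC_minus. ring. }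
  replace (g z * (w - z))%C with (g z * (RtoC (Re w - Re z) + Ci * RtoC (Im w - Im z)))%C
    by now rewrite Ew.
  (* Path independence: [w] is reached from [z] along the height [Im z], then along the abscissa
     [Re w]. The first bracket is the rectangle of [E3]; the other two compare [g] with the constant
     [g z] on these short segments. *)
  replace (_ - _ - _)%C with
    ((hint g y0 (Re z) (Re w) + Ci * vint g (Re w) y0 (Im z) - hint g (Im z) (Re z) (Re w) - Ci * vint g (Re z) y0 (Im z))
     + (hint g (Im z) (Re z) (Re w) - RtoC (Re w - Re z) * g z)
     + Ci * (vint g (Re w) (Im z) (Im w) - RtoC (Im w - Im z) * g z))%C.
  2: ring.
  rewrite E3, Cplus_0_l. eapply Rle_trans; [apply Cmod_triangle|].
  rewrite Cmod_mult, Cmod_Ci, Rmult_1_l.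
  assert (Rabs (Re w - Re z) <= Cmod (w - z)) by apply (re_le_Cmod (w - z)).
  assert (Rabs (Im w - Im z) <= Cmod (w - z)) by apply (im_le_Cmod (w - z)).
  nra.
Qed.

(** * Circles: Cauchy formula and Borel-Caratheodory inequality *)

Definition circ (z0 : C) (rho : R) (t : C) : C := (z0 + rho * Cexp (Ci * t))%C.

Lemma Cexp_Ci (t : R) : Cexp (Ci * t) = (cos t, sin t).
Proof.
  unfold Cexp, Ci, RtoC, Re, Im, Cmult; simpl.
  replace (0 * t - 1 * 0) with 0 by ring. replace (0 * 0 + 1 * t) with t by ring.
  rewrite exp_0. f_equal; ring.
Qed.

Lemma Cmod_Cexp_Ci (t : R) : Cmod (Cexp (Ci * t)) = 1.
Proof.
  rewrite Cmod_Cexp. rewrite <- exp_0. f_equal. unfold Re, Ci, RtoC, Cmult; simpl. ring.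
Qed.

Lemma circ_dist (z0 : C) (rho t : R) : 0 <= rho -> Cmod (circ z0 rho t - z0) = rho.
Proof.
  intros HR. unfold circ. replace (_ - z0)%C with (RtoC rho * Cexp (Ci * t))%C by ring.
  rewrite Cmod_mult, Cmod_Cexp_Ci, Cmod_R, Rabs_right; lra.
Qed.

Lemma circ_cderiv (z0 : C) (rho : R) (t : C) :
  cderiv (circ z0 rho) t (Ci * (circ z0 rho t - z0))%C.
Proof.
  eapply cderiv_eq.
  - apply cderiv_plus; [apply cderiv_const|]. apply cderiv_mult; [apply cderiv_const|].
    apply (cderiv_comp Cexp (fun t => Ci * t)%C); [apply Cexp_cderiv|].
    apply cderiv_mult; [apply cderiv_const | apply cderiv_id].
  - unfold circ. cbv beta. ring.
Qed.

Lemma circ_ccont (z0 : C) (rho : R) (t : C) : ccont (circ z0 rho) t.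
Proof. exact (cderiv_ccont _ _ _ (circ_cderiv z0 rho t)). Qed.

Lemma ccont_circ (f : C -> C) (z0 : C) (rho t : R) : ccont f (circ z0 rho t) ->
  ccont (fun t => f (circ z0 rho t)) t.
Proof. intros H. apply ccont_comp; [apply circ_ccont | exact H]. Qed.

Lemma ccont_circ_minus (z0 a : C) (rho : R) (t : C) : ccont (fun t => circ z0 rho t - a)%C t.
Proof. apply ccont_minus; [apply circ_ccont | apply ccont_const]. Qed.

Lemma Ci_cancel (a : C) : (Ci * a)%C = 0%C -> a = 0%C.
Proof.
  intros H. replace a with (- Ci * (Ci * a))%C; [rewrite H; ring|].
  replace (- Ci * (Ci * a))%C with (- (Ci * Ci) * a)%C by ring.
  replace (Ci * Ci)%C with (- (1))%C; [ring|].
  unfold Ci, RtoC, Copp, Cmult; simpl. f_equal; ring.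
Qed.

(** Since [circ] has derivative [Ci * (circ - z0)], this is the contour integral of [g] divided by
    [i], and [G] returns to its initial value after the period [2 PI]. *)
Lemma cint_circ_primitive (G g : C -> C) (z0 : C) (rho : R) :
  (forall t : R, cderiv G (circ z0 rho t) (g (circ z0 rho t)) /\ ccont g (circ z0 rho t)) ->
  cint (fun t => g (circ z0 rho t) * (circ z0 rho t - z0))%C 0 (2 * PI) = 0%C.
Proof.
  intros H. apply Ci_cancel. rewrite <- cint_scal.
  - rewrite (cint_ftc (fun t => G (circ z0 rho t))).
    + unfold circ. rewrite !Cexp_Ci, cos_2PI, sin_2PI, cos_0, sin_0. ring.
    + intros t _. eapply cderiv_eq.
      * apply (cderiv_comp G (circ z0 rho)); [apply H | apply circ_cderiv].
      * ring.
    + intros t _. apply ccont_mult; [apply ccont_const|].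
      apply ccont_mult; [apply ccont_circ, H | apply ccont_circ_minus].
  - intros t _. apply ccont_mult; [apply ccont_circ, H | apply ccont_circ_minus].
Qed.

Lemma dslope_cderiv (f : C -> C) (p l z : C) : z <> p -> (exists l', cderiv f z l') ->
  exists l', cderiv (dslope f p l) z l'.
Proof.
  intros Hz [l' Hl']. assert (Hn := Cminus_neq_0 _ _ Hz).
  eexists. apply (cderiv_ext_loc (fun w => (f w - f p) / (w - p))%C _ z _ (Cmod (z - p))).
  - now apply Cmod_gt_0.
  - intros w Hw. symmetry. apply dslope_neq. intros ->. rewrite Cmod_minus_sym in Hw. lra.
  - apply cderiv_div; [exact Hn| |]; apply cderiv_minus;
      first [exact Hl' | apply cderiv_id | apply cderiv_const].
Qed.

Lemma dslope_ccont_holo (f : C -> C) (U : C -> Prop) (p l : C) : holo f U -> cderiv f p l ->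
  forall z, U z -> ccont (dslope f p l) z.
Proof.
  intros Hf Hp z Hz. destruct (Ceq_dec z p) as [->|Hn].
  - apply dslope_ccont. now apply cderiv_estimate.
  - destruct (dslope_cderiv f p l z Hn (Hf z Hz)) as [l' Hl']. exact (cderiv_ccont _ _ _ Hl').
Qed.

Lemma dslope_primitive (f : C -> C) (U : C -> Prop) (z0 p l : C) : box_star U z0 ->
  holo f U -> cderiv f p l ->
  exists G, forall z, U z -> cderiv G z (dslope f p l z).
Proof.
  intros HU Hf Hp. apply (holo_primitive _ U z0 p HU).
  - now apply dslope_ccont_holo.
  - intros z Hz Hn. apply dslope_cderiv; [exact Hn | now apply Hf].
Qed.

Lemma circ_cdisc (z0 : C) (rho rho' t : R) : 0 <= rho -> rho < rho' -> cdisc z0 rho' (circ z0 rho (RtoC t)).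
Proof. intros H1 H2. unfold cdisc. rewrite circ_dist; assumption. Qed.

Lemma circ_neq (z0 p : C) (rho t : R) : Cmod (p - z0) < rho -> (circ z0 rho t - p)%C <> 0%C.
Proof.
  intros Hp. apply Cminus_neq_0. intros E. rewrite <- E in Hp. rewrite circ_dist in Hp; [lra|].
  pose proof (Cmod_ge_0 (circ z0 rho t - z0)). lra.
Qed.

Lemma ccont_circ_kernel (z0 p : C) (rho t : R) : Cmod (p - z0) < rho ->
  ccont (fun t => (circ z0 rho t - z0) / (circ z0 rho t - p))%C t.
Proof.
  intros Hp. apply ccont_div; try apply ccont_circ_minus. now apply circ_neq.
Qed.

(** The quotient of [f - f p] by [z - p] is a [dslope]; it has a primitive in the larger disc, so
    its circle integral is zero. The kernel integral on the right is left unevaluated until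
    [circ_kernel]. *)
Lemma cauchy_circ_aux (f : C -> C) (z0 p : C) (rho rho' : R) : Cmod (p - z0) < rho -> rho < rho' ->
  holo f (cdisc z0 rho') ->
  cint (fun t => f (circ z0 rho t) * ((circ z0 rho t - z0) / (circ z0 rho t - p)))%C 0 (2 * PI)
  = (f p * cint (fun t => (circ z0 rho t - z0) / (circ z0 rho t - p))%C 0 (2 * PI))%C.
Proof.
  intros Hp HR Hf. pose proof (Cmod_ge_0 (p - z0)).
  destruct (Hf p) as [l Hl]; [unfold cdisc; lra|].
  destruct (dslope_primitive f (cdisc z0 rho') z0 p l) as [G HG]; [apply cdisc_box_star; lra | exact Hf | exact Hl|].
  assert (E := cint_circ_primitive G (dslope f p l) z0 rho).
  rewrite <- cint_scal by (intros t _; now apply ccont_circ_kernel).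
  assert (Cf : forall t : R, ccont (fun t => f (circ z0 rho t)) t).
  { intros t. apply ccont_circ. destruct (Hf (circ z0 rho t)) as [l' Hl'].
    - apply circ_cdisc; lra.
    - exact (cderiv_ccont _ _ _ Hl'). }
  replace (cint _ _ _) with
    (cint (fun t => f (circ z0 rho t) * ((circ z0 rho t - z0) / (circ z0 rho t - p)))%C 0 (2 * PI)
     - cint (fun t => f p * ((circ z0 rho t - z0) / (circ z0 rho t - p)))%C 0 (2 * PI)
     + cint (fun t => f p * ((circ z0 rho t - z0) / (circ z0 rho t - p)))%C 0 (2 * PI))%C by ring.
  rewrite <- cint_minus.
  - rewrite (cint_ext _ (fun t => dslope f p l (circ z0 rho t) * (circ z0 rho t - z0))%C).
    + rewrite E; [ring|]. intros t.
      assert (D : cdisc z0 rho' (circ z0 rho t)) by (apply circ_cdisc; lra).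
      split; [now apply HG | now apply (dslope_ccont_holo f (cdisc z0 rho'))].
    + intros t _. assert (N := circ_neq z0 p rho t Hp).
      rewrite dslope_neq; [field; exact N|]. intros E'. apply N. rewrite E'. ring.
  - intros t _. apply ccont_mult; [apply Cf | now apply ccont_circ_kernel].
  - intros t _. apply ccont_mult; [apply ccont_const | now apply ccont_circ_kernel].
Qed.

Lemma circ_mean (f : C -> C) (z0 : C) (rho rho' : R) : 0 < rho -> rho < rho' -> holo f (cdisc z0 rho') ->
  cint (fun t => f (circ z0 rho t)) 0 (2 * PI) = (RtoC (2 * PI) * f z0)%C.
Proof.
  intros H0 HR Hf. assert (Hp : Cmod (z0 - z0) < rho) by now rewrite Cmod_diag.
  assert (E := cauchy_circ_aux f z0 z0 rho rho' Hp HR Hf).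
  rewrite (cint_ext _ (fun t => f (circ z0 rho t))) in E.
  - rewrite E. rewrite (cint_ext _ (fun _ => 1%C)).
    + rewrite cint_const, Rminus_0_r. ring.
    + intros t _. field. now apply circ_neq.
  - intros t _. field. now apply circ_neq.
Qed.

Lemma ccont_conj (f : C -> C) (z : C) : ccont f z -> ccont (fun w => Cconj (f w)) z.
Proof.
  intros H e He. destruct (H e He) as [d [Hd H1]]. exists d. split; [exact Hd|].
  intros w Hw. rewrite <- Cminus_conj, Cmod_conj. now apply H1.
Qed.

Lemma Cconj_mul_circ (z0 : C) (rho t : R) :
  ((circ z0 rho t - z0) * Cconj (circ z0 rho t - z0))%C = RtoC (rho * rho).
Proof.
  unfold circ. replace (z0 + rho * Cexp (Ci * t) - z0)%C with (rho * Cexp (Ci * t))%C by ring.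
  rewrite Cexp_Ci. unfold Cconj, Cmult, RtoC; simpl. pose proof (sin2_cos2 t) as E. unfold Rsqr in E.
  f_equal; [|ring].
  replace (_ - _) with (rho * rho * (sin t * sin t + cos t * cos t)) by ring. rewrite E. ring.
Qed.

(* On the circle [u conj(u) = rho^2], so the conjugate of the Cauchy kernel
   [u / (u - q)] is [rho^2 / (rho^2 - conj(q) u)], which is holomorphic in a larger
   cdisc and equal to [1] at the centre. *)
Lemma circ_conj_kernel (f : C -> C) (z0 p : C) (rho rho' : R) : Cmod (p - z0) < rho -> rho < rho' ->
  holo f (cdisc z0 rho') ->
  cint (fun t => Cconj (f (circ z0 rho t)) * ((circ z0 rho t - z0) / (circ z0 rho t - p)))%C 0 (2 * PI)
  = (RtoC (2 * PI) * Cconj (f z0))%C.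
Proof.
  intros Hp HR Hf. pose proof (Cmod_ge_0 (p - z0)) as H0.
  set (q := (p - z0)%C) in *. set (r := Cmod q) in *.
  (* The denominator [rho^2 - conj(q) (z - z0)] has no zero with [|z - z0| < rho^2 / r]. Replacing
     [r] by the mean of [rho] and [r] still leaves a radius above [rho] and allows [r = 0]. *)
  set (R1 := Rmin rho' (rho * rho / ((rho + r) / 2))).
  assert (Hr1 : rho < rho * rho / ((rho + r) / 2)).
  { apply Rmult_lt_reg_r with ((rho + r) / 2); [lra|].
    replace (rho * rho / ((rho + r) / 2) * ((rho + r) / 2)) with (rho * rho) by (field; lra). nra. }
  assert (HR1 : rho < R1) by now apply Rmin_glb_lt.
  set (g := fun z => (f z * (RtoC (rho * rho) / (RtoC (rho * rho) - Cconj q * (z - z0))))%C).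
  assert (Hden : forall z, cdisc z0 R1 z -> (RtoC (rho * rho) - Cconj q * (z - z0))%C <> 0%C).
  { intros z Hz. unfold cdisc in Hz. apply Cminus_neq_0. intros E.
    apply (f_equal Cmod) in E. rewrite Cmod_mult, Cmod_conj, Cmod_R in E. fold r in E.
    rewrite Rabs_right in E by nra.
    assert (Hz2 : Cmod (z - z0) < rho * rho / ((rho + r) / 2)) by (eapply Rlt_le_trans; [exact Hz | apply Rmin_r]).
    assert (r * Cmod (z - z0) <= (rho + r) / 2 * Cmod (z - z0)).
    { apply Rmult_le_compat_r; [apply Cmod_ge_0 | lra]. }
    assert ((rho + r) / 2 * Cmod (z - z0) < (rho + r) / 2 * (rho * rho / ((rho + r) / 2))).
    { apply Rmult_lt_compat_l; lra. }
    replace ((rho + r) / 2 * (rho * rho / ((rho + r) / 2))) with (rho * rho) in * by (field; lra). lra. }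
  assert (Hg : holo g (cdisc z0 R1)).
  { intros z Hz. destruct (Hf z) as [l Hl].
    { unfold cdisc in *. eapply Rlt_le_trans; [exact Hz | apply Rmin_l]. }
    eexists. apply cderiv_mult; [exact Hl|].
    apply cderiv_div; [now apply Hden | apply cderiv_const|].
    apply cderiv_minus; [apply cderiv_const|]. apply cderiv_mult; [apply cderiv_const|].
    apply cderiv_minus; [apply cderiv_id | apply cderiv_const]. }
  assert (E := circ_mean g z0 rho R1 ltac:(lra) HR1 Hg).
  apply (f_equal Cconj) in E. rewrite <- cint_conj in E.
  - rewrite (cint_ext _ (fun t => Cconj (g (circ z0 rho t)))).
    + rewrite E, Cmult_conj. f_equal.
      * unfold Cconj, RtoC; simpl. f_equal. ring.
      * f_equal. unfold g. replace (z0 - z0)%C with (RtoC 0) by ring.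
        rewrite Cmult_0_r. unfold Cminus. rewrite Copp_0, Cplus_0_r. field.
        intros E'. apply RtoC_inj in E'. nra.
    + intros t _. unfold g. rewrite Cmult_conj. f_equal.
      assert (N := circ_neq z0 p rho t Hp). assert (M := Cconj_mul_circ z0 rho t).
      replace (circ z0 rho t - p)%C with ((circ z0 rho t - z0) - q)%C in * by (unfold q; ring).
      assert (D : cdisc z0 R1 (circ z0 rho t)) by (apply circ_cdisc; lra).
      assert (N' := Hden _ D). set (u := (circ z0 rho t - z0)%C) in *.
      rewrite <- M in N' |- *.
      assert (Hu : u <> 0%C). { intros Hu. rewrite Hu in N'. apply N'. ring. }
      assert (N2 : (Cconj u - Cconj q)%C <> 0%C).
      { intros E'. apply N'. replace (u * Cconj u - Cconj q * u)%C with (u * (Cconj u - Cconj q))%C by ring.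
        rewrite E'. ring. }
      replace (u * Cconj u / (u * Cconj u - Cconj q * u))%C with (Cconj u / (Cconj u - Cconj q))%C
        by (field; split; [exact N' | exact N2]).
      rewrite Cdiv_conj, Cminus_conj, !Cconj_conj; [reflexivity | exact N2].
  - intros t _. apply ccont_circ. destruct (Hg (circ z0 rho t)) as [l Hl]; [apply circ_cdisc; lra|].
    exact (cderiv_ccont _ _ _ Hl).
Qed.

Lemma holo_const (k : C) (U : C -> Prop) : holo (fun _ => k) U.
Proof. intros z _. exists 0%C. apply cderiv_const. Qed.

Lemma Cconj_1 : Cconj 1 = 1%C.
Proof. unfold Cconj, RtoC; simpl. f_equal. ring. Qed.

(** The case of the constant 1 in [circ_conj_kernel]: the mean value property of the conjugate
    kernel takes the place of a winding number computation. *)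
Lemma circ_kernel (z0 p : C) (rho : R) : Cmod (p - z0) < rho ->
  cint (fun t => (circ z0 rho t - z0) / (circ z0 rho t - p))%C 0 (2 * PI) = RtoC (2 * PI).
Proof.
  intros Hp.
  rewrite (cint_ext _ (fun t => Cconj 1 * ((circ z0 rho t - z0) / (circ z0 rho t - p)))%C).
  - rewrite (circ_conj_kernel (fun _ => 1%C) z0 p rho (rho + 1) Hp); [|lra | apply holo_const].
    rewrite Cconj_1. ring.
  - intros t _. rewrite Cconj_1. ring.
Qed.

Theorem cauchy_circ (f : C -> C) (z0 p : C) (rho rho' : R) : Cmod (p - z0) < rho -> rho < rho' ->
  holo f (cdisc z0 rho') ->
  cint (fun t => f (circ z0 rho t) * ((circ z0 rho t - z0) / (circ z0 rho t - p)))%C 0 (2 * PI)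
  = (RtoC (2 * PI) * f p)%C.
Proof.
  intros Hp HR Hf. rewrite (cauchy_circ_aux f z0 p rho rho' Hp HR Hf), circ_kernel by exact Hp. ring.
Qed.

Lemma Cplus_conj_Re (a : C) : (a + Cconj a)%C = RtoC (2 * Re a).
Proof. destruct a. unfold Cconj, Cplus, RtoC, Re; simpl. f_equal; ring. Qed.

(* The Cauchy formula and [circ_conj_kernel] add up to a formula for
   [f p + conj (f z0)] in terms of [2 Re f] on the circle, where
   [|Re f| <= 2 M - Re f] has a known mean. *)
Theorem borel_caratheodory (f : C -> C) (z0 p : C) (rho rho' M : R) : Cmod (p - z0) < rho -> rho < rho' ->
  holo f (cdisc z0 rho') -> 0 <= M ->
  (forall z, cdisc z0 rho' z -> Re (f z) <= M) ->
  Cmod (f p) <= Cmod (f z0) + 2 * rho / (rho - Cmod (p - z0)) * (2 * M + Cmod (f z0)).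
Proof.
  intros Hp HR Hf HM Hre. pose proof (Cmod_ge_0 (p - z0)) as H0. set (r := Cmod (p - z0)) in *.
  pose proof PI_RGT_0 as Hpi.
  assert (D : forall t : R, cdisc z0 rho' (circ z0 rho t)) by (intros t; apply circ_cdisc; lra).
  assert (Cf : forall t : R, ccont (fun t => f (circ z0 rho t)) t).
  { intros t. apply ccont_circ. destruct (Hf _ (D t)) as [l Hl]. exact (cderiv_ccont _ _ _ Hl). }
  assert (E1 := cauchy_circ f z0 p rho rho' Hp HR Hf).
  assert (E2 := circ_conj_kernel f z0 p rho rho' Hp HR Hf).
  set (K := fun t => ((circ z0 rho t - z0) / (circ z0 rho t - p))%C) in *.
  assert (CK : forall t : R, ccont K t) by (intros; now apply ccont_circ_kernel).
  assert (E3 : cint (fun t => (f (circ z0 rho t) + Cconj (f (circ z0 rho t))) * K t)%C 0 (2 * PI)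
     = (RtoC (2 * PI) * (f p + Cconj (f z0)))%C).
  { rewrite (cint_ext _ (fun t => f (circ z0 rho t) * K t + Cconj (f (circ z0 rho t)) * K t)%C)
      by (intros; ring).
    rewrite (cint_plus (fun t => f (circ z0 rho t) * K t)%C).
    - unfold K. rewrite E1, E2. ring.
    - intros t _. apply ccont_mult; [apply Cf | apply CK].
    - intros t _. apply ccont_mult; [apply ccont_conj, Cf | apply CK]. }
  assert (Im0 := cint_is (fun t => f (circ z0 rho t)) 0 (2 * PI) (fun t _ => Cf t)).
  rewrite (circ_mean f z0 rho rho') in Im0; try lra; try assumption.
  apply (is_RInt_fct_extend_fst (U := R_NormedModule) (V := R_NormedModule)) in Im0.
  (* This bounds the kernel [K] on the circle, whose points are at distance [rho] from [z0] and at
     least [rho - r] from [p]. *)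
  set (A := rho / (rho - r)).
  assert (HA : 0 < A) by (apply Rdiv_lt_0_compat; lra).
  assert (Ig : is_RInt (fun t : R => 2 * A * (2 * M - Re (f (circ z0 rho t)))) 0 (2 * PI)
      (2 * A * (2 * M * (2 * PI) - 2 * PI * Re (f z0)))).
  { apply (is_RInt_scal (V := R_NormedModule)).
    apply (is_RInt_minus (V := R_NormedModule)).
    - replace (2 * M * (2 * PI)) with (scal (V := R_NormedModule) (2 * PI - 0) (2 * M))
        by (unfold scal; simpl; unfold mult; simpl; ring).
      apply (is_RInt_const (V := R_NormedModule)).
    - replace (2 * PI * Re (f z0)) with (fst (RtoC (2 * PI) * f z0)%C)
        by (unfold Cmult, RtoC, Re; simpl; ring). exact Im0. }
  assert (B := cint_norm_le (fun t => (f (circ z0 rho t) + Cconj (f (circ z0 rho t))) * K t)%C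
     (fun t : R => 2 * A * (2 * M - Re (f (circ z0 rho t)))) 0 (2 * PI)).
  rewrite (is_RInt_unique _ _ _ _ Ig), E3 in B.
  assert (B' : Cmod (RtoC (2 * PI) * (f p + Cconj (f z0)))
     <= 2 * A * (2 * M * (2 * PI) - 2 * PI * Re (f z0))).
  { apply B; [lra| |eexists; exact Ig|].
    - intros t _. apply ccont_mult; [apply ccont_plus; [apply Cf | apply ccont_conj, Cf] | apply CK].
    - intros t _. rewrite Cplus_conj_Re, Cmod_mult, Cmod_R, Rabs_mult, (Rabs_right 2) by lra.
      assert (HK : Cmod (K t) <= A).
      { unfold K. rewrite Cmod_div, circ_dist by (try apply circ_neq; lra || exact Hp).
        unfold A, Rdiv. apply Rmult_le_compat_l; [lra|]. apply Rinv_le_contravar; [lra|].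
        pose proof (Cmod_triangle_minus (circ z0 rho t) p z0) as T. rewrite circ_dist in T by lra.
        fold r in T. lra. }
      assert (HRe : Rabs (Re (f (circ z0 rho t))) <= 2 * M - Re (f (circ z0 rho t))).
      { specialize (Hre _ (D t)). unfold Rabs. destruct Rcase_abs; lra. }
      pose proof (Rabs_pos (Re (f (circ z0 rho t)))). pose proof (Cmod_ge_0 (K t)). nra. }
  rewrite Cmod_mult, Cmod_R, Rabs_right in B' by lra.
  assert (B2 : Cmod (f p + Cconj (f z0)) <= 2 * A * (2 * M - Re (f z0))).
  { apply Rmult_le_reg_l with (2 * PI); [lra|]. eapply Rle_trans; [exact B'|]. right. ring. }
  pose proof (Cmod_le_minus (f p) (- Cconj (f z0))) as T. rewrite Cmod_opp, Cmod_conj in T.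
  replace (f p - - Cconj (f z0))%C with (f p + Cconj (f z0))%C in T by ring.
  replace (2 * rho / (rho - r)) with (2 * A) by (unfold A; field; lra).
  assert (Re (f z0) >= - Cmod (f z0)).
  { pose proof (re_le_Cmod (f z0)). pose proof (Rle_abs (- Re (f z0))). rewrite Rabs_Ropp in *. lra. }
  assert (2 * A * (2 * M - Re (f z0)) <= 2 * A * (2 * M + Cmod (f z0))).
  { apply Rmult_le_compat_l; lra. }
  lra.
Qed.

(** * Derivatives and logarithms of holomorphic functions *)

(** A quadratic remainder that is uniform along the path integrates to a quadratic remainder, so
    differentiation under the integral needs no compactness argument here. *)
Lemma cderiv_cint_param (K : C -> C -> C) (K' : C -> C) (p : C) (a b d B : R) :
  a <= b -> 0 < d -> 0 <= B ->
  (forall w, Cmod (w - p) < d -> ccont_seg (K w) a b) -> ccont_seg K' a b ->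
  (forall w (t : R), Cmod (w - p) < d -> a <= t <= b ->
     Cmod (K w t - K p t - K' t * (w - p)) <= B * Cmod (w - p) ^ 2) ->
  cderiv (fun w => cint (K w) a b) p (cint K' a b).
Proof.
  intros Hab Hd HB HK HK' H. apply cderiv_of_estimate. intros e He.
  set (A := (b - a) * B + 1).
  assert (HA : 0 < A) by (unfold A; nra).
  exists (Rmin d (e / A)). split; [apply Rmin_glb_lt; [exact Hd | now apply Rdiv_lt_0_compat]|].
  intros w Hw. assert (Hw1 := Rlt_le_trans _ _ _ Hw (Rmin_l _ _)).
  assert (Hw2 := Rlt_le_trans _ _ _ Hw (Rmin_r _ _)).
  assert (Hp : Cmod (p - p) < d) by now rewrite Cmod_diag.
  rewrite (Cmult_comm (cint K' a b)), <- cint_scal, <- cint_minus, <- cint_minus; auto.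
  - eapply Rle_trans; [apply (cint_norm_le_const _ (B * Cmod (w - p) ^ 2)); [exact Hab| |]|].
    + intros t Ht. apply ccont_minus; [apply ccont_minus; [now apply HK | now apply HK]|].
      apply ccont_mult; [apply ccont_const | now apply HK'].
    + intros t Ht. replace ((w - p) * K' t)%C with (K' t * (w - p))%C by ring. now apply H.
    + pose proof (Cmod_ge_0 (w - p)) as Hm. set (m := Cmod (w - p)) in *.
      replace ((b - a) * (B * m ^ 2)) with (((b - a) * B * m) * m) by ring.
      apply Rmult_le_compat_r; [exact Hm|].
      apply Rle_trans with (A * (e / A)); [|right; field; lra].
      apply Rle_trans with (A * m); [unfold A; nra|]. apply Rmult_le_compat_l; lra.
  - intros t Ht. apply ccont_minus; now apply HK.
  - intros t Ht. apply ccont_mult; [apply ccont_const | now apply HK'].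
Qed.

Lemma Cmod_quot_le (a b : C) (A B : R) : 0 < B -> Cmod a <= A -> B <= Cmod b ->
  Cmod (a / b) <= A / B.
Proof.
  intros HB Ha Hb. assert (Hn : b <> 0%C) by (apply Cmod_gt_0; lra).
  rewrite Cmod_div by exact Hn. unfold Rdiv. pose proof (Cmod_ge_0 a).
  apply Rmult_le_compat; [apply Cmod_ge_0| |exact Ha | apply Rinv_le_contravar; lra].
  left. apply Rinv_0_lt_compat. lra.
Qed.

(** The remainders of [1/(u - w)] and [1/(u - w)^2] to first order in [w - p] are explicit multiples
    of [(w - p)^2]. With [d] half the distance from [p] to the circle, all denominators stay at
    least [d] in modulus. *)
Lemma cderiv_cauchy_transform (phi : C -> C) (z0 p : C) (rho : R) : Cmod (p - z0) < rho ->
  (forall t : R, ccont phi t) ->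
  cderiv (fun w => cint (fun t => phi t / (circ z0 rho t - w))%C 0 (2 * PI)) p
    (cint (fun t => phi t / ((circ z0 rho t - p) * (circ z0 rho t - p)))%C 0 (2 * PI)) /\
  cderiv (fun w => cint (fun t => phi t / ((circ z0 rho t - w) * (circ z0 rho t - w)))%C 0 (2 * PI)) p
    (cint (fun t => 2 * phi t / ((circ z0 rho t - p) * (circ z0 rho t - p) * (circ z0 rho t - p)))%C 0 (2 * PI)).
Proof.
  intros Hp Hphi. pose proof PI_RGT_0 as Hpi. pose proof (Cmod_ge_0 (p - z0)) as H0.
  set (d := (rho - Cmod (p - z0)) / 2). assert (Hd : 0 < d) by (unfold d; lra).
  assert (Ed : d = (rho - Cmod (p - z0)) / 2) by reflexivity. clearbody d.
  assert (HM : exists M, 0 <= M /\ forall t, 0 <= t <= 2 * PI -> Cmod (phi (RtoC t)) <= M).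
  { destruct (continuity_ab_maj (fun t => Cmod (phi (RtoC t))) 0 (2 * PI)) as [m [Hm _]]; [lra| |].
    - intros t _. apply continuity_pt_filterlim. apply filterlim_locally. intros eps.
      destruct (Hphi t eps (cond_pos eps)) as [d' [Hd' H]]. exists (mkposreal d' Hd').
      intros u Hu. assert (Hc : Cmod (RtoC u - RtoC t) < d') by (rewrite <- RtoC_minus, Cmod_R; exact Hu).
      specialize (H u Hc). unfold ball; simpl. unfold AbsRing_ball, abs, minus, plus, opp; simpl.
      pose proof (Cmod_le_minus (phi u) (phi t)). pose proof (Cmod_le_minus (phi t) (phi u)).
      rewrite (Cmod_minus_sym (phi t)) in *. apply Rabs_def1; lra.
    - exists (Cmod (phi (RtoC m))). split; [apply Cmod_ge_0 | exact Hm]. }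
  destruct HM as [M [HM0 HM]].
  assert (Far : forall w (t : R), Cmod (w - p) < d -> d <= Cmod (circ z0 rho t - w)).
  { intros w t Hw. pose proof (Cmod_triangle_minus (circ z0 rho t) w z0) as T1.
    pose proof (Cmod_triangle_minus w p z0). rewrite circ_dist in T1 by lra. lra. }
  assert (Neq : forall w (t : R), Cmod (w - p) < d -> (circ z0 rho t - w)%C <> 0%C).
  { intros w t Hw. apply Cmod_gt_0. specialize (Far w t Hw). lra. }
  assert (Hpp : Cmod (p - p) < d) by now rewrite Cmod_diag.
  assert (Near : forall t : R, Cmod (circ z0 rho t - p) <= 2 * rho).
  { intros t. pose proof (Cmod_triangle_minus (circ z0 rho t) z0 p) as T1.
    rewrite circ_dist in T1 by lra. rewrite (Cmod_minus_sym z0) in T1. lra. }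
  split.
  - apply (cderiv_cint_param _ _ p 0 (2 * PI) d (M / (d * d * d))); [lra | exact Hd | | | |].
    + apply Rdiv_le_0_compat; [exact HM0|]. repeat apply Rmult_lt_0_compat; exact Hd.
    + intros w Hw t _. apply ccont_div; [apply Hphi | apply ccont_circ_minus | now apply Neq].
    + intros t _. apply ccont_div; [apply Hphi | apply ccont_mult; apply ccont_circ_minus |].
      apply Cmult_neq_0; now apply Neq.
    + intros w t Hw Ht. assert (N1 := Neq w t Hw). assert (N2 := Neq p t Hpp).
      assert (F1 := Far w t Hw). assert (F2 := Far p t Hpp).
      replace (_ - _ - _)%C with ((phi t / ((circ z0 rho t - p) * (circ z0 rho t - p) * (circ z0 rho t - w))) *
         ((w - p) * (w - p)))%C by (field; split; assumption).
      rewrite Cmod_mult, (Cmod_mult (w - p)).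
      replace (Cmod (w - p) ^ 2) with (Cmod (w - p) * Cmod (w - p)) by ring.
      apply Rmult_le_compat_r; [apply Rmult_le_pos; apply Cmod_ge_0|].
      apply Cmod_quot_le; [repeat apply Rmult_lt_0_compat; exact Hd | now apply HM|].
      rewrite !Cmod_mult. repeat apply Rmult_le_compat; try lra. nra.
  (* The numerator of the remainder contains [3 (u - p) - 2 (w - p)], of modulus at most
     [6 rho + 2 d]. *)
  - apply (cderiv_cint_param _ _ p 0 (2 * PI) d (M * (8 * rho + 2 * d) / (d * d * d * (d * d)))); [lra | exact Hd | | | |].
    + apply Rdiv_le_0_compat; [apply Rmult_le_pos; lra|]. repeat apply Rmult_lt_0_compat; exact Hd.
    + intros w Hw t _. apply ccont_div; [apply Hphi | apply ccont_mult; apply ccont_circ_minus |].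
      apply Cmult_neq_0; now apply Neq.
    + intros t _. apply ccont_div; [apply ccont_mult; [apply ccont_const | apply Hphi]| |].
      * repeat apply ccont_mult; apply ccont_circ_minus.
      * repeat apply Cmult_neq_0; now apply Neq.
    + intros w t Hw Ht. assert (N1 := Neq w t Hw). assert (N2 := Neq p t Hpp).
      assert (F1 := Far w t Hw). assert (F2 := Far p t Hpp).
      replace (_ - _ - _)%C with ((phi t * (3 * (circ z0 rho t - p) - 2 * (w - p)) /
         ((circ z0 rho t - p) * (circ z0 rho t - p) * (circ z0 rho t - p) *
          ((circ z0 rho t - w) * (circ z0 rho t - w)))) *
         ((w - p) * (w - p)))%C by (field; split; assumption).
      rewrite Cmod_mult, (Cmod_mult (w - p)).
      replace (Cmod (w - p) ^ 2) with (Cmod (w - p) * Cmod (w - p)) by ring.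
      apply Rmult_le_compat_r; [apply Rmult_le_pos; apply Cmod_ge_0|].
      apply Cmod_quot_le; [repeat apply Rmult_lt_0_compat; exact Hd | |].
      * rewrite Cmod_mult. apply Rmult_le_compat; try apply Cmod_ge_0; [now apply HM|].
        unfold Cminus at 1. eapply Rle_trans; [apply Cmod_triangle|].
        rewrite Cmod_opp, !Cmod_mult, !Cmod_R, !Rabs_right by lra. specialize (Near t). lra.
      * rewrite !Cmod_mult. assert (0 < d * d) by nra.
        repeat apply Rmult_le_compat; try lra; nra.
Qed.

(** Near [z] the function is a Cauchy integral over a circle of half the available radius. Its first
    derivative is again an integral, identified with [f'] by uniqueness, and this one can be
    differentiated once more. It is needed to make [f' / f] holomorphic in [holo_log]. *)
Theorem holo_deriv (f f' : C -> C) (U : C -> Prop) : copen U ->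
  (forall z, U z -> cderiv f z (f' z)) -> holo f' U.
Proof.
  intros HU Hf z Hz. destruct (HU z Hz) as [d [Hd HdU]].
  pose proof PI_RGT_0 as Hpi.
  assert (Hf0 : holo f (cdisc z d)). { intros w Hw. exists (f' w). apply Hf, HdU, Hw. }
  set (rho := d / 2).
  set (phi := fun t => (f (circ z rho t) * (circ z rho t - z) / RtoC (2 * PI))%C).
  assert (N2 : RtoC (2 * PI) <> 0%C). { intros E. apply RtoC_inj in E. lra. }
  assert (Hphi : forall t : R, ccont phi t).
  { intros t. apply ccont_div; [|apply ccont_const | exact N2].
    apply ccont_mult; [|apply ccont_circ_minus]. apply ccont_circ.
    destruct (Hf0 (circ z rho t)) as [l Hl]; [apply circ_cdisc; unfold rho; lra|].
    exact (cderiv_ccont _ _ _ Hl). }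
  assert (E : forall w, Cmod (w - z) < rho -> cint (fun t => phi t / (circ z rho t - w))%C 0 (2 * PI) = f w).
  { intros w Hw. replace (f w) with (/ RtoC (2 * PI) * (RtoC (2 * PI) * f w))%C by (field; exact N2).
    rewrite <- (cauchy_circ f z w rho d Hw); [|unfold rho; lra | exact Hf0].
    rewrite <- cint_scal.
    - apply cint_ext. intros t _. unfold phi. field. split; [now apply circ_neq | exact N2].
    - intros t _. apply ccont_mult; [|now apply ccont_circ_kernel]. apply ccont_circ.
      destruct (Hf0 (circ z rho t)) as [l Hl]; [apply circ_cdisc; unfold rho; lra|].
      exact (cderiv_ccont _ _ _ Hl). }
  assert (Hrho : 0 < rho) by (unfold rho; lra).
  assert (E' : forall w, Cmod (w - z) < rho ->
     cint (fun t => phi t / ((circ z rho t - w) * (circ z rho t - w)))%C 0 (2 * PI) = f' w).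
  { intros w Hw. apply (cderiv_unique f w).
    - apply (cderiv_ext_loc (fun w => cint (fun t => phi t / (circ z rho t - w))%C 0 (2 * PI)) f w _ (rho - Cmod (w - z))).
      + lra.
      + intros v Hv. apply E. pose proof (Cmod_triangle_minus v w z). lra.
      + exact (proj1 (cderiv_cauchy_transform phi z w rho Hw Hphi)).
    - apply Hf, HdU. unfold rho in *. lra. }
  eexists. eapply (cderiv_ext_loc _ f' z _ rho Hrho).
  - exact E'.
  - refine (proj2 (cderiv_cauchy_transform phi z z rho _ Hphi)). now rewrite Cmod_diag.
Qed.

Lemma cderiv_0_const (f : C -> C) (U : C -> Prop) (z0 : C) : box_star U z0 ->
  (forall z, U z -> cderiv f z 0) -> forall z, U z -> f z = f z0.
Proof.
  intros [_ [_ HB]] Hf z Hz.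
  assert (K : forall a b, ccont_seg (fun _ => 0%C) a b) by (intros a b t _; apply ccont_const).
  assert (Z : forall a b, cint (fun _ => 0%C) a b = 0%C) by (intros; rewrite cint_const; ring).
  assert (E1 := hint_ftc f (fun _ => 0%C) (Im z0) (Re z0) (Re z)).
  assert (E2 := vint_ftc f (fun _ => 0%C) (Re z) (Im z0) (Im z)).
  unfold hint, vint in *. rewrite Z in *. rewrite !pt_eta in *.
  transitivity (f (Re z + Ci * Im z0)%C).
  - replace (f z) with (f (Re z + Ci * Im z0)%C + (f z - f (Re z + Ci * Im z0)%C))%C by ring.
    rewrite <- E2; [ring| |apply K]. intros t Ht. apply Hf, (HB z); [exact Hz|].
    apply cbox_pt; [apply Rminmax_r | exact Ht].
  - replace (f (Re z + Ci * Im z0)%C) with (f z0 + (f (Re z + Ci * Im z0)%C - f z0))%C by ring.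
    rewrite <- E1; [ring| |apply K]. intros t Ht. apply Hf, (HB z); [exact Hz|].
    apply cbox_pt; [exact Ht | apply Rminmax_l].
Qed.

Lemma Cexp_surj (c : C) : c <> 0%C -> exists a, Cexp a = c.
Proof.
  intros Hc. assert (Hm := proj1 (Cmod_gt_0 c) Hc). set (m := Cmod c) in *.
  set (x := Re c / m). set (y := Im c / m).
  assert (Hxy : x * x + y * y = 1).
  { assert (E := Cmod2_alt c). fold m in E. unfold x, y.
    replace (Re c / m * (Re c / m) + Im c / m * (Im c / m)) with ((Re c ^ 2 + Im c ^ 2) / (m * m)) by (field; lra).
    rewrite <- E. field. lra. }
  assert (Hx : -1 <= x <= 1) by nra.
  assert (Hth : exists th, cos th = x /\ sin th = y).
  { assert (Es : sqrt (1 - x²) = Rabs y).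
    { replace (1 - x²) with (y²) by (unfold Rsqr; lra). apply sqrt_Rsqr_abs. }
    destruct (Rle_dec 0 y) as [Hy|Hy].
    - exists (acos x). rewrite cos_acos, sin_acos, Es, Rabs_right by lra. tauto.
    - exists (- acos x). rewrite cos_neg, sin_neg, cos_acos, sin_acos, Es, Rabs_left by lra.
      split; [reflexivity | ring]. }
  destruct Hth as [th [H1 H2]]. exists (ln m, th). unfold Cexp; simpl.
  rewrite exp_ln, H1, H2 by exact Hm. unfold x, y.
  rewrite (surjective_pairing c). unfold Re, Im. simpl. f_equal; field; lra.
Qed.

(* Arbitrary where [f] is not differentiable. *)
Definition cder (f : C -> C) (z : C) : C := epsilon (inhabits (RtoC 0)) (cderiv f z).

Lemma cder_spec (f : C -> C) (U : C -> Prop) : holo f U -> forall z, U z -> cderiv f z (cder f z).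
Proof. intros H z Hz. exact (epsilon_spec _ _ (H z Hz)). Qed.

(** If [G] is a primitive of [f' / f], then [f / exp G] has derivative zero and is a nonzero
    constant [exp a]; the logarithm is [G + a]. *)
Theorem holo_log (f : C -> C) (U : C -> Prop) (z0 : C) : box_star U z0 -> holo f U ->
  (forall z, U z -> f z <> 0%C) ->
  exists F, forall z, U z -> Cexp (F z) = f z /\ cderiv F z (cder f z / f z)%C.
Proof.
  intros HU Hf Hn. assert (Hd := cder_spec f U Hf).
  assert (Hd2 := holo_deriv f (cder f) U (proj1 HU) Hd).
  assert (Hq : holo (fun z => cder f z / f z)%C U).
  { intros z Hz. destruct (Hd2 z Hz) as [l Hl]. eexists.
    apply cderiv_div; [now apply Hn | exact Hl | now apply Hd]. }
  destruct (holo_primitive (fun z => cder f z / f z)%C U z0 z0 HU) as [G HG].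
  { intros z Hz. destruct (Hq z Hz) as [l Hl]. exact (cderiv_ccont _ _ _ Hl). }
  { intros z Hz _. now apply Hq. }
  destruct (Cexp_surj (f z0 / Cexp (G z0))%C) as [a Ha].
  { apply Cmult_neq_0; [apply Hn, HU|]. intros E.
    assert (E1 : (Cexp (G z0) * / Cexp (G z0))%C = 1%C) by (apply Cinv_r, Cexp_neq_0).
    rewrite E in E1. rewrite Cmult_0_r in E1. apply RtoC_inj in E1. lra. }
  exists (fun z => G z + a)%C. intros z Hz. split.
  - assert (E : (f z / Cexp (G z))%C = (f z0 / Cexp (G z0))%C).
    { apply (cderiv_0_const (fun z => f z / Cexp (G z))%C U z0 HU); [|exact Hz].
      intros w Hw. eapply cderiv_eq.
      - apply cderiv_div; [apply Cexp_neq_0 | now apply Hd|].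
        apply (cderiv_comp Cexp G); [apply Cexp_cderiv | now apply HG].
      - cbv beta. field. split; [now apply Hn | apply Cexp_neq_0]. }
    rewrite Cexp_plus, Ha, <- E. field. apply Cexp_neq_0.
  - eapply cderiv_eq; [apply cderiv_plus; [now apply HG | apply cderiv_const]|]. ring.
Qed.

(** * Newman's contour *)

Lemma cint_Re_ge (f : C -> C) (a b k : R) : a <= b -> ccont_seg f a b ->
  (forall t : R, a <= t <= b -> k <= Re (f t)) -> (b - a) * k <= Re (cint f a b).
Proof.
  intros Hab Hf H. assert (I := cint_is f a b Hf).
  apply (is_RInt_fct_extend_fst (U := R_NormedModule) (V := R_NormedModule)) in I.
  apply (is_RInt_le (fun _ => k) (fun t : R => fst (f t)) a b); [exact Hab | |exact I|].
  - apply (is_RInt_const (V := R_NormedModule)).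
  - intros t Ht. apply H. lra.
Qed.

Lemma cint_Im_ge (f : C -> C) (a b k : R) : a <= b -> ccont_seg f a b ->
  (forall t : R, a <= t <= b -> k <= Im (f t)) -> (b - a) * k <= Im (cint f a b).
Proof.
  intros Hab Hf H. assert (I := cint_is f a b Hf).
  apply (is_RInt_fct_extend_snd (U := R_NormedModule) (V := R_NormedModule)) in I.
  apply (is_RInt_le (fun _ => k) (fun t : R => snd (f t)) a b); [exact Hab | |exact I|].
  - apply (is_RInt_const (V := R_NormedModule)).
  - intros t Ht. apply H. lra.
Qed.

Lemma cint_Im_le (f : C -> C) (a b k : R) : a <= b -> ccont_seg f a b ->
  (forall t : R, a <= t <= b -> Im (f t) <= k) -> Im (cint f a b) <= (b - a) * k.
Proof.
  intros Hab Hf H. assert (I := cint_is f a b Hf).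
  apply (is_RInt_fct_extend_snd (U := R_NormedModule) (V := R_NormedModule)) in I.
  apply (is_RInt_le (fun t : R => snd (f t)) (fun _ => k) a b); [exact Hab | exact I| |].
  - apply (is_RInt_const (V := R_NormedModule)).
  - intros t Ht. apply H. lra.
Qed.

Lemma cint_Re_le (f : C -> C) (a b k : R) : a <= b -> ccont_seg f a b ->
  (forall t : R, a <= t <= b -> Re (f t) <= k) -> Re (cint f a b) <= (b - a) * k.
Proof.
  intros Hab Hf H. assert (I := cint_is f a b Hf).
  apply (is_RInt_fct_extend_fst (U := R_NormedModule) (V := R_NormedModule)) in I.
  apply (is_RInt_le (fun t : R => fst (f t)) (fun _ => k) a b); [exact Hab | exact I| |].
  - apply (is_RInt_const (V := R_NormedModule)).
  - intros t Ht. apply H. lra.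
Qed.

Lemma pt_neq_0 (x y : R) : x <> 0 \/ y <> 0 -> (x + Ci * y)%C <> 0%C.
Proof.
  intros H E. assert (E1 := f_equal Re E). assert (E2 := f_equal Im E).
  rewrite Re_pt in E1. rewrite Im_pt in E2. unfold Re, Im, RtoC in *; simpl in *. lra.
Qed.

Lemma Re_inv_pt (x y : R) : Re (/ (x + Ci * y))%C = x / (x ^ 2 + y ^ 2).
Proof.
  unfold Re, Cinv, Ci, Cplus, Cmult, RtoC; simpl. apply f_equal2; ring.
Qed.

Lemma Im_inv_pt (x y : R) : Im (/ (x + Ci * y))%C = - y / (x ^ 2 + y ^ 2).
Proof.
  unfold Im, Cinv, Ci, Cplus, Cmult, RtoC; simpl. apply f_equal2; ring.
Qed.

(** Continuity is asked for on the sides only, since the integrands [1/z] and [f z / z] have a pole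
    inside the rectangle. *)
Definition ccont_bd (f : C -> C) (a b c d : R) : Prop :=
  forall z, cbox a b c d z -> (Re z = a \/ Re z = b \/ Im z = c \/ Im z = d) -> ccont f z.

Lemma ccont_bd_h (f : C -> C) (a b c d y : R) : ccont_bd f a b c d -> y = c \/ y = d ->
  ccont_seg (fun t => f (t + Ci * y)%C) a b.
Proof.
  intros H Hy t Ht. apply ccont_h, H.
  - apply cbox_pt; [exact Ht|]. destruct Hy as [->| ->]; [apply Rminmax_l | apply Rminmax_r].
  - rewrite Im_pt. tauto.
Qed.

Lemma ccont_bd_v (f : C -> C) (a b c d x : R) : ccont_bd f a b c d -> x = a \/ x = b ->
  ccont_seg (fun t => f (x + Ci * t)%C) c d.
Proof.
  intros H Hx t Ht. apply ccont_v, H.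
  - apply cbox_pt; [|exact Ht]. destruct Hx as [->| ->]; [apply Rminmax_l | apply Rminmax_r].
  - rewrite Re_pt. tauto.
Qed.

Lemma rect_comb_bd (f g h : C -> C) (k : C) (a b c d : R) :
  ccont_bd f a b c d -> ccont_bd g a b c d ->
  (forall z, cbox a b c d z -> (Re z = a \/ Re z = b \/ Im z = c \/ Im z = d) ->
     h z = (f z + k * g z)%C) ->
  rect h a b c d = (rect f a b c d + k * rect g a b c d)%C.
Proof.
  intros Hf Hg H. unfold rect.
  assert (Hh : forall y, y = c \/ y = d -> hint h y a b = (hint f y a b + k * hint g y a b)%C).
  { intros y Hy. unfold hint. rewrite <- cint_scal by now apply (ccont_bd_h g a b c d).
    rewrite <- (cint_plus (fun t => f (t + Ci * y)%C)).
    - apply cint_ext. intros t Ht. apply H; [|rewrite Im_pt; tauto]. apply cbox_pt; [lra|].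
      destruct Hy as [->| ->]; [apply Rminmax_l | apply Rminmax_r].
    - now apply (ccont_bd_h f a b c d).
    - intros t Ht. apply ccont_mult; [apply ccont_const | now apply (ccont_bd_h g a b c d)]. }
  assert (Hv : forall x, x = a \/ x = b -> vint h x c d = (vint f x c d + k * vint g x c d)%C).
  { intros x Hx. unfold vint. rewrite <- cint_scal by now apply (ccont_bd_v g a b c d).
    rewrite <- (cint_plus (fun t => f (x + Ci * t)%C)).
    - apply cint_ext. intros t Ht. apply H; [|rewrite Re_pt; tauto]. apply cbox_pt; [|lra].
      destruct Hx as [->| ->]; [apply Rminmax_l | apply Rminmax_r].
    - now apply (ccont_bd_v f a b c d).
    - intros t Ht. apply ccont_mult; [apply ccont_const | now apply (ccont_bd_v g a b c d)]. }
  rewrite !Hh, !Hv by tauto. ring.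
Qed.

Lemma quot_nonneg (a b : R) : 0 <= a -> 0 < b -> 0 <= a / b.
Proof. intros Ha Hb. now apply Rdiv_le_0_compat. Qed.

(* Only a lower bound for the winding integral is needed: each side contributes
   a nonnegative imaginary part, and the right side alone contributes [1]. *)
Lemma rect_inv_Im_ge (eta T : R) : 0 < eta -> 0 < T ->
  1 <= Im (rect (fun z => / z)%C (- eta) T (- T) T).
Proof.
  intros He HT. unfold rect.
  assert (Hh : forall y, y <> 0 -> ccont_seg (fun t => / (t + Ci * y))%C (- eta) T).
  { intros y Hy t _. apply (ccont_h (fun z => / z)%C).
    apply ccont_inv; [apply ccont_id | apply pt_neq_0; tauto]. }
  assert (Hv : forall x, x <> 0 -> ccont_seg (fun t => / (x + Ci * t))%C (- T) T).
  { intros x Hx t _. apply (ccont_v (fun z => / z)%C).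
    apply ccont_inv; [apply ccont_id | apply pt_neq_0; tauto]. }
  assert (B1 : 0 <= Im (hint (fun z => / z)%C (- T) (- eta) T)).
  { replace 0 with ((T - - eta) * 0) by ring. apply cint_Im_ge; [lra | apply Hh; lra|].
    intros t _. rewrite Im_inv_pt. apply quot_nonneg; nra. }
  assert (B2 : Im (hint (fun z => / z)%C T (- eta) T) <= 0).
  { replace 0 with ((T - - eta) * 0) by ring. apply cint_Im_le; [lra | apply Hh; lra|].
    intros t _. rewrite Im_inv_pt. replace (- T / (t ^ 2 + T ^ 2)) with (- (T / (t ^ 2 + T ^ 2))) by (field; nra).
    assert (0 <= T / (t ^ 2 + T ^ 2)) by (apply quot_nonneg; nra). lra. }
  assert (B3 : Re (vint (fun z => / z)%C (- eta) (- T) T) <= 0).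
  { replace 0 with ((T - - T) * 0) by ring. apply cint_Re_le; [lra | apply Hv; lra|].
    intros t _. rewrite Re_inv_pt. replace (- eta / ((- eta) ^ 2 + t ^ 2)) with (- (eta / (eta ^ 2 + t ^ 2))) by (field; nra).
    assert (0 <= eta / (eta ^ 2 + t ^ 2)) by (apply quot_nonneg; nra). lra. }
  assert (B4 : 1 <= Re (vint (fun z => / z)%C T (- T) T)).
  (* On this side of length [2 T] one has [t^2 <= T^2], so the real part [T / (T^2 + t^2)] is at
     least [1 / (2 T)]. *)
  { replace 1 with ((T - - T) * / (2 * T)) by (field; lra). apply cint_Re_ge; [lra | apply Hv; lra|].
    intros t Ht. rewrite Re_inv_pt.
    assert (HP : 0 < T ^ 2 + t ^ 2) by nra.
    apply Rmult_le_reg_r with ((2 * T) * (T ^ 2 + t ^ 2)); [apply Rmult_lt_0_compat; lra|].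
    replace (/ (2 * T) * (2 * T * (T ^ 2 + t ^ 2))) with (T ^ 2 + t ^ 2) by (field; lra).
    replace (T / (T ^ 2 + t ^ 2) * (2 * T * (T ^ 2 + t ^ 2))) with (2 * T ^ 2) by (field; lra). nra. }
  set (h1 := hint _ (- T) _ _) in *. set (h2 := hint _ T _ _) in *.
  set (v1 := vint _ T _ _) in *. set (v2 := vint _ (- eta) _ _) in *.
  replace (Im (h1 + Ci * v1 - h2 - Ci * v2)%C) with (Im h1 + Re v1 - Im h2 - Re v2); [lra|].
  unfold Im, Re, Ci, Cminus, Copp, Cplus, Cmult; simpl. ring.
Qed.

(** On the boundary [f z / z] is the difference quotient of [f] at 0, whose integral vanishes, plus
    [f 0 / z], whose integral has modulus at least [|f 0|] by [rect_inv_Im_ge]. The true factor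
    [2 PI] is given away. *)
Lemma rect_residue_le (f : C -> C) (U : C -> Prop) (eta T : R) : 0 < eta -> 0 < T ->
  box_star U 0 -> holo f U -> (forall z, cbox (- eta) T (- T) T z -> U z) ->
  Cmod (f 0%C) <= Cmod (rect (fun z => f z / z)%C (- eta) T (- T) T).
Proof.
  intros He HT HU Hf HB.
  destruct (Hf 0%C) as [l Hl]; [apply HU|].
  assert (E : rect (dslope f 0 l) (- eta) T (- T) T = 0%C).
  { apply (goursat_except _ 0%C); try lra.
    - intros z Hz. apply (dslope_ccont_holo f U); auto.
    - intros z Hz Hn. apply dslope_cderiv; auto. }
  assert (Z : forall z, (Re z = - eta \/ Re z = T \/ Im z = - T \/ Im z = T) -> z <> 0%C).
  { intros z Hz ->. unfold Re, Im, RtoC in Hz; simpl in Hz. lra. }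
  rewrite (rect_comb_bd (dslope f 0 l) (fun z => / z)%C _ (f 0%C)).
  - rewrite E, Cplus_0_l, Cmod_mult.
    pose proof (rect_inv_Im_ge eta T He HT) as I. pose proof (im_le_Cmod (rect (fun z => / z)%C (- eta) T (- T) T)).
    pose proof (Rle_abs (Im (rect (fun z => / z)%C (- eta) T (- T) T))).
    pose proof (Cmod_ge_0 (f 0%C)). nra.
  - intros z Hz _. apply (dslope_ccont_holo f U); auto.
  - intros z Hz Hb. apply ccont_inv; [apply ccont_id | now apply Z].
  - intros z Hz Hb. apply Z in Hb. rewrite dslope_neq by exact Hb.
    unfold Cminus. rewrite Copp_0, Cplus_0_r. field. exact Hb.
Qed.

Definition newman_kernel (T : R) (z : C) : C := (/ z + z / RtoC (T ^ 2))%C.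

(** With [z = x + i y] and [y^2 = T^2], the numerator [T^2 + z^2] factors as [x (x + 2 i y)], and
    [|x + 2 i y| <= 2 |z|] cancels the [z] of the denominator. In particular the kernel vanishes at
    [i T] and [- i T]. *)
Lemma newman_kernel_h (T : R) (z : C) : 0 < T -> Rabs (Im z) = T ->
  Cmod (newman_kernel T z) <= 2 * Rabs (Re z) / T ^ 2.
Proof.
  intros HT Hz. set (x := Re z). set (y := Im z) in *.
  assert (Hy : y ^ 2 = T ^ 2) by (rewrite <- Hz; symmetry; apply pow2_abs).
  assert (Hz0 : z <> 0%C).
  { intros ->. unfold y, Im, RtoC in Hz; simpl in Hz. rewrite Rabs_R0 in Hz. lra. }
  assert (HT2 : RtoC (T ^ 2) <> 0%C) by (intros E; apply RtoC_inj in E; nra).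
  assert (Ez : z = (x, y)) by apply surjective_pairing.
  assert (E : newman_kernel T z = (RtoC x * (x, 2 * y)%R / (z * RtoC (T ^ 2)))%C).
  { unfold newman_kernel. replace (/ z + z / RtoC (T ^ 2))%C with ((RtoC (T ^ 2) + z * z) / (z * RtoC (T ^ 2)))%C
      by (field; split; assumption).
    f_equal. rewrite <- Hy, Ez. unfold RtoC, Cmult, Cplus; simpl. f_equal; ring. }
  rewrite E, Cmod_div, !Cmod_mult, !Cmod_R by (apply Cmult_neq_0; assumption).
  assert (Hm := proj1 (Cmod_gt_0 z) Hz0).
  assert (B : Cmod (x, 2 * y)%R <= 2 * Cmod z).
  { replace (2 * Cmod z) with (Cmod (2 * z)) by (rewrite Cmod_mult, Cmod_R, Rabs_right; lra).
    apply Cmod_le_parts; unfold Re, Im; rewrite Ez; simpl.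
    - replace (2 * x - 0 * y) with (2 * x) by ring. rewrite Rabs_mult, (Rabs_right 2) by lra.
      pose proof (Rabs_pos x). lra.
    - right. f_equal. ring. }
  rewrite (Rabs_right (T ^ 2)) by nra.
  apply Rmult_le_reg_r with (Cmod z * T ^ 2); [apply Rmult_lt_0_compat; nra|].
  replace (Rabs x * Cmod (x, (2 * y)%R) / (Cmod z * T ^ 2) * (Cmod z * T ^ 2)) with (Rabs x * Cmod (x, (2 * y)%R)) by (field; lra).
  replace (2 * Rabs x / T ^ 2 * (Cmod z * T ^ 2)) with (Rabs x * (2 * Cmod z)) by (field; lra).
  apply Rmult_le_compat_l; [apply Rabs_pos | exact B].
Qed.

Lemma newman_kernel_v (T : R) (z : C) : 0 < T -> z <> 0%C ->
  Cmod (newman_kernel T z) <= / Cmod z + Cmod z / T ^ 2.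
Proof.
  intros HT Hz. unfold newman_kernel. eapply Rle_trans; [apply Cmod_triangle|].
  assert (HT2 : RtoC (T ^ 2) <> 0%C) by (intros E; apply RtoC_inj in E; nra).
  rewrite Cmod_inv, Cmod_div, Cmod_R, (Rabs_right (T ^ 2)) by (assumption || nra). lra.
Qed.

Lemma newman_kernel_ccont (T : R) (z : C) : z <> 0%C -> ccont (newman_kernel T) z.
Proof.
  intros Hz. apply ccont_plus; [apply ccont_inv; [apply ccont_id | exact Hz]|].
  apply ccont_mult; [apply ccont_id | apply ccont_const].
Qed.

Definition rpow_c (Y : R) (z : C) : C := Cexp (z * RtoC (ln Y)).

Lemma rpow_c_cderiv (Y : R) (z : C) : cderiv (rpow_c Y) z (rpow_c Y z * RtoC (ln Y))%C.
Proof.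
  eapply cderiv_eq.
  - apply (cderiv_comp Cexp (fun z => z * RtoC (ln Y))%C); [apply Cexp_cderiv|].
    apply cderiv_mult; [apply cderiv_id | apply cderiv_const].
  - unfold rpow_c. cbv beta. ring.
Qed.

Lemma Cmod_rpow_c (Y : R) (z : C) : Cmod (rpow_c Y z) = Rpower Y (Re z).
Proof.
  unfold rpow_c, Rpower. rewrite Cmod_Cexp. f_equal. unfold Re, Cmult, RtoC; simpl. ring.
Qed.

Lemma Rpower_neg_le_1 (Y x : R) : 1 <= Y -> x <= 0 -> Rpower Y x <= 1.
Proof.
  intros HY Hx. rewrite <- (Rpower_O Y) by lra. apply Rle_Rpower; lra.
Qed.

(* To the left of the imaginary axis [A] is written [(A + S) - S], and only the
   integral of [S], which is entire, is moved to [Re z = - T]. *)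
Theorem newman_contour (A S : C -> C) (U : C -> Prop) (Y eta T C0 m M : R) :
  0 < eta -> eta <= 1 -> 1 <= T -> T <= Y -> 0 <= C0 -> 0 <= m -> 0 <= M ->
  box_star U 0 -> holo A U -> holo S (fun _ => True) ->
  (forall z, cbox (- eta) T (- T) T z -> U z) ->
  (forall z, U z -> 0 < Re z -> Cmod (A z) * Rpower Y (Re z) <= C0 / Re z) ->
  (forall z, Re z < 0 -> Cmod (S z) * Rpower Y (Re z) <= m * (/ (- Re z) + / Y)) ->
  (forall z, - eta <= Re z <= 0 -> Rabs (Im z) <= T -> Cmod (A z + S z) <= M) ->
  Cmod (A 0%C) <= (10 * C0 + 20 * m) / T
    + M * (4 / T ^ 2 + 2 * T * (/ eta + 2) * Rpower Y (- eta)).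
Proof.
  intros He He1 HT HTY HC0 Hm HM HU HA HS HB BA BS BM.
  set (e := fun z => (rpow_c Y z * newman_kernel T z)%C).
  assert (HT2 : RtoC (T ^ 2) <> 0%C) by (intros E; apply RtoC_inj in E; nra).
  assert (Ce : forall z : C, z <> 0%C -> ccont e z).
  { intros z Hz. apply ccont_mult; [exact (cderiv_ccont _ _ _ (rpow_c_cderiv Y z)) | now apply newman_kernel_ccont]. }
  assert (CA : forall z, U z -> ccont A z).
  { intros z Hz. destruct (HA z Hz) as [l Hl]. exact (cderiv_ccont _ _ _ Hl). }
  assert (CS : forall z, ccont S z).
  { intros z. destruct (HS z I) as [l Hl]. exact (cderiv_ccont _ _ _ Hl). }
  (* The factor [Y^z (1 + z^2 / T^2)] is entire with value 1 at 0, so [f 0 = A 0], while [f z / z]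
     is [A] times the weight [e]. *)
  set (f := fun z => (A z * (rpow_c Y z * (1 + z * z / RtoC (T ^ 2))))%C).
  assert (Hf : holo f U).
  { intros z Hz. destruct (HA z Hz) as [l Hl]. eexists. apply cderiv_mult; [exact Hl|].
    apply cderiv_mult; [apply rpow_c_cderiv|]. apply cderiv_plus; [apply cderiv_const|].
    apply cderiv_mult; [apply cderiv_mult; apply cderiv_id | apply cderiv_const]. }
  assert (Ef : f 0%C = A 0%C).
  { unfold f, rpow_c. rewrite Cmult_0_l, Cexp_0. unfold Cdiv. ring. }
  rewrite <- Ef.
  eapply Rle_trans; [apply (rect_residue_le f U eta T); auto; lra|].
  set (g := fun z => (A z * e z)%C). set (gs := fun z => (S z * e z)%C).
  set (gh := fun z => ((A z + S z) * e z)%C).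
  assert (Z : forall z, Re z <> 0 \/ Im z <> 0 -> z <> 0%C).
  { intros z Hz ->. unfold Re, Im, RtoC in Hz; simpl in Hz. lra. }
  assert (Cg : forall z, U z -> z <> 0%C -> ccont g z).
  { intros z Hz Hn. apply ccont_mult; auto. }
  assert (Cgs : forall z : C, z <> 0%C -> ccont gs z).
  { intros z Hn. apply ccont_mult; auto. }
  assert (Cgh : forall z, U z -> z <> 0%C -> ccont gh z).
  { intros z Hz Hn. apply ccont_mult; auto. apply ccont_plus; auto. }
  assert (BU : forall x y, - eta <= x <= T -> - T <= y <= T -> U (x + Ci * y)%C).
  { intros x y Hx Hy. apply HB. apply cbox_le; try lra. rewrite Re_pt, Im_pt. lra. }
  assert (Er : rect (fun z => f z / z)%C (- eta) T (- T) T = rect g (- eta) T (- T) T).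
  { rewrite (rect_comb_bd g g _ 0%C).
    - ring.
    - intros z Hz Hb. apply Cg; [now apply HB|]. apply Z. lra.
    - intros z Hz Hb. apply Cg; [now apply HB|]. apply Z. lra.
    - intros z Hz Hb. assert (Hn : z <> 0%C) by (apply Z; lra).
      unfold f, g, e, newman_kernel. field. split; assumption. }
  rewrite Er.
  assert (Ch : forall y a b, - eta <= a -> a <= b -> b <= T -> y = T \/ y = - T ->
     ccont_seg (fun t => g (t + Ci * y)%C) a b /\ ccont_seg (fun t => gh (t + Ci * y)%C) a b).
  { intros y a b Ha Hab Hb Hy.
    split; intros t Ht; rewrite Rmin_left, Rmax_right in Ht by lra; apply ccont_h;
      [apply Cg | apply Cgh]; try (apply BU; lra); apply pt_neq_0; lra. }
  assert (Chs : forall y a b, y = T \/ y = - T -> ccont_seg (fun t => gs (t + Ci * y)%C) a b).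
  { intros y a b Hy t Ht. apply ccont_h, Cgs, pt_neq_0. lra. }
  assert (Cvs : forall x, x <> 0 -> ccont_seg (fun t => gs (x + Ci * t)%C) (- T) T).
  { intros x Hx t Ht. apply ccont_v, Cgs, pt_neq_0. tauto. }
  (* The horizontal sides are cut at the imaginary axis. To its left [g = gh - gs], and the three
     sides carrying [gs] are stretched from [Re z = - eta] to [Re z = - T]; the rectangle in between
     avoids the pole at 0. *)
  assert (Split : rect g (- eta) T (- T) T =
    (hint g (- T) 0 T + Ci * vint g T (- T) T - hint g T 0 T
     + (hint gh (- T) (- eta) 0 - hint gh T (- eta) 0 - Ci * vint gh (- eta) (- T) T)
     - (hint gs (- T) (- T) 0 - hint gs T (- T) 0 - Ci * vint gs (- T) (- T) T))%C).
  { unfold rect.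
    assert (Hy : forall y, y = T \/ y = - T ->
      hint g y (- eta) T = (hint gh y (- eta) 0 - hint gs y (- eta) 0 + hint g y 0 T)%C).
    { intros y Hy. unfold hint.
      destruct (Ch y (- eta) 0) as [D1 D2]; try lra. destruct (Ch y 0 T) as [D3 _]; try lra.
      rewrite <- (cint_chasles (fun t => g (t + Ci * y)%C) (- eta) 0 T D1 D3). f_equal.
      rewrite <- (cint_minus (fun t => gh (t + Ci * y)%C)); [|exact D2 | now apply Chs].
      apply cint_ext. intros t _. unfold g, gh, gs. ring. }
    assert (Hv : vint g (- eta) (- T) T = (vint gh (- eta) (- T) T - vint gs (- eta) (- T) T)%C).
    { unfold vint. rewrite <- (cint_minus (fun t => gh (RtoC (- eta) + Ci * t)%C)).
      - apply cint_ext. intros t _. unfold g, gh, gs. ring.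
      - intros t Ht. rewrite Rmin_left, Rmax_right in Ht by lra.
        apply ccont_v, Cgh; [apply BU; lra | apply pt_neq_0; lra].
      - apply Cvs. lra. }
    rewrite !Hy, Hv by tauto.
    assert (G : rect gs (- T) (- eta) (- T) T = 0%C).
    { apply goursat; try lra. intros z Hz. rewrite cbox_le in Hz by lra.
      assert (Hn : z <> 0%C) by (apply Z; lra).
      destruct (HS z I) as [l Hl]. eexists. apply cderiv_mult; [exact Hl|].
      apply cderiv_mult; [apply rpow_c_cderiv|]. apply cderiv_plus.
      - apply cderiv_inv; [exact Hn | apply cderiv_id].
      - apply cderiv_mult; [apply cderiv_id | apply cderiv_const]. }
    unfold rect in G.
    assert (Hs : forall y, y = T \/ y = - T ->
      hint gs y (- T) 0 = (hint gs y (- T) (- eta) + hint gs y (- eta) 0)%C).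
    { intros y Hy'. symmetry. apply cint_chasles; now apply Chs. }
    rewrite !Hs by tauto.
    replace (Ci * vint gs (- T) (- T) T)%C with
      (hint gs (- T) (- T) (- eta) + Ci * vint gs (- eta) (- T) T - hint gs T (- T) (- eta))%C.
    - ring.
    - rewrite <- (Cplus_0_r (Ci * vint gs (- T) (- T) T)), <- G. ring. }
  rewrite Split.
  assert (Em : forall z, Cmod (e z) = Rpower Y (Re z) * Cmod (newman_kernel T z)).
  { intros z. unfold e. now rewrite Cmod_mult, Cmod_rpow_c. }
  assert (AT : forall y, y = T \/ y = - T -> Rabs y = T).
  { intros y [->| ->]; [|rewrite Rabs_Ropp]; apply Rabs_right; lra. }
  assert (TT : 0 < T ^ 2) by nra.
  assert (IY : 0 < / Y <= / T) by (split; [apply Rinv_0_lt_compat; lra | apply Rinv_le_contravar; lra]).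
  assert (B1 : forall y, y = T \/ y = - T -> Cmod (hint g y 0 T) <= 2 * C0 / T).
  { intros y Hy. replace (2 * C0 / T) with ((T - 0) * (2 * C0 / T ^ 2)) by (field; lra).
    apply cint_norm_le_const; [lra | apply Ch; lra|]. intros t Ht. unfold g.
    rewrite Cmod_mult, Em.
    assert (K := newman_kernel_h T (t + Ci * y)%C). rewrite Re_pt, Im_pt, AT in K by exact Hy.
    specialize (K ltac:(lra) eq_refl). rewrite Re_pt.
    (* At [t = 0] the bound [C0 / Re z] says nothing, but the kernel is zero at this point. *)
    destruct (Req_dec t 0) as [->|Ht0].
    - rewrite Rabs_R0 in K. replace (2 * 0 / T ^ 2) with 0 in K by (field; lra).
      pose proof (Cmod_ge_0 (newman_kernel T (0 + Ci * y))).
      replace (Cmod (newman_kernel T (0 + Ci * y))) with 0 by lra.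
      rewrite !Rmult_0_r. apply quot_nonneg; lra.
    - assert (P := BA (t + Ci * y)%C). rewrite Re_pt in P.
      assert (Hu : U (t + Ci * y)%C) by (apply BU; lra). specialize (P Hu ltac:(lra)).
      rewrite Rabs_right in K by lra. rewrite <- Rmult_assoc.
      replace (2 * C0 / T ^ 2) with ((C0 / t) * (2 * t / T ^ 2)) by (field; lra).
      apply Rmult_le_compat; [|apply Cmod_ge_0 | exact P | exact K].
      apply Rmult_le_pos; [apply Cmod_ge_0 | left; apply exp_pos]. }
  assert (KV : forall x t, Rabs x = T -> - T <= t <= T -> Cmod (newman_kernel T (x + Ci * t)) <= 3 / T).
  { intros x t Hx Ht. assert (Hx0 : x <> 0) by (intros ->; rewrite Rabs_R0 in Hx; lra).
    eapply Rle_trans; [apply newman_kernel_v; [lra | apply pt_neq_0; tauto]|].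
    pose proof (re_le_Cmod (x + Ci * t)) as N1. pose proof (Cmod_le_re_im (x + Ci * t)) as N2.
    rewrite Re_pt, Hx in N1. rewrite Re_pt, Im_pt, Hx in N2.
    assert (Rabs t <= T) by (apply Rabs_le; lra).
    set (n := Cmod (x + Ci * t)) in *.
    assert (/ n <= / T) by (apply Rinv_le_contravar; lra).
    assert (n / T ^ 2 <= 2 * T / T ^ 2) by (apply Rmult_le_compat_r; [left; now apply Rinv_0_lt_compat | lra]).
    replace (3 / T) with (/ T + 2 * T / T ^ 2) by (field; lra). lra. }
  assert (B2 : Cmod (Ci * vint g T (- T) T) <= 6 * C0 / T).
  { rewrite Cmod_mult, Cmod_Ci, Rmult_1_l.
    replace (6 * C0 / T) with ((T - - T) * (C0 / T * (3 / T))) by (field; lra).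
    apply cint_norm_le_const; [lra| |].
    - intros t Ht. rewrite Rmin_left, Rmax_right in Ht by lra.
      apply ccont_v, Cg; [apply BU; lra | apply pt_neq_0; lra].
    - intros t Ht. unfold g. rewrite Cmod_mult, Em, <- Rmult_assoc.
      apply Rmult_le_compat; [|apply Cmod_ge_0| |apply KV; [apply Rabs_right; lra | lra]].
      + apply Rmult_le_pos; [apply Cmod_ge_0 | left; apply exp_pos].
      + assert (P := BA (T + Ci * t)%C). rewrite Re_pt in *. apply P; [apply BU; lra | lra]. }
  assert (B3 : forall y, y = T \/ y = - T -> Cmod (hint gh y (- eta) 0) <= 2 * M / T ^ 2).
  { intros y Hy. apply Rle_trans with ((0 - - eta) * (2 * M / T ^ 2)).
    2:{ assert (0 <= 2 * M / T ^ 2) by (apply quot_nonneg; lra). nra. }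
    apply cint_norm_le_const; [lra | apply Ch; lra|]. intros t Ht. unfold gh.
    rewrite Cmod_mult, Em.
    assert (K := newman_kernel_h T (t + Ci * y)%C). rewrite Re_pt, Im_pt, AT in K by exact Hy.
    specialize (K ltac:(lra) eq_refl). rewrite Re_pt.
    assert (P := BM (t + Ci * y)%C). rewrite Re_pt, Im_pt, AT in P by exact Hy.
    specialize (P ltac:(lra) ltac:(lra)).
    pose proof (Rpower_neg_le_1 Y t ltac:(lra) ltac:(lra)) as Q.
    assert (Q0 : 0 < Rpower Y t) by apply exp_pos.
    rewrite Rabs_left1 in K by lra.
    replace (2 * M / T ^ 2) with (M * (1 * (2 / T ^ 2))) by (field; lra).
    apply Rmult_le_compat; [apply Cmod_ge_0 | |exact P|].
    - apply Rmult_le_pos; [lra | apply Cmod_ge_0].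
    - apply Rmult_le_compat; [lra | apply Cmod_ge_0 | exact Q|].
      eapply Rle_trans; [exact K|]. apply Rmult_le_compat_r; [left; now apply Rinv_0_lt_compat | lra]. }
  assert (B4 : Cmod (Ci * vint gh (- eta) (- T) T) <= M * (2 * T * (/ eta + 2) * Rpower Y (- eta))).
  { rewrite Cmod_mult, Cmod_Ci, Rmult_1_l.
    replace (M * (2 * T * (/ eta + 2) * Rpower Y (- eta))) with
      ((T - - T) * (M * (Rpower Y (- eta) * (/ eta + 2)))) by (field; lra).
    apply cint_norm_le_const; [lra| |].
    - intros t Ht. rewrite Rmin_left, Rmax_right in Ht by lra.
      apply ccont_v, Cgh; [apply BU; lra | apply pt_neq_0; lra].
    - intros t Ht. unfold gh. rewrite Cmod_mult, Em, Re_pt.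
      assert (Q0 : 0 < Rpower Y (- eta)) by apply exp_pos.
      apply Rmult_le_compat; [apply Cmod_ge_0| | |].
      + apply Rmult_le_pos; [lra | apply Cmod_ge_0].
      + apply BM; rewrite ?Re_pt, ?Im_pt; [lra | apply Rabs_le; lra].
      + apply Rmult_le_compat_l; [lra|].
        eapply Rle_trans; [apply newman_kernel_v; [lra | apply pt_neq_0; lra]|].
        pose proof (re_le_Cmod (RtoC (- eta) + Ci * t)) as N1. pose proof (Cmod_le_re_im (RtoC (- eta) + Ci * t)) as N2.
        rewrite Re_pt, Rabs_Ropp, (Rabs_right eta) in N1 by lra.
        rewrite Re_pt, Im_pt, Rabs_Ropp, (Rabs_right eta) in N2 by lra.
        assert (Rabs t <= T) by (apply Rabs_le; lra).
        set (n := Cmod (RtoC (- eta) + Ci * t)) in *.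
        assert (/ n <= / eta) by (apply Rinv_le_contravar; lra).
        assert (HT1 : T <= T ^ 2) by nra. assert (n / T ^ 2 <= 2 * T ^ 2 / T ^ 2) by (apply Rmult_le_compat_r; [left; now apply Rinv_0_lt_compat | lra]).
        replace (2 * T ^ 2 / T ^ 2) with 2 in * by (field; lra). lra. }
  assert (B5 : forall y, y = T \/ y = - T -> Cmod (hint gs y (- T) 0) <= 4 * m / T).
  { intros y Hy. replace (4 * m / T) with ((0 - - T) * (4 * m / T ^ 2)) by (field; lra).
    apply cint_norm_le_const; [lra | now apply Chs|]. intros t Ht. unfold gs.
    rewrite Cmod_mult, Em.
    assert (K := newman_kernel_h T (t + Ci * y)%C). rewrite Re_pt, Im_pt, AT in K by exact Hy.
    specialize (K ltac:(lra) eq_refl). rewrite Re_pt.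
    destruct (Req_dec t 0) as [->|Ht0].
    - rewrite Rabs_R0 in K. replace (2 * 0 / T ^ 2) with 0 in K by (field; lra).
      pose proof (Cmod_ge_0 (newman_kernel T (0 + Ci * y))).
      replace (Cmod (newman_kernel T (0 + Ci * y))) with 0 by lra.
      rewrite !Rmult_0_r. apply quot_nonneg; lra.
    - assert (P := BS (t + Ci * y)%C). rewrite Re_pt in P. specialize (P ltac:(lra)).
      rewrite Rabs_left in K by lra. rewrite <- Rmult_assoc.
      apply Rle_trans with (m * (/ - t + / Y) * (2 * - t / T ^ 2)).
      + apply Rmult_le_compat; [|apply Cmod_ge_0 | exact P | exact K].
        apply Rmult_le_pos; [apply Cmod_ge_0 | left; apply exp_pos].
      + replace (m * (/ - t + / Y) * (2 * - t / T ^ 2)) with (2 * m / T ^ 2 * (1 + (- t) * / Y))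
          by (field; lra).
        replace (4 * m / T ^ 2) with (2 * m / T ^ 2 * 2) by (field; lra).
        apply Rmult_le_compat_l; [apply quot_nonneg; lra|].
        (* Since [- t <= T <= Y], the summand [/ Y] in the bound for [S] at most doubles the
           contribution of [/ - t]. *)
        assert (- t * / Y <= T * / T) by (apply Rmult_le_compat; lra).
        rewrite Rinv_r in H by lra. lra. }
  assert (B6 : Cmod (Ci * vint gs (- T) (- T) T) <= 12 * m / T).
  { rewrite Cmod_mult, Cmod_Ci, Rmult_1_l.
    replace (12 * m / T) with ((T - - T) * (m * (/ T + / T) * (3 / T))) by (field; lra).
    apply cint_norm_le_const; [lra | apply Cvs; lra|].
    intros t Ht. unfold gs. rewrite Cmod_mult, Em, <- Rmult_assoc.
    apply Rmult_le_compat; [|apply Cmod_ge_0| |].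
    - apply Rmult_le_pos; [apply Cmod_ge_0 | left; apply exp_pos].
    - assert (P := BS (RtoC (- T) + Ci * t)%C). rewrite Re_pt in *.
      specialize (P ltac:(lra)). eapply Rle_trans; [exact P|]. rewrite Ropp_involutive.
      apply Rmult_le_compat_l; lra.
    - apply KV; [rewrite Rabs_Ropp; apply Rabs_right; lra | lra]. }
  pose proof (B1 T (or_introl eq_refl)). pose proof (B1 (- T) (or_intror eq_refl)).
  pose proof (B3 T (or_introl eq_refl)). pose proof (B3 (- T) (or_intror eq_refl)).
  pose proof (B5 T (or_introl eq_refl)). pose proof (B5 (- T) (or_intror eq_refl)).
  assert (Tri : forall a b : C, Cmod (a - b) <= Cmod a + Cmod b).
  { intros a b. unfold Cminus. rewrite <- (Cmod_opp b). apply Cmod_triangle. }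
  eapply Rle_trans; [apply Tri|].
  eapply Rle_trans; [apply Rplus_le_compat; [apply Cmod_triangle | apply Tri]|].
  eapply Rle_trans; [apply Rplus_le_compat; [apply Rplus_le_compat; apply Tri | apply Rplus_le_compat_r, Tri]|].
  eapply Rle_trans; [apply Rplus_le_compat_r, Rplus_le_compat; apply Rplus_le_compat_r; [apply Cmod_triangle | apply Tri]|].
  (* The right half contributes [2 + 6 + 2 = 10] times [C0 / T], the shifted integral of [S]
     contributes [4 + 4 + 12 = 20] times [m / T], and the sides with [A + S] give the multiple of
     [M]. *)
  replace ((10 * C0 + 20 * m) / T + M * (4 / T ^ 2 + 2 * T * (/ eta + 2) * Rpower Y (- eta)))
    with (2 * C0 / T + 6 * C0 / T + 2 * C0 / T + (2 * M / T ^ 2 + 2 * M / T ^ 2 + M * (2 * T * (/ eta + 2) * Rpower Y (- eta)))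
          + (4 * m / T + 4 * m / T + 12 * m / T)) by (field; lra).
  lra.
Qed.

(** * Logarithms of Euler products *)

(* [g 1 + ... + g n]: the term of index [0] is left out. *)
Fixpoint csum (g : nat -> C) (n : nat) : C :=
  match n with
  | O => 0%C
  | S k => (csum g k + g (S k))%C
  end.

Lemma csum_minus (f g : nat -> C) (n : nat) :
  csum (fun k => f k - g k)%C n = (csum f n - csum g n)%C.
Proof. induction n as [|n IH]; simpl; [ring | rewrite IH; ring]. Qed.

Lemma csum_cderiv (g : nat -> C -> C) (n : nat) (z : C) :
  (forall k, exists l, cderiv (g k) z l) ->
  exists l, cderiv (fun w => csum (fun k => g k w) n) z l.
Proof.
  intros H. induction n as [|n [l Hl]]; simpl.
  - exists 0%C. apply cderiv_const.
  - destruct (H (S n)) as [l' Hl']. exists (l + l')%C. now apply cderiv_plus.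
Qed.

Lemma csum_telescope (g : nat -> C) (v : nat -> R) (N n : nat) : (N <= n)%nat ->
  (forall k, (N <= k)%nat -> Cmod (g (S k)) <= v k - v (S k)) ->
  Cmod (csum g n - csum g N) <= v N - v n.
Proof.
  intros HN H. induction HN as [|n HN IH].
  - rewrite Cmod_diag. lra.
  - simpl. replace (csum g n + g (S n) - csum g N)%C with ((csum g n - csum g N) + g (S n))%C by ring.
    eapply Rle_trans; [apply Cmod_triangle|]. specialize (H n HN). lra.
Qed.

(** Compares one term of a power sum with the increment of its antiderivative over a unit step. With
    [csum_telescope] it replaces the integral test. *)
Lemma Rpower_mvt (a y : R) : 0 < a ->
  exists x, a < x < a + 1 /\ Rpower (a + 1) y - Rpower a y = y * Rpower x (y - 1).
Proof.
  intros Ha. destruct (MVT_cor2 (fun t => Rpower t y) (fun t => y * Rpower t (y - 1)) a (a + 1)) as [x [E Hx]].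
  - lra.
  - intros t Ht. apply derivable_pt_lim_power. lra.
  - exists x. split; [exact Hx|]. rewrite E. ring.
Qed.

Lemma Rpower_le_base (a b y : R) : 0 < a -> a <= b -> 0 <= y -> Rpower a y <= Rpower b y.
Proof. intros. apply Rle_Rpower_l; lra. Qed.

Lemma Rpower_ge_base (a b y : R) : 0 < a -> a <= b -> y <= 0 -> Rpower b y <= Rpower a y.
Proof.
  intros. replace y with (- - y) by ring. rewrite !(Rpower_Ropp _ (- y)).
  apply Rinv_le_contravar; [apply exp_pos | apply Rpower_le_base; lra].
Qed.

Lemma INR_pos_S (k : nat) : 0 < INR (S k).
Proof. apply lt_0_INR. lia. Qed.

(** By the mean value theorem [(k + 1)^(-1 - x)] is at most the decrease of [k^(-x) / x] from [k] to
    [k + 1], and the decreases telescope. *)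
Lemma csum_tail (g : nat -> C) (B x : R) (N n : nat) : 0 < x -> 0 <= B -> (1 <= N <= n)%nat ->
  (forall k, (1 <= k)%nat -> Cmod (g k) <= B * Rpower (INR k) (- (1 + x))) ->
  Cmod (csum g n - csum g N) <= B * Rpower (INR N) (- x) / x.
Proof.
  intros Hx HB HN Hg.
  eapply Rle_trans; [apply (csum_telescope g (fun k => B * Rpower (INR k) (- x) / x)); [lia|]|].
  - intros k Hk. eapply Rle_trans; [apply Hg; lia|].
    assert (Hk0 : 0 < INR k) by (apply lt_0_INR; lia).
    destruct (Rpower_mvt (INR k) (- x) Hk0) as [t [Ht E]]. rewrite <- S_INR in E, Ht.
    replace (B * Rpower (INR k) (- x) / x - B * Rpower (INR (S k)) (- x) / x)
      with (B * (- (Rpower (INR (S k)) (- x) - Rpower (INR k) (- x)) / x)) by (field; lra).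
    rewrite E. replace (- (- x * Rpower t (- x - 1)) / x) with (Rpower t (- x - 1)) by (field; lra).
    apply Rmult_le_compat_l; [exact HB|]. replace (- (1 + x)) with (- x - 1) by ring.
    apply Rpower_ge_base; lra.
  - assert (0 <= B * Rpower (INR n) (- x) / x); [|lra].
    apply quot_nonneg; [|exact Hx]. apply Rmult_le_pos; [exact HB | left; apply exp_pos].
Qed.

(** For [y <= 1] the majorants decrease and telescope to [n^y / y]. For [y > 1] they increase, and
    each is compared with the following unit step: this yields [n^y / y] for the terms before the
    last, and the last one, [n^(y - 1) = n^y / n], is the origin of [/ INR n]. *)
Lemma csum_power_le (g : nat -> C) (m y : R) (n : nat) : 0 < y -> 0 <= m -> (1 <= n)%nat ->
  (forall k, (1 <= k)%nat -> Cmod (g k) <= m * Rpower (INR k) (y - 1)) ->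
  Cmod (csum g n) <= m * (/ y + / INR n) * Rpower (INR n) y.
Proof.
  intros Hy Hm Hn Hg.
  assert (HP : forall x, 0 < Rpower x y) by (intros; apply exp_pos).
  assert (Hn0 : 0 < INR n) by (apply lt_0_INR; lia).
  assert (I : 0 < / INR n) by now apply Rinv_0_lt_compat.
  assert (Iy : 0 < / y) by now apply Rinv_0_lt_compat.
  destruct (Rle_dec y 1) as [H1|H1].
  - apply Rle_trans with (m * / y * Rpower (INR n) y).
    2:{ apply Rmult_le_compat_r; [left; apply HP|]. apply Rmult_le_compat_l; lra. }
    clear I Hn0. induction Hn as [|n Hn IH].
    + simpl csum. rewrite Cplus_0_l. eapply Rle_trans; [apply Hg; lia|].
      unfold Rpower. simpl INR. rewrite ln_1, !Rmult_0_r, exp_0, !Rmult_1_r.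
      rewrite <- (Rmult_1_r m) at 1. apply Rmult_le_compat_l; [exact Hm|].
      rewrite <- Rinv_1. apply Rinv_le_contravar; lra.
    + simpl csum. eapply Rle_trans; [apply Cmod_triangle|].
      assert (Hn0 : 0 < INR n) by (apply lt_0_INR; lia).
      destruct (Rpower_mvt (INR n) y Hn0) as [t [Ht E]]. rewrite <- S_INR in E, Ht.
      assert (Hs := Hg (S n) ltac:(lia)).
      assert (Rpower (INR (S n)) (y - 1) <= Rpower t (y - 1)) by (apply Rpower_ge_base; lra).
      assert (m * Rpower (INR (S n)) (y - 1) <= m * Rpower t (y - 1)) by (apply Rmult_le_compat_l; lra).
      replace (m * / y * Rpower (INR (S n)) y) with
        (m * / y * Rpower (INR n) y + m * / y * (Rpower (INR (S n)) y - Rpower (INR n) y)) by ring.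
      rewrite E. replace (m * / y * (y * Rpower t (y - 1))) with (m * Rpower t (y - 1)) by (field; lra). lra.
  - assert (B : forall k, Cmod (csum g k) <= m * / y * Rpower (INR (S k)) y).
    { induction k as [|k IH].
      - simpl csum. rewrite Cmod_0. apply Rmult_le_pos; [nra | left; apply HP].
      - simpl csum. eapply Rle_trans; [apply Cmod_triangle|].
        destruct (Rpower_mvt (INR (S k)) y (INR_pos_S k)) as [t [Ht E]]. rewrite <- S_INR in E, Ht.
        assert (Hs := Hg (S k) ltac:(lia)). pose proof (INR_pos_S k).
        assert (Rpower (INR (S k)) (y - 1) <= Rpower t (y - 1)) by (apply Rpower_le_base; lra).
        assert (m * Rpower (INR (S k)) (y - 1) <= m * Rpower t (y - 1)) by (apply Rmult_le_compat_l; lra).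
        replace (m * / y * Rpower (INR (S (S k))) y) with
          (m * / y * Rpower (INR (S k)) y + m * / y * (Rpower (INR (S (S k))) y - Rpower (INR (S k)) y)) by ring.
        rewrite E. replace (m * / y * (y * Rpower t (y - 1))) with (m * Rpower t (y - 1)) by (field; lra). lra. }
    destruct n as [|k]; [lia|]. specialize (B k). assert (Hs := Hg (S k) Hn).
    simpl csum. eapply Rle_trans; [apply Cmod_triangle|].
    assert (E : Rpower (INR (S k)) (y - 1) = / INR (S k) * Rpower (INR (S k)) y).
    { unfold Rminus. rewrite Rpower_plus, Rpower_Ropp, Rpower_1 by exact Hn0. ring. }
    rewrite E in Hs. lra.
Qed.

(** * Limits of complex sequences, and uniqueness of continuous logarithms *)

Definition ccv (u : nat -> C) (l : C) : Prop :=
  forall e, 0 < e -> exists N, forall n, (N <= n)%nat -> Cmod (u n - l) <= e.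

Lemma ccv_unique (u : nat -> C) (l l' : C) : ccv u l -> ccv u l' -> l = l'.
Proof.
  intros H H'. replace l with (l' + (l - l'))%C by ring.
  assert (E : Cmod (l - l') = 0); [|rewrite (Cmod_eq_0 _ E); ring].
  apply Rle_antisym; [|apply Cmod_ge_0]. apply le_epsilon. intros e He.
  destruct (H (e/2)) as [N HN]; [lra|]. destruct (H' (e/2)) as [N' HN']; [lra|].
  specialize (HN (N + N')%nat ltac:(lia)). specialize (HN' (N + N')%nat ltac:(lia)).
  pose proof (Cmod_triangle_minus l (u (N + N')%nat) l'). rewrite (Cmod_minus_sym l (u _)) in H0. lra.
Qed.

Lemma ccv_cauchy (u : nat -> C) :
  (forall e, 0 < e -> exists N, forall n, (N <= n)%nat -> Cmod (u n - u N) <= e) ->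
  exists l, ccv u l.
Proof.
  intros H.
  assert (Hp : forall p : C -> R, (forall a b, Rabs (p a - p b) <= Cmod (a - b)) ->
    Cauchy_crit (fun n => p (u n))).
  { intros p Hp e He. destruct (H (e/4)) as [N HN]; [lra|]. exists N. intros i j Hi Hj.
    unfold Rdist. eapply Rle_lt_trans; [apply Hp|].
    pose proof (Cmod_triangle_minus (u i) (u N) (u j)). specialize (HN i Hi) as H1. specialize (HN j Hj) as H2.
    rewrite (Cmod_minus_sym (u N) (u j)) in H0. lra. }
  destruct (Rcomplete.R_complete _ (Hp Re (fun a b => re_le_Cmod (a - b)))) as [x Hx].
  destruct (Rcomplete.R_complete _ (Hp Im (fun a b => im_le_Cmod (a - b)))) as [y Hy].
  exists (x, y). intros e He. destruct (Hx (e/2)) as [N HN]; [lra|]. destruct (Hy (e/2)) as [N' HN']; [lra|].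
  exists (N + N')%nat. intros n Hn. specialize (HN n ltac:(lia)). specialize (HN' n ltac:(lia)).
  unfold Rdist in *. eapply Rle_trans; [apply Cmod_le_re_im|].
  change (Re (u n - (x, y))%C) with (Re (u n) - x). change (Im (u n - (x, y))%C) with (Im (u n) - y). lra.
Qed.

Lemma ccv_map (f : C -> C) (u : nat -> C) (l : C) : ccont f l -> ccv u l -> ccv (fun n => f (u n)) (f l).
Proof.
  intros Hf H e He. destruct (Hf e He) as [d [Hd Hd1]]. destruct (H (d/2)) as [N HN]; [lra|].
  exists N. intros n Hn. left. apply Hd1. specialize (HN n Hn). lra.
Qed.

Lemma ccv_le (u : nat -> C) (l k : C) (B : R) (N : nat) : ccv u l ->
  (forall n, (N <= n)%nat -> Cmod (u n - k) <= B) -> Cmod (l - k) <= B.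
Proof.
  intros H HB. apply le_epsilon. intros e He. destruct (H e He) as [N' HN'].
  specialize (HN' (N + N')%nat ltac:(lia)). specialize (HB (N + N')%nat ltac:(lia)).
  pose proof (Cmod_triangle_minus l (u (N + N')%nat) k). rewrite (Cmod_minus_sym l (u _)) in H0. lra.
Qed.

(** The modulus forces [Re u = 0], and the sine has no zero [y] with [0 < |y| < 1]. Only the
    discreteness of the periods of [Cexp] is wanted. *)
Lemma Cexp_eq_1_small (u : C) : Cexp u = 1%C -> Cmod u < 1 -> u = 0%C.
Proof.
  intros H Hu. destruct u as [x y]. unfold Cexp, RtoC in H; simpl in H.
  assert (Hx : exp x = 1).
  { assert (E := Cmod_Cexp (x, y)). unfold Cexp in E; simpl in E. rewrite H in E.
    change (Cmod (RtoC 1) = exp x) in E. rewrite Cmod_1 in E. now symmetry. }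
  injection H as H1 H2. rewrite Hx, Rmult_1_l in H2.
  assert (x = 0). { rewrite <- exp_0 in Hx. now apply exp_inv. }
  pose proof (im_le_Cmod (x, y)) as Hy; simpl in Hy. pose proof PI2_1.
  assert (y = 0); [|now subst].
  destruct (Rtotal_order y 0) as [L|[E|G]]; [|exact E|].
  - rewrite Rabs_left in Hy by lra. assert (0 < sin (- y)) by (apply sin_gt_0; lra).
    rewrite sin_neg in *. lra.
  - rewrite Rabs_right in Hy by lra. assert (0 < sin y) by (apply sin_gt_0; lra). lra.
Qed.

(** The values of [D] are periods of [Cexp], so continuity makes [D] locally constant. Its
    derivative is therefore zero and [cderiv_0_const] applies. *)
Lemma Cexp_1_const (D : C -> C) (V : C -> Prop) (z0 : C) : box_star V z0 ->
  (forall z, V z -> ccont D z) -> (forall z, V z -> Cexp (D z) = 1%C) ->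
  forall z, V z -> D z = D z0.
Proof.
  intros HV HD He. apply (cderiv_0_const D V z0 HV). intros z Hz.
  destruct (HD z Hz 1) as [d [Hd H]]; [lra|]. destruct (proj1 HV z Hz) as [d' [Hd' H']].
  apply (cderiv_ext_loc (fun _ => D z) D z 0 (Rmin d d')); [now apply Rmin_glb_lt| |apply cderiv_const].
  intros w Hw. assert (Hw1 := Rlt_le_trans _ _ _ Hw (Rmin_l _ _)).
  assert (Hw2 := Rlt_le_trans _ _ _ Hw (Rmin_r _ _)).
  assert (E : (D w - D z)%C = 0%C).
  { apply Cexp_eq_1_small; [|now apply H]. unfold Cminus.
    rewrite Cexp_plus, Cexp_opp, !He by auto. field. }
  replace (D w) with (D z + (D w - D z))%C by ring. rewrite E. ring.
Qed.

Lemma Rpower_INR_small (x e : R) : 0 < x -> 0 < e ->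
  exists N, (1 <= N)%nat /\ forall n, (N <= n)%nat -> Rpower (INR n) (- x) <= e.
Proof.
  intros Hx He. set (t := exp (- ln e / x)).
  assert (Ht : 0 < t) by apply exp_pos.
  destruct (archimed_cor1 (/ t)) as [N [HN HN0]]; [now apply Rinv_0_lt_compat|].
  exists N. split; [lia|]. intros n Hn.
  assert (HNp : 0 < INR N) by (apply lt_0_INR; lia).
  assert (tN : t < INR N).
  { rewrite <- (Rinv_inv t), <- (Rinv_inv (INR N)). apply Rinv_lt_contravar; [|exact HN].
    apply Rmult_lt_0_compat; now apply Rinv_0_lt_compat. }
  assert (Hnn : INR N <= INR n) by now apply le_INR.
  apply Rle_trans with (Rpower t (- x)); [apply Rpower_ge_base; lra|].
  unfold Rpower, t. rewrite ln_exp. replace (- x * (- ln e / x)) with (ln e) by (field; lra).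
  right. now apply exp_ln.
Qed.

(** * The series of logarithms, its continuation and its tail at 0 *)

Section LogSeries.

(* [b k z] stands for the logarithm of the Euler factor at [k] and [s = 1 + z],
   and [a k * k^(-(1 + z))] for its first-order term. *)
Context (b : nat -> C -> C) (m : R).
Hypothesis (Hm : 0 <= m).
Hypothesis (Hb_holo : forall k z, - / 2 < Re z -> exists l, cderiv (b k) z l).
Hypothesis (Hb_le : forall k z, (1 <= k)%nat -> - / 2 <= Re z ->
  Cmod (b k z) <= 4 * m * Rpower (INR k) (- (1 + Re z))).

Let bsum (z : C) (n : nat) : C := csum (fun k => b k z) n.

Lemma bsum_tail (z : C) (N n : nat) : 0 < Re z -> (1 <= N <= n)%nat ->
  Cmod (bsum z n - bsum z N) <= 4 * m * Rpower (INR N) (- Re z) / Re z.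
Proof.
  intros Hz HN. apply csum_tail; [exact Hz | lra | exact HN|].
  intros k Hk. apply Hb_le; [exact Hk | lra].
Qed.

Lemma bsum_cv (z : C) : 0 < Re z -> exists l, ccv (bsum z) l.
Proof.
  intros Hz. apply ccv_cauchy. intros e He.
  destruct (Rpower_INR_small (Re z) (e * Re z / (4 * m + 1))) as [N [HN H]]; [exact Hz| |].
  { apply Rdiv_lt_0_compat; [now apply Rmult_lt_0_compat | lra]. }
  exists N. intros n Hn. eapply Rle_trans; [apply bsum_tail; [exact Hz | lia]|].
  specialize (H N (Nat.le_refl N)). set (P := Rpower _ _) in *.
  assert (0 < P) by apply exp_pos.
  apply Rmult_le_reg_r with (Re z); [exact Hz|].
  replace (4 * m * P / Re z * Re z) with (4 * m * P) by (field; lra).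
  apply Rle_trans with ((4 * m + 1) * P); [nra|].
  apply Rle_trans with ((4 * m + 1) * (e * Re z / (4 * m + 1))); [apply Rmult_le_compat_l; lra|].
  right. field. lra.
Qed.

(** The sum of the series; an arbitrary value wherever it diverges. *)
Let tau (z : C) : C := epsilon (inhabits (RtoC 0)) (ccv (bsum z)).

Lemma tau_spec (z : C) : 0 < Re z -> ccv (bsum z) (tau z).
Proof. intros Hz. exact (epsilon_spec _ _ (bsum_cv z Hz)). Qed.

Lemma tau_tail (z : C) (N : nat) : 0 < Re z -> (1 <= N)%nat ->
  Cmod (tau z - bsum z N) <= 4 * m * Rpower (INR N) (- Re z) / Re z.
Proof.
  intros Hz HN. apply (ccv_le (bsum z) _ _ _ N); [now apply tau_spec|].
  intros n Hn. apply bsum_tail; [exact Hz | lia].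
Qed.

(** The tails are uniformly at most [e / 4] on [Re w >= Re z / 2], and the partial sum is
    continuous. Continuity is what [Cexp_1_const] asks of the difference between [tau] and a
    holomorphic logarithm. *)
Lemma tau_ccont (z : C) : 0 < Re z -> ccont tau z.
Proof.
  intros Hz e He. set (x := Re z / 2). assert (Hx : 0 < x) by (unfold x; lra).
  destruct (Rpower_INR_small x (e * x / (4 * (4 * m + 1)))) as [N [HN H]]; [exact Hx| |].
  { apply Rdiv_lt_0_compat; [now apply Rmult_lt_0_compat | lra]. }
  specialize (H N (Nat.le_refl N)).
  assert (T : forall w, x <= Re w -> Cmod (tau w - bsum w N) <= e / 4).
  { intros w Hw. eapply Rle_trans; [apply tau_tail; [lra | exact HN]|].
    assert (HN1 : 1 <= INR N) by (apply (le_INR 1); lia).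
    assert (P1 : Rpower (INR N) (- Re w) <= Rpower (INR N) (- x)) by (apply Rle_Rpower; lra).
    assert (P0 : 0 < Rpower (INR N) (- Re w)) by apply exp_pos.
    set (P := Rpower (INR N) (- Re w)) in *. set (Q := Rpower (INR N) (- x)) in *.
    apply Rmult_le_reg_r with (Re w); [lra|].
    replace (4 * m * P / Re w * Re w) with (4 * m * P) by (field; lra).
    apply Rle_trans with ((4 * m + 1) * Q); [apply Rmult_le_compat; lra|].
    apply Rle_trans with ((4 * m + 1) * (e * x / (4 * (4 * m + 1)))); [apply Rmult_le_compat_l; lra|].
    replace ((4 * m + 1) * (e * x / (4 * (4 * m + 1)))) with (e / 4 * x) by (field; lra).
    apply Rmult_le_compat_l; lra. }
  destruct (csum_cderiv b N z) as [l Hl]; [intros k; apply Hb_holo; lra|].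
  destruct (cderiv_ccont _ _ _ Hl (e / 4)) as [d [Hd Hd1]]; [lra|].
  exists (Rmin d x). split; [now apply Rmin_glb_lt|]. intros w Hw.
  assert (Hw1 := Rlt_le_trans _ _ _ Hw (Rmin_l _ _)).
  assert (Hw2 := Rlt_le_trans _ _ _ Hw (Rmin_r _ _)).
  specialize (Hd1 w Hw1).
  assert (Rw := re_le_Cmod (w - z)). change (Re (w - z)%C) with (Re w - Re z) in Rw.
  pose proof (Rle_abs (- (Re w - Re z))) as Rw2. rewrite Rabs_Ropp in Rw2.
  assert (T1 := T w ltac:(unfold x in *; lra)). assert (T2 := T z ltac:(unfold x in *; lra)).
  pose proof (Cmod_triangle_minus (tau w) (bsum w N) (tau z)).
  pose proof (Cmod_triangle_minus (bsum w N) (bsum z N) (tau z)).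
  rewrite (Cmod_minus_sym (bsum z N) (tau z)) in *.
  change (csum (fun k => b k w) N) with (bsum w N) in Hd1.
  change (csum (fun k => b k z) N) with (bsum z N) in Hd1. lra.
Qed.

(** Any holomorphic logarithm of [L] on the rectangle differs from [tau] by a period of [Cexp],
    which is constant on the part with [Re z > 0]. Subtracting the value of this constant at the
    point 1 selects the branch that continues the series. *)
Lemma log_series_exists (L : C -> C) (a1 b1 c1 d1 : R) :
  orect a1 b1 c1 d1 1 -> a1 <= 0 -> holo L (orect a1 b1 c1 d1) ->
  (forall z, orect a1 b1 c1 d1 z -> L z <> 0%C) ->
  (forall z, orect a1 b1 c1 d1 z -> 0 < Re z -> ccv (fun n => Cexp (bsum z n)) (L z)) ->
  exists F, holo F (orect a1 b1 c1 d1) /\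
    (forall z, orect a1 b1 c1 d1 z -> Cexp (F z) = L z) /\
    (forall z, orect a1 b1 c1 d1 z -> 0 < Re z -> ccv (bsum z) (F z)).
Proof.
  intros H1 Ha1 HL Hn Hcv. set (U := orect a1 b1 c1 d1) in *.
  assert (Hsub : forall z, orect 0 b1 c1 d1 z <-> U z /\ 0 < Re z).
  { intros z. unfold U, orect. lra. }
  assert (R1 : Re 1 = 1) by reflexivity.
  destruct (holo_log L U 1 (orect_box_star _ _ _ _ _ H1) HL Hn) as [F0 HF0].
  set (D := fun z => (F0 z - tau z)%C).
  assert (CF : forall z, U z -> ccont F0 z).
  { intros z Hz. exact (cderiv_ccont _ _ _ (proj2 (HF0 z Hz))). }
  assert (ED : forall z, orect 0 b1 c1 d1 z -> Cexp (D z) = 1%C).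
  { intros z Hz. apply Hsub in Hz. unfold D, Cminus. rewrite Cexp_plus, Cexp_opp, (proj1 (HF0 z (proj1 Hz))).
    rewrite (ccv_unique _ _ _ (Hcv z (proj1 Hz) (proj2 Hz))
      (ccv_map Cexp _ _ (cderiv_ccont _ _ _ (Cexp_cderiv _)) (tau_spec z (proj2 Hz)))).
    apply Cinv_r, Cexp_neq_0. }
  assert (H1' : orect 0 b1 c1 d1 1) by (apply Hsub; split; [exact H1 | rewrite R1; lra]).
  assert (DC := Cexp_1_const D (orect 0 b1 c1 d1) 1 (orect_box_star _ _ _ _ _ H1')).
  exists (fun z => F0 z - D 1)%C. split; [|split].
  - intros z Hz. eexists. apply cderiv_minus; [exact (proj2 (HF0 z Hz)) | apply cderiv_const].
  - intros z Hz. unfold Cminus. rewrite Cexp_plus, Cexp_opp, (proj1 (HF0 z Hz)), ED by exact H1'. field.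
  - intros z Hz Hz0. replace (F0 z - D 1)%C with (tau z); [now apply tau_spec|].
    rewrite <- (DC) with (z := z); [unfold D; ring| |exact ED|now apply Hsub].
    intros w Hw. apply Hsub in Hw. apply ccont_minus; [now apply CF | now apply tau_ccont].
Qed.

(** Borel-Caratheodory on the disc of centre [1 + i Im z] and radius [1 + eta], which lies in the
    rectangle and in [Re w < 3]. The growth of [L] bounds [Re F] by [M0], and at the centre the
    series itself gives [|F| <= 4 m], its term of index 1 being zero. *)
Lemma log_bound (F L : C -> C) (eta eta' T X H M0 : R) (z : C) :
  0 < eta' -> eta' < eta -> eta <= / 2 -> 3 <= X -> T + 2 <= H -> 0 <= M0 ->
  holo F (orect (- eta) X (- H) H) ->
  (forall z, orect (- eta) X (- H) H z -> Cexp (F z) = L z) ->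
  (forall z, orect (- eta) X (- H) H z -> 0 < Re z -> ccv (bsum z) (F z)) ->
  (forall z, orect (- eta) X (- H) H z -> Re z < 3 -> Cmod (L z) <= exp M0) ->
  (forall z, b 1 z = 0%C) ->
  - eta' <= Re z <= 0 -> Rabs (Im z) <= T ->
  Cmod (F z) <= 4 * m + 8 / (eta - eta') * (2 * M0 + 4 * m).
Proof.
  intros He' He He2 HX HH HM0 HF HFL Hcv HL Hb1 Hz Ht.
  set (z0 := (1 + Ci * Im z)%C).
  assert (Rz0 : Re z0 = 1) by apply Re_pt. assert (Iz0 : Im z0 = Im z) by apply Im_pt.
  assert (Ht' : - T <= Im z <= T) by (split; [|]; pose proof (Rle_abs (Im z)); pose proof (Rle_abs (- Im z)); rewrite ?Rabs_Ropp in *; lra).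
  assert (Hd : forall w, cdisc z0 (1 + eta) w -> orect (- eta) X (- H) H w /\ Re w < 3).
  { intros w Hw. unfold cdisc in Hw.
    assert (A1 := Rle_lt_trans _ _ _ (re_le_Cmod (w - z0)) Hw).
    assert (A2 := Rle_lt_trans _ _ _ (im_le_Cmod (w - z0)) Hw).
    change (Re (w - z0)%C) with (Re w - Re z0) in A1. change (Im (w - z0)%C) with (Im w - Im z0) in A2.
    rewrite Rz0 in A1. rewrite Iz0 in A2. apply Rabs_def2 in A1. apply Rabs_def2 in A2. unfold orect. lra. }
  assert (Hz0 : orect (- eta) X (- H) H z0).
  { apply Hd. unfold cdisc. rewrite Cmod_diag. lra. }
  assert (Ez : Cmod (z - z0) = 1 - Re z).
  { replace (z - z0)%C with (RtoC (Re z - 1)).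
    - rewrite Cmod_R, Rabs_left1; lra.
    - unfold z0. rewrite <- (pt_eta z) at 2. rewrite RtoC_minus. ring. }
  assert (F0 : Cmod (F z0) <= 4 * m).
  { replace (F z0) with (F z0 - bsum z0 1)%C.
    - eapply Rle_trans; [apply (ccv_le (bsum z0) (F z0) (bsum z0 1) (4 * m * Rpower (INR 1) (- Re z0) / Re z0) 1)|].
      + apply Hcv; [exact Hz0 | lra].
      + intros n Hn. apply bsum_tail; [lra | lia].
      + rewrite Rz0. unfold Rpower. simpl INR. rewrite ln_1, Rmult_0_r, exp_0. lra.
    - unfold bsum; simpl. rewrite Hb1. ring. }
  (* Halfway between the largest distance [1 + eta'] of [z] from the centre and the radius
     [1 + eta]: then [rho - |z - z0| >= (eta - eta') / 2], and [2 rho <= 4] leads to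
     [8 / (eta - eta')]. *)
  set (rho := 1 + (eta + eta') / 2).
  assert (B := borel_caratheodory F z0 z rho (1 + eta) M0). rewrite Ez in B.
  eapply Rle_trans; [apply B|].
  - unfold rho. lra.
  - unfold rho. lra.
  - intros w Hw. apply HF. now apply Hd.
  - exact HM0.
  - intros w Hw. destruct (Hd w Hw) as [D1 D2]. specialize (HL w D1 D2).
    rewrite <- HFL, Cmod_Cexp in HL by exact D1. destruct (Rle_dec (Re (F w)) M0) as [|N]; [assumption|].
    apply Rnot_le_lt, exp_increasing in N. lra.
  - pose proof (Cmod_ge_0 (F z0)).
    apply Rplus_le_compat; [exact F0|].
    apply Rmult_le_compat; [|lra| |lra].
    + apply quot_nonneg; unfold rho; lra.
    + replace (8 / (eta - eta')) with (4 * / ((eta - eta') / 2)) by (field; lra). unfold Rdiv at 1.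
      apply Rmult_le_compat; [unfold rho; lra | left; apply Rinv_0_lt_compat; unfold rho; lra | unfold rho; lra|].
      apply Rinv_le_contravar; unfold rho; lra.
Qed.

Context (a : nat -> C).
Hypothesis (Ha_le : forall k, Cmod (a k) <= m).
Hypothesis (Hb_main : forall k z, (1 <= k)%nat -> - / 2 <= Re z ->
  Cmod (b k z - a k * npow k (- (1 + z))) <= 4 * m * Rpower (INR k) (- (2 * (1 + Re z)))).

Lemma Cmod_npow (k : nat) (s : C) : Cmod (npow k s) = Rpower (INR k) (Re s).
Proof. exact (Cmod_rpow_c (INR k) s). Qed.

Lemma npow_cderiv (k : nat) (z : C) : exists l, cderiv (fun z => npow k (- (1 + z)))%C z l.
Proof.
  eexists. apply (cderiv_comp (rpow_c (INR k)) (fun z => - (1 + z))%C); [apply rpow_c_cderiv|].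
  apply cderiv_opp, cderiv_plus; [apply cderiv_const | apply cderiv_id].
Qed.

(** Newman's contour applied to [F] minus the partial sum, with [Sp] the first-order Dirichlet
    polynomial. Adding [Sp] leaves [F] minus the higher-order terms, which stay bounded up to
    [Re z = - eta'] because [2 (1 - eta') > 1]. *)
Theorem log_tail_bound (L : C -> C) (eta eta' T X H M0 : R) (Y : nat) :
  0 < eta' -> eta' < eta -> eta <= / 2 -> 1 <= T -> T + 3 <= X -> T + 2 <= H ->
  T <= INR Y -> 0 <= M0 ->
  holo L (orect (- eta) X (- H) H) ->
  (forall z, orect (- eta) X (- H) H z -> L z <> 0%C) ->
  (forall z, orect (- eta) X (- H) H z -> 0 < Re z -> ccv (fun n => Cexp (bsum z n)) (L z)) ->
  (forall z, orect (- eta) X (- H) H z -> Re z < 3 -> Cmod (L z) <= exp M0) ->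
  (forall z, b 1 z = 0%C) ->
  (forall k, a k = 0%C \/ (2 <= k)%nat) ->
  exists E, L 0%C = (Cexp E * Cexp (bsum 0 Y))%C /\
    Cmod E <= 60 * m / T
      + (4 * m + 8 / (eta - eta') * (2 * M0 + 4 * m) + 4 * m / (1 - 2 * eta')) *
        (4 / T ^ 2 + 2 * T * (/ eta' + 2) * Rpower (INR Y) (- eta')).
Proof.
  intros He' He He2 HT HX HH HTY HM0 HL Hn Hcv HLM Hb1 Ha1.
  assert (HY1 : 1 <= INR Y) by lra.
  assert (HY : (1 <= Y)%nat) by (apply INR_le; simpl; lra).
  set (U := orect (- eta) X (- H) H) in *.
  assert (H0 : U 0%C) by (unfold U, orect, Re, Im, RtoC; simpl; lra).
  assert (H1 : U 1%C) by (unfold U, orect, Re, Im, RtoC; simpl; lra).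
  destruct (log_series_exists L (- eta) X (- H) H) as [F [HF [HFL HFcv]]]; auto; [lra|].
  exists (F 0%C - bsum 0 Y)%C. split.
  { rewrite <- Cexp_plus, <- HFL by exact H0. f_equal. ring. }
  set (Sp := fun z => csum (fun k => (a k * npow k (- (1 + z)))%C) Y).
  set (A := fun z => (F z - bsum z Y)%C).
  (* [C0] is [4 m], the constant of [bsum_tail], and the Dirichlet polynomial has coefficients at
     most [m]. *)
  replace (60 * m / T) with ((10 * (4 * m) + 20 * m) / T) by (field; lra).
  apply (newman_contour A Sp U (INR Y) eta' T (4 * m) m); try lra.
  - assert (0 <= 8 / (eta - eta')) by (apply quot_nonneg; lra).
    assert (0 <= 4 * m / (1 - 2 * eta')) by (apply quot_nonneg; lra). nra.
  - now apply orect_box_star.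
  - intros z Hz. destruct (HF z Hz) as [l Hl].
    destruct (csum_cderiv b Y z) as [l' Hl']; [intros k; apply Hb_holo; unfold U, orect in Hz; lra|].
    eexists. apply cderiv_minus; [exact Hl | exact Hl'].
  - intros z _. apply (csum_cderiv (fun k z => a k * npow k (- (1 + z)))%C). intros k.
    destruct (npow_cderiv k z) as [l Hl]. eexists. apply cderiv_mult; [apply cderiv_const | exact Hl].
  - intros z Hz. rewrite cbox_le in Hz by lra. unfold U, orect. lra.
  - intros z Hz Hx. set (P := Rpower (INR Y) (Re z)).
    assert (HP : 0 < P) by apply exp_pos.
    assert (B : Cmod (A z) <= 4 * m * Rpower (INR Y) (- Re z) / Re z).
    { apply (ccv_le (bsum z) _ _ _ Y); [now apply HFcv|]. intros n Hn'. apply bsum_tail; [exact Hx | lia]. }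
    rewrite Rpower_Ropp in B. fold P in B.
    apply Rle_trans with (4 * m * / P / Re z * P); [apply Rmult_le_compat_r; lra|]. right. field. lra.
  - intros z Hz. set (y := - Re z).
    assert (B : Cmod (Sp z) <= m * (/ y + / INR Y) * Rpower (INR Y) y).
    { apply csum_power_le; [unfold y; lra | exact Hm | exact HY|]. intros k Hk.
      rewrite Cmod_mult, Cmod_npow. apply Rmult_le_compat; [apply Cmod_ge_0 | left; apply exp_pos | apply Ha_le|].
      right. f_equal. unfold y, Re, Copp, Cplus, RtoC; simpl. ring. }
    replace (Re z) with (- y) at 1 by (unfold y; ring). rewrite Rpower_Ropp.
    assert (HP : 0 < Rpower (INR Y) y) by apply exp_pos. set (P := Rpower (INR Y) y) in *.
    apply Rle_trans with (m * (/ y + / INR Y) * P * / P).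
    + apply Rmult_le_compat_r; [left; now apply Rinv_0_lt_compat | exact B].
    + right. field. unfold y; lra.
  - intros z Hz Ht.
    assert (B1 := log_bound F L eta eta' T X H M0 z He' He He2 ltac:(lra) HH HM0 HF HFL HFcv HLM Hb1 Hz Ht).
    assert (B2 : Cmod (bsum z Y - Sp z) <= 4 * m / (1 - 2 * eta')).
    { unfold bsum, Sp. rewrite <- csum_minus.
      (* [csum_tail] bounds what follows a given index, here 1; subtracting the sum up to 1 changes
         nothing since both [b 1] and [a 1] vanish. *)
      replace (csum _ Y) with (csum (fun k => b k z - a k * npow k (- (1 + z)))%C Y
         - csum (fun k => b k z - a k * npow k (- (1 + z)))%C 1)%C.
      2:{ simpl. rewrite Hb1. destruct (Ha1 1%nat) as [->|]; [ring | lia]. }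
      eapply Rle_trans; [apply (csum_tail _ (4 * m) (1 - 2 * eta')); [lra | lra | lia|]|].
      - intros k Hk. eapply Rle_trans; [apply Hb_main; [exact Hk | lra]|].
        apply Rmult_le_compat_l; [lra|]. apply Rle_Rpower; [apply (le_INR 1); exact Hk | lra].
      - unfold Rpower. simpl INR. rewrite ln_1, Rmult_0_r, exp_0. lra. }
    replace (A z + Sp z)%C with (F z + - (bsum z Y - Sp z))%C by (unfold A; ring).
    eapply Rle_trans; [apply Cmod_triangle|]. rewrite Cmod_opp. lra.
Qed.

End LogSeries.

(** * Estimates at the edge of the zero-free region *)

Lemma clog_exists : exists l : C -> C, l 1%C = 0%C /\
  forall z, cdisc 1 1 z -> Cexp (l z) = z /\ cderiv l z (/ z)%C.
Proof.
  assert (HU : box_star (cdisc 1 1) 1) by (apply cdisc_box_star; lra).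
  assert (Hid : holo (fun z => z) (cdisc 1 1)) by (intros z _; eexists; apply cderiv_id).
  assert (H1 : cdisc 1 1 1) by apply HU.
  destruct (holo_log (fun z => z) (cdisc 1 1) 1 HU Hid) as [F HF].
  { intros z Hz ->. unfold cdisc in Hz. replace (0 - 1)%C with (- (1))%C in Hz by ring.
    rewrite Cmod_opp, Cmod_1 in Hz. lra. }
  exists (fun z => F z - F 1)%C. split; [ring|]. intros z Hz. destruct (HF z Hz) as [E D]. split.
  - unfold Cminus. rewrite Cexp_plus, Cexp_opp, E, (proj1 (HF _ H1)). field.
  - eapply cderiv_eq; [apply cderiv_minus; [exact D | apply cderiv_const]|].
    rewrite (cderiv_unique _ _ _ _ (cder_spec _ _ Hid z Hz) (cderiv_id z)).
    unfold Cdiv. ring.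
Qed.

Definition clog : C -> C := proj1_sig (constructive_indefinite_description _ clog_exists).

Lemma clog_1 : clog 1 = 0%C.
Proof. exact (proj1 (proj2_sig (constructive_indefinite_description _ clog_exists))). Qed.

Lemma clog_spec (z : C) : cdisc 1 1 z -> Cexp (clog z) = z /\ cderiv clog z (/ z)%C.
Proof. exact (proj2 (proj2_sig (constructive_indefinite_description _ clog_exists)) z). Qed.

Lemma cdisc_1_minus (w : C) : Cmod w < 1 -> cdisc 1 1 (1 - w)%C.
Proof.
  intros H. unfold cdisc. replace (1 - w - 1)%C with (- w)%C by ring. now rewrite Cmod_opp.
Qed.

(** Integrate the derivative [- t w^2 / (1 - t w)] of [log (1 - t w) + t w] over [[0, 1]], where the
    denominator is at least [1/4] in modulus. *)
Lemma clog_1_minus_main (w : C) : Cmod w <= 3 / 4 ->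
  Cmod (- clog (1 - w) - w) <= 4 * Cmod w ^ 2.
Proof.
  intros Hw. pose proof (Cmod_ge_0 w) as H0.
  assert (Ht : forall t : R, 0 <= t <= 1 -> Cmod (t * w) <= 3 / 4).
  { intros t Ht. rewrite Cmod_mult, Cmod_R, Rabs_right by lra. nra. }
  assert (Hn : forall t : R, 0 <= t <= 1 -> / 4 <= Cmod (1 - t * w)).
  { intros t Ht1. specialize (Ht t Ht1). pose proof (Cmod_le_minus 1 (t * w)) as T.
    rewrite Cmod_1 in T. lra. }
  assert (Hn0 : forall t : R, 0 <= t <= 1 -> (1 - t * w)%C <> 0%C).
  { intros t Ht1. apply Cmod_gt_0. specialize (Hn t Ht1). lra. }
  assert (Hc : ccont_seg (fun t => - (t * (w * w)) / (1 - t * w))%C 0 1).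
  { intros t Ht1. rewrite Rmin_left, Rmax_right in Ht1 by lra. apply ccont_div.
    - apply ccont_opp, ccont_mult; [apply ccont_id | apply ccont_const].
    - apply ccont_minus; [apply ccont_const|]. apply ccont_mult; [apply ccont_id | apply ccont_const].
    - now apply Hn0. }
  assert (E := cint_ftc (fun t => clog (1 - t * w) + t * w)%C
     (fun t => - (t * (w * w)) / (1 - t * w))%C 0 1).
  replace (- clog (1 - w) - w)%C with
    (- (clog (1 - RtoC 1 * w) + RtoC 1 * w - (clog (1 - RtoC 0 * w) + RtoC 0 * w)))%C.
  2:{ replace (1 - 0 * w)%C with (RtoC 1) by ring. rewrite clog_1, Cmult_1_l. ring. }
  rewrite Cmod_opp, <- E; [|clear E|exact Hc].
  - replace (4 * Cmod w ^ 2) with ((1 - 0) * (Cmod w ^ 2 / (/ 4))) by field.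
    apply cint_norm_le_const; [lra | exact Hc|]. intros t Ht1.
    apply Cmod_quot_le; [lra | | now apply Hn].
    rewrite Cmod_opp, !Cmod_mult, Cmod_R, Rabs_right by lra.
    assert (0 <= Cmod w * Cmod w) by nra. nra.
  - intros t Ht1. rewrite Rmin_left, Rmax_right in Ht1 by lra.
    eapply cderiv_eq.
    + apply cderiv_plus; [|apply cderiv_mult; [apply cderiv_id | apply cderiv_const]].
      apply (cderiv_comp clog (fun t => 1 - t * w)%C).
      * apply clog_spec, cdisc_1_minus. specialize (Ht t Ht1). lra.
      * apply cderiv_minus; [apply cderiv_const|]. apply cderiv_mult; [apply cderiv_id | apply cderiv_const].
    + cbv beta. field. now apply Hn0.
Qed.

(** [4 |w|^2 <= 3 |w|] by the bound on [|w|], and the main term adds one more [|w|]. *)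
Lemma clog_1_minus_le (w : C) : Cmod w <= 3 / 4 -> Cmod (- clog (1 - w)) <= 4 * Cmod w.
Proof.
  intros Hw. pose proof (clog_1_minus_main w Hw). pose proof (Cmod_ge_0 w).
  pose proof (Cmod_le_minus (- clog (1 - w)) w). nra.
Qed.

Section EulerTerm.

Context (c : C) (k : nat) (z : C).
Hypothesis (Hc : Cmod c <= 1) (Hk : (2 <= k)%nat) (Hz : - / 2 <= Re z).

Let w : C := (c * npow k (- (1 + z)))%C.

Lemma euler_arg_le : Cmod w <= Rpower (INR k) (- (1 + Re z)).
Proof.
  unfold w. rewrite Cmod_mult, Cmod_npow.
  replace (Re (- (1 + z))%C) with (- (1 + Re z)) by reflexivity.
  rewrite <- (Rmult_1_l (Rpower _ _)). apply Rmult_le_compat; [apply Cmod_ge_0| |exact Hc|].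
  - rewrite Rmult_1_l. left. apply exp_pos.
  - lra.
Qed.

(** The extreme case is the prime 2 on the line [Re z = - 1/2], where [2^(-1/2) <= 3/4] as
    [4/3 <= sqrt 2]. This is the origin of [3/4] in the lemmas on [clog]. *)
Lemma euler_arg_le_34 : Cmod w <= 3 / 4.
Proof.
  eapply Rle_trans; [apply euler_arg_le|].
  assert (H2 : 2 <= INR k) by (apply (le_INR 2); exact Hk).
  apply Rle_trans with (Rpower (INR k) (- / 2)); [apply Rle_Rpower; lra|].
  apply Rle_trans with (Rpower 2 (- / 2)); [apply Rpower_ge_base; lra|].
  rewrite Rpower_Ropp, Rpower_sqrt by lra.
  assert (4 / 3 <= sqrt 2).
  { rewrite <- (sqrt_Rsqr (4 / 3)) by lra. apply sqrt_le_1_alt. unfold Rsqr. lra. }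
  replace (3 / 4) with (/ (4 / 3)) by field. apply Rinv_le_contravar; lra.
Qed.

Lemma euler_term_le : Cmod (- clog (1 - w)) <= 4 * Rpower (INR k) (- (1 + Re z)).
Proof.
  eapply Rle_trans; [apply clog_1_minus_le, euler_arg_le_34|].
  apply Rmult_le_compat_l; [lra | apply euler_arg_le].
Qed.

Lemma euler_term_main : Cmod (- clog (1 - w) - w) <= 4 * Rpower (INR k) (- (2 * (1 + Re z))).
Proof.
  eapply Rle_trans; [apply clog_1_minus_main, euler_arg_le_34|].
  apply Rmult_le_compat_l; [lra|].
  replace (- (2 * (1 + Re z))) with (- (1 + Re z) + - (1 + Re z)) by ring. rewrite Rpower_plus.
  replace (Cmod w ^ 2) with (Cmod w * Cmod w) by ring.
  apply Rmult_le_compat; try apply Cmod_ge_0; apply euler_arg_le.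
Qed.

Lemma euler_term_holo : exists l, cderiv (fun z => - clog (1 - c * npow k (- (1 + z))))%C z l.
Proof.
  destruct (npow_cderiv k z) as [l Hl]. eexists. apply cderiv_opp.
  apply (cderiv_comp clog (fun z => 1 - c * npow k (- (1 + z)))%C).
  - apply clog_spec, cdisc_1_minus. fold w. pose proof euler_arg_le_34. lra.
  - apply cderiv_minus; [apply cderiv_const|]. apply cderiv_mult; [apply cderiv_const | exact Hl].
Qed.

Lemma euler_term_exp : Cexp (- clog (1 - w)) = (/ (1 - w))%C.
Proof.
  rewrite Cexp_opp. f_equal. apply clog_spec, cdisc_1_minus. pose proof euler_arg_le_34. lra.
Qed.

End EulerTerm.

(** Integrate the derivative of [exp (t E)] over [[0, 1]]. This turns the bound for the logarithmic
    error into one for the relative error [eps]. *)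
Lemma Cexp_minus_1_le (E : C) : Cmod (Cexp E - 1) <= Cmod E * exp (Cmod E).
Proof.
  assert (Hc : ccont_seg (fun t => E * Cexp (t * E))%C 0 1).
  { intros t _. apply ccont_mult; [apply ccont_const|]. apply (ccont_comp Cexp (fun t => t * E)%C).
    - apply ccont_mult; [apply ccont_id | apply ccont_const].
    - exact (cderiv_ccont _ _ _ (Cexp_cderiv _)). }
  assert (F := cint_ftc (fun t => Cexp (t * E)) (fun t => E * Cexp (t * E))%C 0 1).
  cbv beta in F. rewrite Cmult_1_l, Cmult_0_l, Cexp_0 in F. rewrite <- F; [|clear F|exact Hc].
  - replace (Cmod E * exp (Cmod E)) with ((1 - 0) * (Cmod E * exp (Cmod E))) by ring.
    apply cint_norm_le_const; [lra | exact Hc|]. intros t Ht. rewrite Cmod_mult, Cmod_Cexp.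
    apply Rmult_le_compat_l; [apply Cmod_ge_0|].
    pose proof (re_le_Cmod E) as R1. pose proof (Rle_abs (Re E)). pose proof (Cmod_ge_0 E).
    replace (Re (t * E)%C) with (t * Re E) by (unfold Re, Cmult, RtoC; simpl; ring).
    assert (t * Re E <= Cmod E) by nra.
    destruct (Rle_lt_or_eq_dec _ _ H1) as [L|L]; [left; now apply exp_increasing | right; now rewrite L].
  - intros t _. eapply cderiv_eq.
    + apply (cderiv_comp Cexp (fun t => t * E)%C); [apply Cexp_cderiv|].
      apply cderiv_mult; [apply cderiv_id | apply cderiv_const].
    + cbv beta. ring.
Qed.

(** Makes [log N >= 2] out of [N >= 16], so that [log log N] is positive. *)
Lemma exp_2_le_16 : exp 2 <= 16.
Proof.
  replace 2 with (1 + 1) by ring. rewrite exp_plus. pose proof exp_le_3. pose proof (exp_pos 1). nra.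
Qed.

Lemma ln_le_self (x : R) : 0 < x -> ln x <= x.
Proof.
  intros Hx. pose proof (exp_ineq1_le (ln x)) as H. rewrite exp_ln in H by exact Hx. lra.
Qed.

Lemma natfloor_ge (x : R) : 0 <= x -> x - 1 <= INR (natfloor x).
Proof.
  intros Hx. unfold natfloor. destruct (base_Int_part x) as [H1 H2].
  assert (0 <= Int_part x)%Z.
  { assert (-1 < Int_part x)%Z; [|lia]. apply lt_IZR. lra. }
  rewrite INR_IZR_INZ, Z2Nat.id by assumption. lra.
Qed.

(** * The choice of parameters and the size of the error *)

Section Asymptotics.

Context (l A eta : R).
Hypothesis (Hl : 2 <= l) (Heta : 0 < eta < / 2) (HA : 2 / eta <= A).

(* With [T = l^tau], [eta' = theta eta] and [A eta >= 2], the error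
   [l (1 / T^2 + T l^(- A eta'))] decays if [1/2 < tau < 2 theta - 1]. *)
Let eta' := 15 / 16 * eta.
Let T := Rpower l (3 / 4).
Let Y := natfloor (Rpower l A).

Lemma height_bounds : 1 <= T <= l.
Proof.
  split.
  - unfold T. rewrite <- (Rpower_O l) by lra. apply Rle_Rpower; lra.
  - unfold T. rewrite <- (Rpower_1 l) at 2 by lra. apply Rle_Rpower; lra.
Qed.

Lemma exponent_ge_4 : 4 <= A.
Proof.
  apply Rle_trans with (2 / eta); [|exact HA].
  apply Rmult_le_reg_r with eta; [lra|]. unfold Rdiv. rewrite Rmult_assoc, Rinv_l; lra.
Qed.

Lemma length_power_ge : l ^ 4 <= Rpower l A.
Proof.
  rewrite <- Rpower_pow by lra. apply Rle_Rpower; [lra|]. simpl. pose proof exponent_ge_4. lra.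
Qed.

(** Since [l^A >= l^4 >= 16], rounding down loses less than half. *)
Lemma length_ge_half : Rpower l A / 2 <= INR Y.
Proof.
  pose proof length_power_ge. assert (S : 4 <= l * l) by nra.
  assert (16 <= l ^ 4) by (replace (l ^ 4) with ((l * l) * (l * l)) by ring; nra).
  eapply Rle_trans; [|apply natfloor_ge; lra]. lra.
Qed.

Lemma height_le_length : T <= INR Y.
Proof.
  pose proof length_power_ge. pose proof length_ge_half. pose proof height_bounds.
  assert (S : 4 <= l * l) by nra.
  assert (4 * l <= l ^ 4) by (replace (l ^ 4) with ((l * l) * (l * l)) by ring; nra). lra.
Qed.

(** The loss of one half in [Y] costs [2^eta' <= 2], and [A eta' >= 15/8] because [A eta >= 2]. *)
Lemma length_decay : Rpower (INR Y) (- eta') <= 2 * Rpower l (- (15 / 8)).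
Proof.
  pose proof length_ge_half as H. assert (P : 0 < Rpower l A) by apply exp_pos.
  eapply Rle_trans; [apply (Rpower_ge_base (Rpower l A / 2)); [lra | exact H | unfold eta'; lra]|].
  unfold Rdiv. rewrite <- Rpower_mult_distr by lra. rewrite Rpower_mult.
  rewrite Rmult_comm. apply Rmult_le_compat; try (left; apply exp_pos).
  - rewrite Rpower_Ropp. unfold Rpower. rewrite ln_Rinv by lra.
    rewrite <- exp_Ropp. replace (- (eta' * - ln 2)) with (eta' * ln 2) by ring.
    rewrite <- (exp_ln 2) at 2 by lra.
    assert (0 < ln 2) by (rewrite <- ln_1; apply ln_increasing; lra).
    left. apply exp_increasing. unfold eta'. nra.
  - apply Rle_Rpower; [lra|].
    assert (2 <= A * eta).
    { replace 2 with (2 / eta * eta) by (field; lra). apply Rmult_le_compat_r; lra. }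
    unfold eta'. lra.
Qed.

(** The exponents of [l] are [-3/4] from [1/T], [1 - 3/2 = -1/2] from [M / T^2] and
    [1 + 3/4 - 15/8 = -1/8] from the left side; the last one dominates. *)
Lemma error_bound (mu C1 M : R) : 0 <= mu -> 0 <= C1 -> M <= C1 * l ->
  60 * mu / T + M * (4 / T ^ 2 + 2 * T * (/ eta' + 2) * Rpower (INR Y) (- eta'))
  <= (60 * mu + C1 * (4 + 4 * (/ eta' + 2))) * Rpower l (- / 8).
Proof.
  intros Hmu HC1 HM. pose proof height_bounds as HT. pose proof length_decay as HD.
  assert (He' : 0 < / eta') by (apply Rinv_0_lt_compat; unfold eta'; lra).
  assert (P : forall x, 0 < Rpower l x) by (intros; apply exp_pos).
  assert (LP : forall x, x <= - / 8 -> Rpower l x <= Rpower l (- / 8)) by (intros; apply Rle_Rpower; lra).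
  assert (PQ : 0 < Rpower (INR Y) (- eta')) by apply exp_pos.
  assert (ET : / T = Rpower l (- (3 / 4))) by (unfold T; now rewrite Rpower_Ropp).
  assert (ET2 : l * / T ^ 2 = Rpower l (- / 2)).
  { rewrite <- pow_inv, ET. rewrite <- (Rpower_1 l) at 1 by lra. simpl pow.
    rewrite Rmult_1_r, <- !Rpower_plus. f_equal. field. }
  assert (EY : l * (T * Rpower l (- (15 / 8))) = Rpower l (- / 8)).
  { rewrite <- (Rpower_1 l) at 1 by lra. unfold T. rewrite <- !Rpower_plus. f_equal. field. }
  assert (A1 : 60 * mu / T <= 60 * mu * Rpower l (- / 8)).
  { unfold Rdiv. rewrite ET. apply Rmult_le_compat_l; [lra | apply LP; lra]. }
  set (W := 4 / T ^ 2 + 2 * T * (/ eta' + 2) * Rpower (INR Y) (- eta')).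
  assert (HW : W <= 4 / T ^ 2 + 4 * (/ eta' + 2) * (T * Rpower l (- (15 / 8)))).
  { unfold W. apply Rplus_le_compat_l.
    replace (4 * (/ eta' + 2) * (T * Rpower l (- (15 / 8)))) with
      (2 * T * (/ eta' + 2) * (2 * Rpower l (- (15 / 8)))) by ring.
    apply Rmult_le_compat_l; [|exact HD]. apply Rmult_le_pos; lra. }
  assert (HW0 : 0 <= W).
  { unfold W. apply Rplus_le_le_0_compat.
    - apply quot_nonneg; [lra|]. apply pow_lt; lra.
    - apply Rmult_le_pos; [|lra]. apply Rmult_le_pos; lra. }
  assert (A2 : M * W <= C1 * ((4 + 4 * (/ eta' + 2)) * Rpower l (- / 8))).
  { apply Rle_trans with (C1 * l * W); [apply Rmult_le_compat_r; assumption|].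
    rewrite Rmult_assoc. apply Rmult_le_compat_l; [exact HC1|].
    apply Rle_trans with (l * (4 / T ^ 2 + 4 * (/ eta' + 2) * (T * Rpower l (- (15 / 8))))).
    - apply Rmult_le_compat_l; lra.
    - replace (l * (4 / T ^ 2 + 4 * (/ eta' + 2) * (T * Rpower l (- (15 / 8))))) with
        (4 * (l * / T ^ 2) + 4 * (/ eta' + 2) * (l * (T * Rpower l (- (15 / 8))))) by (unfold Rdiv; ring).
      rewrite ET2, EY. specialize (LP (- / 2) ltac:(lra)). lra. }
  lra.
Qed.

(** [log x <= x] at [x = l^(1/8)]. Here the power saving is weakened to the form of the theorem. *)
Lemma decay_le_inv_ln : Rpower l (- / 8) <= 8 / ln l.
Proof.
  assert (L0 : 0 < ln l) by (rewrite <- ln_1; apply ln_increasing; lra).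
  assert (P : 0 < Rpower l (/ 8)) by apply exp_pos.
  pose proof (ln_le_self _ P) as H. unfold Rpower at 1 in H. rewrite ln_exp in H.
  rewrite Rpower_Ropp. apply Rmult_le_reg_r with (Rpower l (/ 8) * ln l); [now apply Rmult_lt_0_compat|].
  replace (/ Rpower l (/ 8) * (Rpower l (/ 8) * ln l)) with (ln l) by (field; lra).
  replace (8 / ln l * (Rpower l (/ 8) * ln l)) with (8 * Rpower l (/ 8)) by (field; lra). lra.
Qed.

End Asymptotics.

(** The analytic core, for an abstract sequence [b] of logarithms with first-order coefficients [a];
    primes and finite products enter only afterwards. That [B] precedes [b], [a], [L], [N] and
    [sigmaL] is the uniformity of the implied constant. *)
Theorem euler_product_at_1 (mu gamma1 gamma2 K delta A : R) :
  0 <= mu -> 0 < gamma1 -> 0 < gamma2 -> 0 < K -> 0 < delta < 7 / 2 -> 14 / delta <= A ->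
  exists B, 0 < B /\
  forall (b : nat -> C -> C) (a : nat -> C) (L : C -> C) (N sigmaL : R),
    (forall k z, - / 2 < Re z -> exists l, cderiv (b k) z l) ->
    (forall k z, (1 <= k)%nat -> - / 2 <= Re z ->
       Cmod (b k z) <= 4 * mu * Rpower (INR k) (- (1 + Re z))) ->
    (forall k, Cmod (a k) <= mu) ->
    (forall k z, (1 <= k)%nat -> - / 2 <= Re z ->
       Cmod (b k z - a k * npow k (- (1 + z))) <= 4 * mu * Rpower (INR k) (- (2 * (1 + Re z)))) ->
    (forall z, b 1%nat z = 0%C) ->
    (forall k, a k = 0%C \/ (2 <= k)%nat) ->
    (forall z, 0 < Re z -> ccv (fun n => Cexp (csum (fun k => b k z) n)) (L (1 + z)%C)) ->
    16 <= N -> delta < 7 * (1 - sigmaL) ->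
    holo L (fun s => sigmaL <= Re s) ->
    (forall s, 1 <= Re s \/ (1 - delta / 7 <= Re s < 1 /\ Rabs (Im s) <= 2 * ln N ^ 3) -> L s <> 0%C) ->
    (forall s, sigmaL < Re s < 4 ->
       Cmod (L s) <= K * Rpower N gamma1 * Rpower (1 + Rabs (Im s)) gamma2) ->
  exists eps, Cmod eps <= B / ln (ln N) /\
    L 1%C = ((1 + eps) * Cexp (csum (fun k => b k 0%C) (natfloor (Rpower (ln N) A))))%C.
Proof.
  intros Hmu Hg1 Hg2 HK Hd HA.
  set (eta := delta / 7). set (eta' := 15 / 16 * eta).
  assert (Heta : 0 < eta < / 2) by (unfold eta; lra).
  assert (HA' : 2 / eta <= A).
  { replace (2 / eta) with (14 / delta) by (unfold eta; field; lra). exact HA. }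
  (* [K1 * l] bounds the logarithm of the growth bound, as [1 + 2 l^3 <= l^5]. *)
  set (K1 := Rabs (ln K) + gamma1 + 5 * gamma2).
  assert (HK1 : 0 < K1) by (unfold K1; pose proof (Rabs_pos (ln K)); lra).
  set (C1 := 4 * mu + 8 / (eta - eta') * (2 * K1 + 4 * mu) + 4 * mu / (1 - 2 * eta')).
  assert (D1 : 0 <= 8 / (eta - eta')) by (apply quot_nonneg; unfold eta'; lra).
  assert (D2 : 0 <= 4 * mu / (1 - 2 * eta')) by (apply quot_nonneg; unfold eta'; lra).
  assert (HC1 : 0 <= C1).
  { unfold C1. assert (0 <= 8 / (eta - eta') * (2 * K1 + 4 * mu)) by (apply Rmult_le_pos; lra). lra. }
  assert (Ie : 0 < / eta') by (apply Rinv_0_lt_compat; unfold eta'; lra).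
  set (C2 := 60 * mu + C1 * (4 + 4 * (/ eta' + 2)) + 1).
  assert (HC2 : 0 < C2).
  { unfold C2. assert (0 <= C1 * (4 + 4 * (/ eta' + 2))) by (apply Rmult_le_pos; lra). lra. }
  (* [|exp E - 1| <= |E| exp |E|], where [|E| <= C2 l^(-1/8)] is at most [8 C2 / log l] in the first
     factor and at most [C2] in the exponent. *)
  exists (8 * C2 * exp C2). split; [apply Rmult_lt_0_compat; [lra | apply exp_pos]|].
  intros b a L N sigmaL Hb_holo Hb_le Ha_le Hb_main Hb1 Ha1 Hcv HN Hs HL Hnz Hgr.
  set (l := ln N) in *.
  assert (Hl : 2 <= l).
  { unfold l. rewrite <- (ln_exp 2). pose proof exp_2_le_16. pose proof (exp_pos 2).
    destruct (Rle_lt_or_eq_dec (exp 2) N) as [Q|Q]; [lra | left; apply ln_increasing; lra | right; now f_equal]. }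
  set (T := Rpower l (3 / 4)). set (Y := natfloor (Rpower l A)).
  assert (HT : 1 <= T <= l) by now apply height_bounds.
  assert (HTY : T <= INR Y) by now apply (height_le_length l A eta).
  assert (Hl3 : 4 * l <= l ^ 3) by (simpl; nra).
  (* [H] is the full height of the zero-free region, and [l >= 2] makes it exceed [T + 2]. To the
     right, [X] leaves room for the contour, which ends at [Re z = T], and for the discs of
     [log_bound]. *)
  set (X := T + 3). set (H := 2 * l ^ 3).
  assert (HU : forall z, orect (- eta) X (- H) H z ->
     sigmaL < Re (1 + z)%C /\ 1 - delta / 7 < Re (1 + z)%C /\ Rabs (Im (1 + z)%C) <= 2 * l ^ 3).
  { intros z [H1 H2]. change (Re (1 + z)%C) with (1 + Re z).
    replace (Im (1 + z)%C) with (Im z) by (unfold Im, RtoC; simpl; ring).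
    split; [unfold eta in *; lra|]. split; [unfold eta in *; lra|]. apply Rabs_le. unfold H in *. lra. }
  destruct (log_tail_bound b mu Hmu Hb_holo Hb_le a Ha_le Hb_main (fun z => L (1 + z)%C)
      eta eta' T X H (K1 * l) Y) as [E [E1 E2]]; try assumption.
  - unfold eta'. lra.
  - unfold eta'. lra.
  - lra.
  - lra.
  - unfold X. lra.
  - unfold H. lra.
  - apply Rmult_le_pos; lra.
  - intros z Hz. destruct (HU z Hz) as [U1 _]. destruct (HL (1 + z)%C) as [d Hd']; [lra|].
    eexists. apply (cderiv_comp L (fun z => 1 + z)%C); [exact Hd'|].
    apply cderiv_plus; [apply cderiv_const | apply cderiv_id].
  - intros z Hz. destruct (HU z Hz) as [_ [U2 U3]]. apply Hnz.
    destruct (Rle_dec 1 (Re (1 + z)%C)); [left; assumption | right; split; [split; [unfold eta; lra|apply Rnot_le_lt; assumption]|exact U3]].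
  - intros z _ Hz. now apply Hcv.
  - intros z Hz Hz3. destruct (HU z Hz) as [U1 [U2 U3]].
    eapply Rle_trans; [apply Hgr; split; [exact U1 | change (1 + Re z < 4); lra]|].
    set (t := Rabs (Im (1 + z)%C)) in *.
    assert (Ht0 : 0 <= t) by apply Rabs_pos.
    apply Rle_trans with (exp (ln K) * exp (gamma1 * l) * exp (gamma2 * (5 * ln l))).
    + rewrite exp_ln by exact HK. apply Rmult_le_compat_l.
      * apply Rmult_le_pos; [lra | left; apply exp_pos].
      * unfold Rpower. assert (Q : ln (1 + t) <= 5 * ln l).
        { replace (5 * ln l) with (INR 5 * ln l) by (simpl; ring).
          rewrite <- ln_pow by lra.
          assert (1 + t <= l ^ 5).
          { replace (l ^ 5) with (l ^ 3 * (l * l)) by ring.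
            assert (l ^ 3 * 4 <= l ^ 3 * (l * l)) by (apply Rmult_le_compat_l; nra). lra. }
          destruct (Rle_lt_or_eq_dec _ _ H0) as [Q|Q]; [left; apply ln_increasing; lra | right; now f_equal]. }
        assert (Q2 : gamma2 * ln (1 + t) <= gamma2 * (5 * ln l)) by (apply Rmult_le_compat_l; lra).
        destruct (Rle_lt_or_eq_dec _ _ Q2) as [Q3|Q3]; [left; now apply exp_increasing | right; now rewrite Q3].
    + rewrite <- !exp_plus. assert (Q : ln K + gamma1 * l + gamma2 * (5 * ln l) <= K1 * l).
      { unfold K1. pose proof (Rle_abs (ln K)). pose proof (Rabs_pos (ln K)).
        pose proof (ln_le_self l ltac:(lra)).
        assert (gamma2 * (5 * ln l) <= gamma2 * (5 * l)) by (apply Rmult_le_compat_l; lra).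
        assert (Rabs (ln K) <= Rabs (ln K) * l) by nra. lra. }
      destruct (Rle_lt_or_eq_dec _ _ Q) as [Q3|Q3]; [left; now apply exp_increasing | right; now rewrite Q3].
  - set (P := Rpower l (- / 8)).
    assert (HP0 : 0 < P) by apply exp_pos.
    assert (HP1 : P <= 1) by (apply Rpower_neg_le_1; lra).
    assert (HE : Cmod E <= C2 * P).
    { eapply Rle_trans; [exact E2|].
      eapply Rle_trans; [apply (error_bound l A eta Hl Heta HA' mu C1); [exact Hmu | exact HC1|]|].
      (* Only the term with [K1] carries a factor [l]; the others are enlarged by that factor to fit
         under [C1 * l]. *)
      - unfold C1. set (q := 8 / (eta - eta')) in *. set (q' := 4 * mu / (1 - 2 * eta')) in *.
        assert (mu <= mu * l) by nra. assert (q' <= q' * l) by nra.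
        assert (q * (2 * (K1 * l) + 4 * mu) <= q * ((2 * K1 + 4 * mu) * l)) by (apply Rmult_le_compat_l; lra).
        lra.
      - fold P. apply Rmult_le_compat_r; [lra|]. unfold C2, eta'. lra. }
    assert (HE1 : Cmod E <= C2) by nra.
    exists (Cexp E - 1)%C. split.
    + eapply Rle_trans; [apply Cexp_minus_1_le|].
      assert (L0 : 0 < ln l) by (rewrite <- ln_1; apply ln_increasing; lra).
      pose proof (decay_le_inv_ln l Hl) as Q. fold P in Q.
      replace (8 * C2 * exp C2 / ln l) with (C2 * (8 / ln l) * exp C2) by (field; lra).
      apply Rmult_le_compat; [apply Cmod_ge_0 | left; apply exp_pos | |].
      * eapply Rle_trans; [exact HE|]. apply Rmult_le_compat_l; lra.
      * destruct (Rle_lt_or_eq_dec _ _ HE1) as [Q3|Q3]; [left; now apply exp_increasing | right; now rewrite Q3].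
    + rewrite Cplus_0_r in E1. rewrite E1. ring.
Qed.

From HB Require Import structures.
From mathcomp Require Import ssreflect ssrfun ssrbool eqtype ssrnat seq fintype bigop prime.
Set Bullet Behavior "Strict Subproofs".

(** * Euler products over the primes *)

(** The products of the statement are bare iterated operations; [big_mkcond] and [big_nat_recr] ask
    for the monoid law. *)
HB.instance Definition _ :=
  Monoid.isLaw.Build C (RtoC 1) Cmult Cmult_assoc Cmult_1_l Cmult_1_r.

Definition ord_sum {m : nat} (f : 'I_m -> C) : C := \big[Cplus/RtoC 0]_(j < m) f j.

Lemma ord_sum0 (f : 'I_0 -> C) : ord_sum f = RtoC 0.
Proof. exact: big_ord0. Qed.

Lemma ord_sumS (m : nat) (f : 'I_m.+1 -> C) :
  ord_sum f = (f ord0 + ord_sum (fun j : 'I_m => f (lift ord0 j)))%C.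
Proof. exact: big_ord_recl. Qed.

Lemma ord_sum_norm_le (m : nat) (f : 'I_m -> C) (B : R) :
  (forall j, Cmod (f j) <= B) -> Cmod (ord_sum f) <= INR m * B.
Proof.
  elim: m f => [|m IH] f Hf.
  - rewrite ord_sum0 Cmod_0 /=. lra.
  - rewrite ord_sumS S_INR. apply: Rle_trans; first exact: Cmod_triangle.
    have H1 := Hf ord0. have H2 := IH (fun j => f (lift ord0 j)) (fun j => Hf (lift ord0 j)). lra.
Qed.

Lemma ord_sum_minus_mul (m : nat) (f g : 'I_m -> C) (w : C) :
  (ord_sum f - ord_sum g * w)%C = ord_sum (fun j => f j - g j * w)%C.
Proof.
  elim: m f g => [|m IH] f g.
  - rewrite !ord_sum0. ring.
  - rewrite !ord_sumS -IH. ring.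
Qed.

Lemma ord_sum_cderiv (m : nat) (f : 'I_m -> C -> C) (z : C) :
  (forall j, exists l, cderiv (f j) z l) ->
  exists l, cderiv (fun w => ord_sum (fun j => f j w)) z l.
Proof.
  elim: m f => [|m IH] f Hf.
  - exists (RtoC 0). apply: (cderiv_ext (fun _ => RtoC 0)); last exact: cderiv_const.
    by move=> w; rewrite ord_sum0.
  - case: (Hf ord0) => l Hl. case: (IH _ (fun j => Hf (lift ord0 j))) => l' Hl'.
    exists (l + l')%C.
    apply: (cderiv_ext (fun w => f ord0 w + ord_sum (fun j : 'I_m => f (lift ord0 j) w))%C).
    + by move=> w; rewrite ord_sumS.
    + exact: cderiv_plus.
Qed.

Section EulerLog.

Context {m : nat} (c : 'I_m -> nat -> C).
Hypothesis (Hc : forall j p, prime p -> Cmod (c j p) <= 1).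

(** The coefficient of [p^(-s)] in the logarithm of the Euler product. Extending it by zero makes
    sums over primes into sums over all integers, as [csum] requires. *)
Definition prime_coef (p : nat) : C := if prime p then ord_sum (fun j => c j p) else RtoC 0.

Definition euler_log (p : nat) (z : C) : C :=
  if prime p then ord_sum (fun j => - clog (1 - c j p * npow p (- (1 + z))))%C else RtoC 0.

Lemma prime_ge2 (p : nat) : prime p -> Peano.le 2 p.
Proof. by move=> /prime_gt1 /leP. Qed.

Lemma euler_log_holo (p : nat) (z : C) : - / 2 < Re z -> exists l, cderiv (euler_log p) z l.
Proof.
  move=> Hz. rewrite /euler_log. case Hp: (prime p).
  - apply: ord_sum_cderiv => j. apply: euler_term_holo; [exact: Hc | exact: prime_ge2 | lra].
  - exists (RtoC 0). exact: cderiv_const.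
Qed.

Lemma Rpower_pos (x y : R) : 0 < Rpower x y.
Proof. exact: exp_pos. Qed.

Lemma euler_log_le (p : nat) (z : C) : - / 2 <= Re z ->
  Cmod (euler_log p z) <= 4 * INR m * Rpower (INR p) (- (1 + Re z)).
Proof.
  move=> Hz. rewrite /euler_log. have := pos_INR m. have := Rpower_pos (INR p) (- (1 + Re z)).
  case Hp: (prime p) => H1 H2.
  - rewrite (Rmult_comm 4) Rmult_assoc. apply: ord_sum_norm_le => j.
    apply: euler_term_le; [exact: Hc | exact: prime_ge2 | exact: Hz].
  - rewrite Cmod_0. apply: Rmult_le_pos; lra.
Qed.

Lemma prime_coef_le (p : nat) : Cmod (prime_coef p) <= INR m.
Proof.
  rewrite /prime_coef. have := pos_INR m. case Hp: (prime p) => H2.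
  - rewrite -[X in _ <= X]Rmult_1_r. apply: ord_sum_norm_le => j. exact: Hc.
  - by rewrite Cmod_0.
Qed.

Lemma euler_log_main (p : nat) (z : C) : - / 2 <= Re z ->
  Cmod (euler_log p z - prime_coef p * npow p (- (1 + z)))
    <= 4 * INR m * Rpower (INR p) (- (2 * (1 + Re z))).
Proof.
  move=> Hz. rewrite /euler_log /prime_coef. have := pos_INR m.
  have := Rpower_pos (INR p) (- (2 * (1 + Re z))).
  case Hp: (prime p) => H1 H2.
  - rewrite ord_sum_minus_mul (Rmult_comm 4) Rmult_assoc. apply: ord_sum_norm_le => j.
    apply: euler_term_main; [exact: Hc | exact: prime_ge2 | exact: Hz].
  - have -> : (0 - 0 * npow p (- (1 + z)))%C = RtoC 0 by ring.
    rewrite Cmod_0. apply: Rmult_le_pos; lra.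
Qed.

(** Moving the primality test into the factor gives 1 at non-primes, in accordance with the value 0
    of [euler_log] there. The product begins at index 0 and [csum] at 1, which agree as 0 is not
    prime. *)
Lemma euler_upto_exp (z : C) (n : nat) : - / 2 <= Re z ->
  euler_upto c (1 + z) n = Cexp (csum (fun p => euler_log p z) n).
Proof.
  move=> Hz. rewrite /euler_upto big_mkcond /=. elim: n => [|n IH].
  - by rewrite big_nat1 /= Cexp_0.
  - rewrite big_nat_recr //= IH Cexp_plus /euler_log. congr (_ * _)%C.
    case Hp: (prime n.+1); last by rewrite Cexp_0.
    rewrite /euler_factor /ord_sum (big_morph Cexp Cexp_plus Cexp_0).
    apply: eq_bigr => j _. symmetry.
    apply: euler_term_exp; [exact: Hc | exact: prime_ge2 | exact: Hz].
Qed.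

End EulerLog.

(** Balls of [C_UniformSpace] are squares: each coordinate is controlled separately, hence the
    radius [e / 2]. *)
Lemma filterlim_ccv (u : nat -> C) (l : C) :
  filterlim u eventually (locally (T := C_UniformSpace) l) -> ccv u l.
Proof.
  move=> /filterlim_locally H e He. have He2 : 0 < e / 2 by lra.
  case: (H (mkposreal _ He2)) => N HN. exists N => n Hn.
  case: (HN n Hn) => H1 H2. apply: Rle_trans; first exact: Cmod_le_re_im.
  have H1' : Rabs (Re (u n - l)%C) < e / 2 by exact: H1.
  have H2' : Rabs (Im (u n - l)%C) < e / 2 by exact: H2. lra.
Qed.

(* K is the constant implied in (iii), B the one implied in the conclusion. *)
Theorem theorem1 :
  forall (m : nat) (gamma1 gamma2 K delta A : R),
    (1 <= m)%N ->
    (0 < gamma1)%R -> (0 < gamma2)%R -> (0 < K)%R ->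
    (0 < delta < 7 / 2)%R ->
    (14 / delta <= A)%R ->
  exists B : R, (0 < B)%R /\
  forall (c : 'I_m -> nat -> C) (L : C -> C) (N : nat) (sigmaL : R),
    (forall (j : 'I_m) (p : nat), prime p -> (Cmod (c j p) <= 1)%R) ->
    (forall s : C, (1 < Re s)%R -> is_euler_product c s (L s)) ->
    (16 <= N)%N ->
    (1 / 2 <= sigmaL < 1)%R ->
    (delta < 7 * (1 - sigmaL))%R ->
    holomorphic_on (fun s : C => (sigmaL <= Re s)%R) L ->
    (forall s : C, zero_free_region delta N s -> L s <> RtoC 0) ->
    (forall s : C, (sigmaL < Re s < 4)%R ->
       (Cmod (L s) <=
          K * Rpower (INR N) gamma1 * Rpower (1 + Rabs (Im s)) gamma2)%R) ->
  exists eps : C,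
    (Cmod eps <= B / ln (ln (INR N)))%R /\
    L (RtoC 1) =
      ((1 + eps) *
         euler_upto c (RtoC 1) (natfloor (Rpower (ln (INR N)) A)))%C.
Proof.
  move=> m gamma1 gamma2 K delta A _ Hg1 Hg2 HK Hd HA.
  case: (euler_product_at_1 (INR m) gamma1 gamma2 K delta A (pos_INR m) Hg1 Hg2 HK Hd HA) => B [HB H].
  exists B. split=> // c L N sigmaL Hc HL HN _ HsL [U [_ [HU HLU]]] Hnz Hgr.
  (* The vanishing of [euler_log] at 1 is closed by evaluating [prime 1]; the zero-free region and
     the growth bound are hypotheses up to unfolding. *)
  case: (H (euler_log c) (prime_coef c) L (INR N) sigmaL) => //.
  - move=> k z Hz. exact: euler_log_holo.
  - move=> k z _ Hz. exact: euler_log_le.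
  - move=> k. exact: prime_coef_le.
  - move=> k z _ Hz. exact: euler_log_main.
  - move=> k. rewrite /prime_coef. case Hp: (prime k); [right; exact: prime_ge2 | by left].
  - move=> z Hz. have Hz1 : 1 < Re (1 + z)%C by change (1 < 1 + Re z); lra.
    have cv := filterlim_ccv _ _ (HL _ Hz1). move=> e He. case: (cv e He) => M HM. exists M => n Hn.
    rewrite -euler_upto_exp; [exact: HM | exact: Hc | lra].
  - have -> : 16 = INR 16 by rewrite INR_IZR_INZ. apply: le_INR. exact/leP.
  (* The closed half-plane lies in an open set on which [L] is differentiable, so a full complex
     derivative exists even on the line [Re s = sigmaL]. *)
  - move=> s Hs. apply: cderiv_of_is_derive. exact: HLU (HU s Hs).
  - move=> eps [H1 H2]. exists eps. split=> //. rewrite H2.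
    have E1 : (1 + 0)%C = RtoC 1 by ring.
    rewrite -(euler_upto_exp c Hc 0) ?E1 //. rewrite /Re /=. lra.
Qed.
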